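(* Consider pairs $(m,\chi)$ where $0\neq m\in\mathfrak{sl}_2(F)$ and $\chi$ is a character of $Z_G(m)$ such that: (a) $V_{m,\chi}^{K_\epsilon}$ is finite-dimensional and the action of $T_x$ on it does not depend on $x\in\kappa$. In other words, if $m$ is nilpotent then it is assumed that $\chi\neq 1$, while if $m$ has an eigenvalue $c$ in $F\smallsetminus\{0\}$ and $\mathfrak{c}(\chi)=0$ then it is assumed that $\mathfrak{v}(c)\neq 0$; (b) if $m$ has an eigenvalue in $F\smallsetminus\{0\}$ and $\mathfrak{c}(\chi)=0$, then it is assumed that $|z|=1$ for all $z\in\mathrm{Im}(\chi)$. Then all eigenvalues of the action of $T_0$ on $V_{m,\chi}^{K_\epsilon}$ have algebraic multiplicity $1$, are real, and lie in the interval $[-2q^{1/2},2q^{1/2}]$. Denote by $\Lambda_{m,\chi}$ the set of these eigenvalues. Given a sequence $(m_n,\chi_n)$ of such pairs for which $\lim_{n\to\infty}\dim V_{m_n,\chi_n}^{K_\epsilon}=\infty$, and given any $f\in C_c(\mathbb{R})$, we have $$\lim_{n\to\infty}\frac{1}{|\Lambda_{m_n,\chi_n}|}\sum_{\lambda\in\Lambda_{m_n,\chi_n}}f\left(\frac{\lambda}{2q^{1/2}}\right)=\frac{1}{\pi}\int_{-1}^{1}\frac{f(x)\,dx}{\sqrt{1-x^2}}.$$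
   Context: $F$ is a non-Archimedean local field of characteristic different from $2$, $\mathcal{O}$ its ring of integers, $\varpi$ a generator of the maximal ideal, $\mathfrak{v}:F^\times\to\mathbb{Z}$ the valuation, $\kappa=\mathcal{O}/\varpi\mathcal{O}$, $q=|\kappa|$. For a ring $A$, $A_\epsilon:=A[\epsilon]/(\epsilon^2)$. Put $G=\mathrm{PGL}_2(F)$, $K=\mathrm{PGL}_2(\mathcal{O})$, $G_\epsilon=\mathrm{PGL}_2(F_\epsilon)$, $K_\epsilon=\mathrm{PGL}_2(\mathcal{O}_\epsilon)$, $\mathfrak{g}=\mathfrak{sl}_2(F)$. Elements of $\mathrm{PGL}_2$ are written as matrices in $\mathrm{GL}_2$. One has $G_\epsilon=(1+\epsilon\mathfrak{g})\rtimes G$. Hecke operators: for $x\in\kappa$ with a lift $\tilde x\in\mathcal{O}$, let $g_x=\begin{pmatrix}\varpi+\epsilon\tilde x&0\\0&1\end{pmatrix}\in G_\epsilon$; the double coset $K_\epsilon g_xK_\epsilon$ does not depend on the lift. $T_x:=q^{-1}\,\mathrm{ch}_{K_\epsilon g_xK_\epsilon}$ in the Hecke algebra of $(G_\epsilon,K_\epsilon)$ (Haar measure with $\mathrm{vol}(K_\epsilon)=1$); on the $K_\epsilon$-invariants $V^{K_\epsilon}$ of a smooth representation $V$ of $G_\epsilon$ it acts by $T_xv=q^{-1}\sum_{gK_\epsilon\subset K_\epsilon g_xK_\epsilon}gv$. Representations: fix an additive character $\psi_0:F\to\mathrm{U}(1)$ with $\{x\in F:\psi_0|_{x\mathcal{O}}=1\}=\mathcal{O}$,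 and for $m\in\mathfrak{g}$ let $\psi_m(m')=\psi_0(\mathrm{tr}(mm'))$ for $m'\in\mathfrak{g}$. $Z_G(m)$ is the stabilizer of $m$ in $G$ under conjugation. A character is a smooth homomorphism to $\mathbb{C}^\times$. For a character $\chi$ of $Z_G(m)$, $V_{m,\chi}$ is the space of smooth functions $f:G_\epsilon\to\mathbb{C}$ such that $f((1+\epsilon m')g)=\psi_m(m')f(g)$ for $m'\in\mathfrak{g}$, $g\in G$; $f(zg)=\chi(z)f(g)$ for $z\in Z_G(m)$, $g\in G$; and the support of $f|_G$ is compact modulo left translation by $Z_G(m)$. $G_\epsilon$ acts by right translation. If $m$ has an eigenvalue $c\in F\smallsetminus\{0\}$, then after conjugation $m=\mathrm{diag}(c,-c)$ and $Z_G(m)=\{\mathrm{diag}(x,1):x\in F^\times\}\cong F^\times$; $\mathfrak{c}(\chi)$ denotes the conductor of $\chi$ viewed as a character of $F^\times$, i.e. the smallest $\ell\ge 0$ such that $\chi$ is trivial on $\mathcal{O}^\times$ (if $\ell=0$) or on $1+\varpi^\ell\mathcal{O}$ (if $\ell\ge1$). *)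

(* Defs.v *)
From HB Require Import structures.
From mathcomp Require Import all_boot all_order all_algebra.
From mathcomp Require Import finmap complex.
From mathcomp Require Import all_classical all_reals all_analysis.

Set Implicit Arguments.
Unset Strict Implicit.
Unset Printing Implicit Defensive.

Import Order.TTheory GRing.Theory Num.Theory.
Import numFieldNormedType.Exports.

Local Open Scope classical_set_scope.
Local Open Scope ring_scope.
Local Open Scope quotient_scope.

(* The valuation is a total function; its value at 0 is irrelevant and
   [vge v N x] is the condition v(x) >= N with the convention v(0) = +oo. *)
Definition vge (F : fieldType) (v : F -> int) (N : int) : set F :=
  [set x | x = 0 \/ N <= v x].

Definition residue_classes (F : fieldType) (v : F -> int) : set (set F) :=
  [set [set y | vge v 1 (y - x)] | x in vge v 0].

Record localField := LocalField {
  lf_field :> fieldType;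
  lf_val : lf_field -> int;
  lf_valM : forall x y, x != 0 -> y != 0 ->
    lf_val (x * y) = lf_val x + lf_val y;
  lf_valD : forall x y, x != 0 -> y != 0 -> x + y != 0 ->
    Num.min (lf_val x) (lf_val y) <= lf_val (x + y);
  lf_val_normalized : exists2 x, x != 0 & lf_val x = 1;
  lf_complete : forall u : nat -> lf_field,
    (forall N, exists n0, forall m n, (n0 <= m)%N -> (n0 <= n)%N ->
       vge lf_val N (u m - u n)) ->
    exists l, forall N, exists n0, forall n, (n0 <= n)%N ->
       vge lf_val N (u n - l);
  lf_finite_residue : finite_set (residue_classes lf_val)
}.

Section LocalFieldDefs.
Variable F : localField.

Definition ge_val (N : int) : set F := vge (@lf_val F) N.
Definition integers : set F := ge_val 0.
Definition integer_units : set F := [set x | x != 0 /\ lf_val x = 0].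
Definition is_uniformizer (x : F) := x != 0 /\ lf_val x = 1.
Definition residue_card : nat := #|` fset_set (residue_classes (@lf_val F))|.

End LocalFieldDefs.
Arguments integers : clear implicits.
Arguments integer_units : clear implicits.

(* GL_2(A) modulo the units of A; this is PGL_2(A) when A is a field or a local
   ring, in particular for A = F and A = F[eps]/(eps^2). *)
Definition GL2 (A : comUnitRingType) := {M : 'M[A]_2 | M \in unitmx}.
HB.instance Definition _ (A : comUnitRingType) := Choice.on (GL2 A).

Section PGL2.
Variable A : comUnitRingType.
Implicit Types M N : 'M[A]_2.

Definition GL2_one : GL2 A := exist _ 1%:M (unitmx1 _ _).

Definition GL2_homothetic (M N : GL2 A) : bool :=
  `[< exists2 u : A, u \is a GRing.unit & val M = u *: val N >].

Lemma GL2_homothetic_equiv : equiv_class_of GL2_homothetic.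
Proof.
split=> [M|M N|N M P].
- by apply/asboolP; exists 1; rewrite ?unitr1 ?scale1r.
- apply/asboolP/asboolP => -[u uu ->]; exists u^-1; rewrite ?unitrV //;
  by rewrite scalerA mulVr ?scale1r.
- move=> /asboolP[u uu MN] /asboolP[w uw NP]; apply/asboolP.
  by exists (u * w); rewrite ?unitrM ?uu ?uw // MN NP scalerA.
Qed.

Canonical GL2_homothety := EquivRelPack GL2_homothetic_equiv.

Definition PGL2 := {eq_quot GL2_homothety}.
HB.instance Definition _ := Choice.on PGL2.

(* The class of a matrix in PGL_2 (1 if the matrix is not invertible). *)
Definition pgl M : PGL2 := \pi_({eq_quot GL2_homothety}) (insubd GL2_one M).

Definition pgl_mx (x : PGL2) : 'M[A]_2 :=
  val (repr (x : {eq_quot GL2_homothety})).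

Lemma pgl_mx_unit x : pgl_mx x \in unitmx.
Proof. exact: valP (repr _). Qed.

Lemma pgl_mxK : cancel pgl_mx pgl.
Proof. by move=> x; rewrite /pgl /pgl_mx valKd reprK. Qed.

Lemma eq_pgl M N : M \in unitmx -> N \in unitmx ->
  pgl M = pgl N <-> exists2 u, u \is a GRing.unit & M = u *: N.
Proof.
move=> uM uN; rewrite /pgl; split.
  by move=> /eqquotP/asboolP; rewrite !insubdK.
by move=> h; apply/eqquotP/asboolP; rewrite !insubdK.
Qed.

Lemma pglK M : M \in unitmx ->
  exists2 u, u \is a GRing.unit & pgl_mx (pgl M) = u *: M.
Proof. by move=> uM; apply/eq_pgl; rewrite ?pgl_mx_unit ?pgl_mxK. Qed.

Definition pgl_mul (x y : PGL2) : PGL2 := pgl (pgl_mx x *m pgl_mx y).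
Definition pgl_inv (x : PGL2) : PGL2 := pgl (invmx (pgl_mx x)).
Definition pgl_one : PGL2 := pgl 1%:M.

Lemma pgl_mulE M N : M \in unitmx -> N \in unitmx ->
  pgl_mul (pgl M) (pgl N) = pgl (M *m N).
Proof.
move=> uM uN; apply/eq_pgl; rewrite ?unitmx_mul ?pgl_mx_unit ?uM ?uN //.
have [u uu ->] := pglK uM; have [w uw ->] := pglK uN.
by exists (u * w); rewrite ?unitrM ?uu // -scalemxAl -scalemxAr scalerA.
Qed.

Lemma pgl_mulA : associative pgl_mul.
Proof.
move=> x y z; rewrite -[x]pgl_mxK -[y]pgl_mxK -[z]pgl_mxK.
by rewrite !pgl_mulE ?unitmx_mul ?pgl_mx_unit // mulmxA.
Qed.

Lemma pgl_mul1 : left_id pgl_one pgl_mul.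
Proof. by move=> x; rewrite -[x]pgl_mxK pgl_mulE ?unitmx1 ?pgl_mx_unit ?mul1mx. Qed.

Lemma pgl_1mul : right_id pgl_one pgl_mul.
Proof. by move=> x; rewrite -[x]pgl_mxK pgl_mulE ?unitmx1 ?pgl_mx_unit ?mulmx1. Qed.

Lemma pgl_mulV : left_inverse pgl_one pgl_inv pgl_mul.
Proof.
move=> x; rewrite -[x in pgl_mul _ x]pgl_mxK.
by rewrite pgl_mulE ?unitmx_inv ?pgl_mx_unit // mulVmx ?pgl_mx_unit.
Qed.

Lemma pgl_Vmul : right_inverse pgl_one pgl_inv pgl_mul.
Proof.
move=> x; rewrite -[x in pgl_mul x _]pgl_mxK.
by rewrite pgl_mulE ?unitmx_inv ?pgl_mx_unit // mulmxV ?pgl_mx_unit.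
Qed.

HB.instance Definition _ := isGroup.Build PGL2
  pgl_mulA pgl_mul1 pgl_1mul pgl_mulV pgl_Vmul.

End PGL2.

Section Groups.
Variable F : localField.

Definition dual : comUnitRingType := {poly %/ ('X^2 : {poly F})}.

Definition eps : dual := 'qX.
Definition dualC : F -> dual := qpolyC ('X^2).

Definition dual_ge_val (N : int) : set dual :=
  [set a : dual | ge_val N (a : {poly F})`_0 /\ ge_val N (a : {poly F})`_1].

Definition G : Type := PGL2 F.
HB.instance Definition _ := Group.on G.

Definition Geps : Type := PGL2 dual.
HB.instance Definition _ := Group.on Geps.

(* Given a neighbourhood basis [nb] of 0 in A: the open sets of the quotient
   topology on PGL_2(A) induced by the product topology on 2x2 matrices. *)
Definition pgl_open (A : comUnitRingType) (nb : int -> set A) :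
    set_system (PGL2 A) :=
  [set U | forall M : 'M[A]_2, M \in unitmx -> U (pgl M) ->
     exists n : int, forall N : 'M[A]_2, N \in unitmx ->
       (forall i j, nb n (N i j - M i j)) -> U (pgl N)].

Section OpenSets.
Variables (A : comUnitRingType) (nb : int -> set A).
Hypothesis nb_decr : forall m n, m <= n -> nb n `<=` nb m.

Lemma pgl_openT : pgl_open nb setT.
Proof. by move=> M _ _; exists 0. Qed.

Lemma pgl_openI : setI_closed (pgl_open nb).
Proof.
move=> U V oU oV M uM [UM VM].
have [m hm] := oU M uM UM; have [n hn] := oV M uM VM.
exists (Num.max m n) => N uN NM; split.
- by apply: hm => // i j; apply: nb_decr (NM i j); rewrite le_max lexx.
- by apply: hn => // i j; apply: nb_decr (NM i j); rewrite le_max lexx orbT.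
Qed.

Lemma pgl_open_bigU (I : Type) (f : I -> set (PGL2 A)) :
  (forall i, pgl_open nb (f i)) -> pgl_open nb (\bigcup_i f i).
Proof.
move=> of_ M uM [i _ fM]; have [n hn] := of_ i M uM fM.
by exists n => N uN NM; exists i => //; exact: hn.
Qed.

End OpenSets.

Lemma ge_val_decr m n : m <= n -> ge_val n `<=` @ge_val F m.
Proof. by move=> mn x [->|h]; [left|right; exact: le_trans h]. Qed.

Lemma dual_ge_val_decr m n : m <= n -> dual_ge_val n `<=` dual_ge_val m.
Proof. by move=> mn x [h0 h1]; split; exact: ge_val_decr mn _ _. Qed.

HB.instance Definition _ := isOpenTopological.Build G
  (pgl_openT (@ge_val F)) (pgl_openI ge_val_decr)
  (@pgl_open_bigU _ (@ge_val F)).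

HB.instance Definition _ := isOpenTopological.Build Geps
  (pgl_openT dual_ge_val) (pgl_openI dual_ge_val_decr)
  (@pgl_open_bigU _ dual_ge_val).

Definition incl (g : G) : Geps := pgl (map_mx dualC (pgl_mx g)).

Definition one_plus_eps (m : 'M[F]_2) : Geps :=
  pgl (1%:M + eps *: map_mx dualC m).

Definition diag2 (A : comUnitRingType) (a b : A) : 'M[A]_2 :=
  diag_mx (\row_i (if i == 0 then a else b)).

(* K_eps: the classes of the matrices which together with their inverse have
   entries in O_eps. *)
Definition Keps : set Geps :=
  [set g | exists M : 'M[dual]_2,
     [/\ M \in unitmx, forall i j, dual_ge_val 0 (M i j),
         forall i j, dual_ge_val 0 (invmx M i j) & g = pgl M]].

Definition stabilizer (m : 'M[F]_2) : set G :=
  [set g | pgl_mx g *m m *m invmx (pgl_mx g) = m].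

End Groups.

Arguments dual F : clear implicits.
Arguments Keps F : clear implicits.

Section LinearAlgebra.
Variables (K : fieldType) (V : lmodType K).
Implicit Types (W : set V) (T : V -> V).

Definition is_basis W n (e : 'I_n -> V) : Prop :=
  (forall i, W (e i)) /\
  (forall w, W w -> exists! c : 'rV[K]_n, w = \sum_i c 0 i *: e i).

Definition finite_dim W : Prop := exists n (e : 'I_n -> V), is_basis W e.

Definition dimension W : nat :=
  xget 0%N [set n | exists e : 'I_n -> V, is_basis W e].

(* It does not depend on the basis; the default 0 is only taken when W is not
   finite-dimensional or not stable under T. *)
Definition charpoly_on W T : {poly K} :=
  xget 0 [set p | exists n (e : 'I_n -> V) (M : 'M[K]_n),
    [/\ is_basis W e, forall j, T (e j) = \sum_i M i j *: e i
      & p = char_poly M]].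

Definition eigenvalues_on W T : set K :=
  [set l | exists w, [/\ W w, w != 0 & T w = l *: w]].

Definition alg_multiplicity W T (l : K) : nat := mup l (charpoly_on W T).

End LinearAlgebra.

Section Representations.
Variables (R : realType) (F : localField).
Local Notation C := R[i].
Implicit Types (m : 'M[F]_2) (chi : G F -> C) (psi : F -> C).

Definition locally_constant (X : topologicalType) (Y : Type) (f : X -> Y) :=
  forall x, \forall y \near x, f y = f x.

Definition additive_character psi : Prop :=
  [/\ forall x y, psi (x + y) = psi x * psi y,
      forall x, `|psi x| = 1
    & [set x | forall y, integers F y -> psi (x * y) = 1] = integers F].

(* chi is a smooth character of Z_G(m); only its values on Z_G(m) matter. *)
Definition stabilizer_character m chi : Prop :=
  [/\ forall z, stabilizer m z -> chi z != 0,
      forall z w, stabilizer m z -> stabilizer m w ->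
        chi (z * w)%g = chi z * chi w
    & forall z, stabilizer m z ->
        \forall w \near z, stabilizer m w -> chi w = chi z].

(* The set where a locally constant function does not vanish is closed, hence
   equal to its support. A closed set of G is compact modulo Z_G(m) iff it is
   covered by the translates of a compact set. *)
Definition Vrep psi m chi : set (Geps F -> C) :=
  [set f |
    [/\ locally_constant f,
        forall (m' : 'M[F]_2) (g : G F), \tr m' = 0 ->
          f (one_plus_eps m' * incl g)%g = psi (\tr (m *m m')) * f (incl g),
        forall z g, stabilizer m z ->
          f (incl z * incl g)%g = chi z * f (incl g)
      & exists2 D : set (G F), compact D &
          [set g | f (incl g) != 0] `<=`
          [set (z * d)%g | z in stabilizer m & d in D]]].

Definition VrepK psi m chi : set (Geps F -> C) :=
  [set f | Vrep psi m chi f /\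
           forall g k, Keps F k -> f (g * k)%g = f g].

Definition left_coset (g : Geps F) : set (Geps F) :=
  [set (g * k)%g | k in Keps F].

Definition double_coset (g : Geps F) : set (Geps F) :=
  [set (k * g * k')%g | k in Keps F & k' in Keps F].

Definition g_elt (varpi x : F) : Geps F :=
  pgl (diag2 (dualC varpi + eps F * dualC x) 1).

(* T_x, with x in O standing for its residue class. The choice of the coset
   representatives is irrelevant for right K_eps-invariant f. *)
Definition Hecke (varpi x : F) (f : Geps F -> C) : Geps F -> C :=
  fun h => (residue_card F)%:R^-1 *
    \sum_(c \in [set c | c `<=` double_coset (g_elt varpi x) /\
                         exists g, c = left_coset g])
      f (h * xget 1%g c)%g.

Definition unit_filtration (l : nat) : set F :=
  if l is 0%N then integer_units F else [set x | ge_val l%:Z (x - 1)].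

Definition is_conductor (eta : F -> C) (l : nat) : Prop :=
  (forall x, unit_filtration l x -> eta x = 1) /\
  (forall l', (forall x, unit_filtration l' x -> eta x = 1) -> (l <= l')%N).

(* In the last item m = h diag(c,-c) h^-1, so that Z_G(m) consists of the
   h diag(x,1) h^-1; the conductor does not depend on the choice of h and c. *)
Definition admissible (varpi : F) psi m chi : Prop :=
  [/\ m != 0 /\ \tr m = 0,
      stabilizer_character m chi,
      finite_dim (VrepK psi m chi),
      forall x y, integers F x -> integers F y ->
        forall f, VrepK psi m chi f -> Hecke varpi x f = Hecke varpi y f
    & forall (h : 'M[F]_2) (c : F), h \in unitmx -> c != 0 ->
        m = h *m diag2 c (- c) *m invmx h ->
        is_conductor (fun x => chi (pgl (h *m diag2 x 1 *m invmx h))) 0 ->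
        forall z, stabilizer m z -> `|chi z| = 1].

Definition Lambda (varpi : F) psi m chi : set C :=
  eigenvalues_on (VrepK psi m chi) (Hecke varpi 0).

End Representations.

Definition Cc (R : realType) (f : R -> R[i]^o) : Prop :=
  continuous f /\ compact (closure [set x | f x != 0]).

Definition complex_integral (R : realType) (D : set R) (f : R -> R[i]) : R[i] :=
  Complex (\int[lebesgue_measure]_(x in D) complex.Re (f x))
          (\int[lebesgue_measure]_(x in D) complex.Im (f x)).

(* Main.v *)
(** An element of [VrepK psi m chi] is determined by its restriction [phi] to
    [G]. Invariance under [1 + eps * Lie(K)] forces [phi g = 0] unless
    [M = g^-1 m g] is integral, and then [M] is a scalar modulo [varpi ^ k] for a
    largest [k], the level of [g]. The vertices [g K] of a given level form one
    orbit of [Z_G(m)], so that [phi] is a function of the level, and only the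
    levels [0, ..., n - 1] contribute. Below the last level, one of the [q + 1]
    neighbours of a vertex lies one level higher and the other [q] one level
    lower (or, at level [0], outside the support of [phi]). Hence [T_0] is a
    Jacobi matrix with off-diagonal entries [1] and [q], except that its last
    row ends in [be], [al], with [be > 0] and
    [|al| sqrt q <= 2 q - be].

    After the substitution [x = 2 sqrt q y] the characteristic polynomial
    becomes [(2 y - a) U_N - b U_(N-1)], with [U_k] the Chebyshev polynomials of
    the second kind, [N = n - 1], [b > 0] and [|a| <= 2 - b]. Its sign
    alternates at the points [cos (j pi / n)] for [j = 0, ..., n], so it has one
    root in each of the [n] intervals between them. This gives the
    multiplicities and the bound, and turns the average of [f] over the
    spectrum into a tagged Riemann sum of [f (cos t)] over [[0, pi]]. *)

Require Import Defs.
From HB Require Import structures.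
From mathcomp Require Import all_boot all_order all_algebra.
From mathcomp Require Import finmap complex.
From mathcomp Require Import all_classical all_reals all_analysis.
From mathcomp Require Import measurable_realfun.
From mathcomp Require Import ring lra zify.

Set Implicit Arguments.
Unset Strict Implicit.
Unset Printing Implicit Defensive.

Import Order.TTheory GRing.Theory Num.Theory.
Import numFieldNormedType.Exports.

Local Open Scope classical_set_scope.
Local Open Scope ring_scope.

(* [classical_sets] shadows the inclusion of [G F] in [Geps F]. *)
Local Notation incl := Defs.incl.

(** * Jacobi operators *)

(** Instead, once a scalar is removed and the power of the uniformizer given by the level is divided
    out, [M] is not scalar modulo the uniformizer; it therefore has a cyclic vector and becomes a
    companion matrix in a suitable basis of the lattice. At the last level the neighbours are sorted
    by the roots modulo the uniformizer of a quadratic polynomial: no root gives [al = 0] and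
    [be = q + 1], a double root gives [be = q] with [al] in {0, 1, -1}, two roots give [be = q - 1]
    and [al = x + x^-1] with [|x| = 1]. The tightest case of the bound on [al] is
    [2 sqrt q <= q + 1]. The factor [q^-1] in [T_0] compensates for the [q] lifts of each neighbour
    to cosets in [Geps], which contribute equally at integral vertices. No characteristic
    determinant is expanded: the recurrence gives an eigenvector for every root of the last
    equation, and [n] distinct eigenvalues exhaust the spectrum. *)

Section BasisTheory.
Variables (K : fieldType) (V : lmodType K).
Implicit Types (W : set V) (T : V -> V).

(** [W] is a bare set with unique coordinates, so dimension theory is rebuilt here: the coordinate
    matrix of more than [n] vectors has a nonzero left kernel. The lemma also serves to bound the
    number of levels that can occur. *)
Lemma basis_size_bound W n (e : 'I_n -> V) r (w : 'I_r -> V) :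
  is_basis W e -> (forall i, W (w i)) ->
  (forall c : 'I_r -> K, \sum_j c j *: w j = 0 -> forall i, c i = 0) -> (r <= n)%N.
Proof.
move=> [_ be] Ww free; rewrite leqNgt; apply/negP => ltnr.
have co i : {c : 'rV[K]_n | w i = \sum_j c 0 j *: e j}.
  by apply: cid; have [c [hc _]] := be _ (Ww i); exists c.
pose M : 'M[K]_(r, n) := \matrix_(i, j) sval (co i) 0 j.
have : kermx M != 0.
  rewrite kermx_eq0 /row_free neq_ltn; apply/orP; left.
  exact: leq_ltn_trans (rank_leq_col M) ltnr.
case/rowV0Pn => u /sub_kermxP uM; case/rV0Pn => i; case/eqP; apply: (free (fun j => u 0 j)).
transitivity (\sum_k (u *m M) 0 k *: e k); last first.
  by rewrite uM big1 // => k _; rewrite mxE scale0r.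
under eq_bigr => j _ do rewrite (svalP (co j)) scaler_sumr.
rewrite exchange_big; apply: eq_bigr => k _; rewrite mxE scaler_suml.
by apply: eq_bigr => j _; rewrite scalerA mxE.
Qed.

Lemma basis_free W n (e : 'I_n -> V) : W 0 -> is_basis W e ->
  forall c : 'I_n -> K, \sum_j c j *: e j = 0 -> forall i, c i = 0.
Proof.
move=> W0 [_ be] c hc i; have [d [hd ud]] := be _ W0.
have h1 : d = \row_j c j.
  by apply: ud; rewrite -[LHS]hc; apply: eq_bigr => j _; rewrite mxE.
have h2 : d = 0 by apply: ud; rewrite big1 // => j _; rewrite mxE scale0r.
have -> : c i = d 0 i by rewrite h1 mxE.
by rewrite h2 mxE.
Qed.

Lemma basis_size_uniq W n (e : 'I_n -> V) n' (e' : 'I_n' -> V) :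
  W 0 -> is_basis W e -> is_basis W e' -> n = n'.
Proof.
move=> W0 be be'; apply/eqP; rewrite eqn_leq.
rewrite (basis_size_bound be' be.1 (basis_free W0 be)).
by rewrite (basis_size_bound be be'.1 (basis_free W0 be')).
Qed.

(** [eigenvalue] concerns row vectors, whereas the images of the basis vectors are the columns of
    the matrix in [charpoly_on]. *)
Lemma char_poly_tr n (M : 'M[K]_n) : char_poly M^T = char_poly M.
Proof.
rewrite /char_poly -det_tr; congr (\det _).
by apply/matrixP => i j; rewrite !mxE eq_sym.
Qed.

Lemma eigenvalue_char_poly W T n (e : 'I_n -> V) (M : 'M[K]_n) (x : K) :
  W 0 -> is_basis W e ->
  (forall c : 'I_n -> K, T (\sum_i c i *: e i) = \sum_i c i *: T (e i)) ->
  (forall j, T (e j) = \sum_i M i j *: e i) ->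
  eigenvalues_on W T x -> root (char_poly M) x.
Proof.
move=> W0 be Tlin TM [w [Ww w0 Tw]]; rewrite -char_poly_tr -eigenvalue_root_char.
have [c [hc _]] := be.2 _ Ww; apply/eigenvalueP; exists c; last first.
  apply: contra_neq w0 => c0; rewrite hc c0 big1 // => j _; by rewrite mxE scale0r.
apply/rowP => i; apply/eqP; rewrite -subr_eq0; apply/eqP.
apply: (basis_free W0 be (c := fun i => (c *m M^T) 0 i - (x *: c) 0 i)).
under eq_bigr => j _ do rewrite scalerBl.
rewrite sumrB; apply/eqP; rewrite subr_eq0; apply/eqP.
transitivity (T w).
  rewrite hc Tlin; under [RHS]eq_bigr => j _ do rewrite TM scaler_sumr.
  rewrite exchange_big; apply: eq_bigr => j _; rewrite mxE scaler_suml.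
  by apply: eq_bigr => k _; rewrite scalerA mxE.
by rewrite Tw hc scaler_sumr; apply: eq_bigr => j _; rewrite scalerA mxE.
Qed.

(* Coordinates [l] in a basis [e] in which [T] is tridiagonal. *)
Record jacobi W T (n : nat) (q al be : K)
    (l : nat -> V -> K) (e : nat -> V) : Prop := Jacobi {
  jacobi_sum : forall c : nat -> K, W (\sum_(k < n) c k *: e k);
  jacobi_coord : forall (c : nat -> K) i, (i < n)%N ->
    l i (\sum_(k < n) c k *: e k) = c i;
  jacobi_span : forall w, W w -> w = \sum_(k < n) l k w *: e k;
  jacobi_stable : forall w, W w -> W (T w);
  jacobi_inner : forall w i, W w -> (i.+1 < n)%N ->
    l i (T w) = l i.+1 w + q * (if i is j.+1 then l j w else 0);
  jacobi_last : forall w i, W w -> i.+1 = n ->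
    l i (T w) = al * l i w + be * (if i is j.+1 then l j w else 0) }.

Variables (W : set V) (T : V -> V) (n : nat) (q al be : K).
Variables (l : nat -> V -> K) (e : nat -> V).
Hypothesis J : jacobi W T n q al be l e.

Lemma jacobi0 : W 0.
Proof.
have := jacobi_sum J (fun=> 0); rewrite big1 // => k _; exact: scale0r.
Qed.

Lemma jacobi_basis : is_basis W (fun i : 'I_n => e i).
Proof.
split=> [i|w Ww].
  have := jacobi_sum J (fun k => (k == i)%:R).
  rewrite (bigD1 i) //= eqxx scale1r big1 ?addr0 // => k ki.
  have -> : (k == i :> nat) = false by apply/negbTE.
  exact: scale0r.
exists (\row_(i < n) l i w); split.
  by rewrite {1}(jacobi_span J Ww); apply: eq_bigr => i _; rewrite mxE.
move=> c wc; apply/rowP => i; rewrite mxE.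
pose c' (k : nat) := if insub k is Some j then c 0 j else 0.
have c'E (k : 'I_n) : c' k = c 0 k by rewrite /c' valK.
rewrite wc (eq_bigr (fun k : 'I_n => c' k *: e k)); last by move=> k _; rewrite c'E.
by rewrite (jacobi_coord J) // c'E.
Qed.

Lemma jacobi_comb r (c : 'I_r -> K) (w : 'I_r -> V) : (forall i, W (w i)) ->
  \sum_i c i *: w i = \sum_(k < n) (\sum_i c i * l k (w i)) *: e k.
Proof.
move=> Ww; under eq_bigr => i _ do rewrite {1}(jacobi_span J (Ww i)) scaler_sumr.
rewrite exchange_big; apply: eq_bigr => k _; rewrite scaler_suml.
by apply: eq_bigr => i _; rewrite scalerA.
Qed.

(** [T] is an arbitrary map. Its linearity on [W] holds because the coordinates of [T w] are fixed
    linear expressions in those of [w]. *)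
Lemma jacobi_linear r (c : 'I_r -> K) (w : 'I_r -> V) : (forall i, W (w i)) ->
  T (\sum_i c i *: w i) = \sum_i c i *: T (w i).
Proof.
move=> Ww; have Wc : W (\sum_i c i *: w i).
  by rewrite (jacobi_comb c Ww); exact: (jacobi_sum J (fun k => \sum_i c i * l k (w i))).
have lc k : (k < n)%N -> l k (\sum_i c i *: w i) = \sum_i c i * l k (w i).
  move=> kn; rewrite (jacobi_comb c Ww).
  by rewrite (jacobi_coord J (fun k => \sum_i c i * l k (w i))).
have WT i : W (T (w i)) by exact/(jacobi_stable J).
rewrite (jacobi_span J (jacobi_stable J Wc)) (jacobi_comb c WT).
apply: eq_bigr => -[k kn] _ /=; congr (_ *: _).
have prevE : (if k is j.+1 then l j (\sum_i c i *: w i) else 0) =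
    \sum_i c i * (if k is j.+1 then l j (w i) else 0).
  case: k kn => [|k] kn; last by rewrite lc // ltnW.
  by rewrite big1 // => i _; rewrite mulr0.
have [kn'|kn'] := ltnP k.+1 n.
  rewrite (jacobi_inner J Wc kn') prevE lc // mulr_sumr -big_split.
  apply: eq_bigr => i _ /=; rewrite (jacobi_inner J (Ww i) kn') mulrDr; congr (_ + _).
  exact: mulrCA.
have ek : k.+1 = n by apply/eqP; rewrite eqn_leq kn.
rewrite (jacobi_last J Wc ek) prevE lc // !mulr_sumr -big_split.
apply: eq_bigr => i _ /=; rewrite (jacobi_last J (Ww i) ek) mulrDr.
by congr (_ + _); exact: mulrCA.
Qed.

(** The coordinates of an eigenvector for [x], normalised to 1 at level 0: each row but the last
    determines the next coordinate. *)
Fixpoint jacobi_vec (x : K) (k : nat) : K :=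
  match k with
  | 0 => 1
  | k'.+1 => x * jacobi_vec x k' - q * (if k' is j.+1 then jacobi_vec x j else 0)
  end.

(** The last row is the only equation that the recurrence leaves open, so the hypothesis is the
    characteristic equation. The eigenvector is nonzero because its coordinate at level 0 is 1. *)
Lemma jacobi_eigenvalue x N : n = N.+1 ->
  (x - al) * jacobi_vec x N = be * (if N is j.+1 then jacobi_vec x j else 0) ->
  eigenvalues_on W T x.
Proof.
move=> nN hx; pose w := \sum_(k < n) jacobi_vec x k *: e k.
have Ww : W w by exact: (jacobi_sum J (jacobi_vec x)).
have lw k : (k < n)%N -> l k w = jacobi_vec x k by exact: (jacobi_coord J).
have prevE k : (k < n)%N -> (if k is j.+1 then l j w else 0) =
    (if k is j.+1 then jacobi_vec x j else 0).
  by case: k => // k kn; rewrite lw // ltnW.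
exists w; split=> //.
  apply/eqP => w0; have := lw 0%N; rewrite nN => /(_ isT) /eqP; apply/negP.
  have := jacobi_coord J (fun=> 0) (i := 0%N); rewrite nN => /(_ isT).
  rewrite big1 => [|k _]; last exact: scale0r.
  by rewrite w0 => ->; rewrite eq_sym oner_neq0.
rewrite (jacobi_span J (jacobi_stable J Ww)) /w scaler_sumr.
apply: eq_bigr => -[k kn] _ /=; rewrite scalerA; congr (_ *: _).
have [kn'|kn'] := ltnP k.+1 n.
  rewrite (jacobi_inner J Ww kn') prevE // lw //=.
  by rewrite subrK.
have ek : k.+1 = n by apply/eqP; rewrite eqn_leq kn.
rewrite (jacobi_last J Ww ek) prevE // lw //.
have -> : k = N by move: ek; rewrite nN => -[].
by rewrite -hx -mulrDl addrC subrK.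
Qed.

Lemma prod_XsubC_mup (s : seq K) x : uniq s -> x \in s ->
  mup x (\prod_(z <- s) ('X - z%:P)) = 1%N.
Proof.
move=> us xs; rewrite (big_rem x) //= mupMl; last first.
  by rewrite root_prod_XsubC mem_rem_uniq // inE eqxx.
by have := mup_XsubCX 1 x x; rewrite expr1 eqxx.
Qed.

(** A monic polynomial of degree [n] with [n] distinct roots is the product of the linear factors.
    This is shown for the matrix in any basis, since [charpoly_on] chooses an unspecified one. *)
Lemma jacobi_spectrum (s : seq K) : uniq s -> size s = n ->
  (forall x, x \in s -> eigenvalues_on W T x) ->
  [/\ eigenvalues_on W T = [set` s],
      forall x, x \in s -> alg_multiplicity W T x = 1%N
    & dimension W = n].
Proof.
move=> us ss hs; have W0 := jacobi0.
have cp (e' : 'I_n -> V) (M : 'M[K]_n) : is_basis W e' ->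
    (forall j, T (e' j) = \sum_i M i j *: e' i) ->
    char_poly M = \prod_(z <- s) ('X - z%:P).
  move=> be' TM; have rt x : x \in s -> root (char_poly M) x.
    move=> /hs; apply: (eigenvalue_char_poly W0 be' _ TM) => c.
    by apply: jacobi_linear; exact: be'.1.
  rewrite [LHS](@all_roots_prod_XsubC _ _ s).
  - by rewrite (monicP (char_poly_monic M)) scale1r.
  - by rewrite size_char_poly ss.
  - exact/allP.
  - by rewrite uniq_rootsE.
have bas := jacobi_basis.
pose M : 'M[K]_n := \matrix_(i, j) l i (T (e j)).
have TM (j : 'I_n) : T (e j) = \sum_(i < n) M i j *: e i.
  rewrite [LHS](jacobi_span J); last exact/(jacobi_stable J)/bas.1.
  by apply: eq_bigr => i _; rewrite mxE.
split.
- apply/seteqP; split=> x; last exact: hs.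
  move=> /(eigenvalue_char_poly W0 bas _ TM); rewrite (cp _ _ bas TM) root_prod_XsubC.
  by apply=> c; apply: jacobi_linear; exact: bas.1.
- move=> x xs; rewrite /alg_multiplicity /charpoly_on.
  set P := [set p | _].
  have : P (xget 0 P) by apply: (@xgetPex _ 0 P); exists (char_poly M), n, (fun i : 'I_n => e i), M.
  case=> n' [e' [M' [be' TM' ->]]].
  have nn := basis_size_uniq W0 bas be'; subst n'.
  by rewrite (cp _ _ be' TM') prod_XsubC_mup.
- rewrite /dimension; set P := [set _ | _].
  have : P (xget 0%N P) by apply: (@xgetPex _ 0%N P); exists n, (fun i : 'I_n => e i).
  by move=> [e' be']; rewrite (basis_size_uniq W0 bas be').
Qed.

End BasisTheory.

(** * Local fields *)

Section Valuation.
Variable F : localField.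
Implicit Types (x y : F) (N : int).

Lemma lf_val1 : lf_val (1 : F) = 0.
Proof.
have := lf_valM (oner_neq0 F) (oner_neq0 F); rewrite mulr1 => /eqP.
by rewrite addrC -subr_eq subrr eq_sym => /eqP.
Qed.

Lemma lf_valN1 : lf_val (-1 : F) = 0.
Proof.
have n1 : (-1 : F) != 0 by rewrite oppr_eq0 oner_neq0.
have := lf_valM n1 n1; rewrite mulrNN mulr1 lf_val1 => h; lia.
Qed.

Lemma lf_valN x : lf_val (- x) = lf_val x.
Proof.
have [->|x0] := eqVneq x 0; first by rewrite oppr0.
rewrite -mulN1r lf_valM ?lf_valN1 ?add0r //.
by rewrite oppr_eq0 oner_neq0.
Qed.

Lemma lf_valV x : x != 0 -> lf_val x^-1 = - lf_val x.
Proof.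
move=> x0; have := lf_valM x0 (_ : x^-1 != 0).
by rewrite invr_eq0 divff // lf_val1 => /(_ x0) h; lia.
Qed.

Lemma ge_val0 N : ge_val N (0 : F). Proof. by left. Qed.

Lemma ge_valN N x : ge_val N x -> ge_val N (- x).
Proof. by move=> [->|h]; [left; rewrite oppr0|right; rewrite lf_valN]. Qed.

Lemma ge_valD N x y : ge_val N x -> ge_val N y -> ge_val N (x + y).
Proof.
move=> [->|hx]; first by rewrite add0r.
move=> [->|hy]; first by rewrite addr0; right.
have [->|x0] := eqVneq x 0; first by rewrite add0r; right.
have [->|y0] := eqVneq y 0; first by rewrite addr0; right.
have [xy|xy] := eqVneq (x + y) 0; first by left.
right; apply: le_trans (lf_valD x0 y0 xy); by rewrite le_min hx.
Qed.

Lemma ge_valB N x y : ge_val N x -> ge_val N y -> ge_val N (x - y).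
Proof. by move=> hx hy; apply: ge_valD => //; apply: ge_valN. Qed.

Lemma ge_valM M N x y : ge_val M x -> ge_val N y -> ge_val (M + N) (x * y).
Proof.
move=> [->|hx]; first by left; rewrite mul0r.
move=> [->|hy]; first by left; rewrite mulr0.
have [->|x0] := eqVneq x 0; first by left; rewrite mul0r.
have [->|y0] := eqVneq y 0; first by left; rewrite mulr0.
by right; rewrite lf_valM // lerD.
Qed.

Lemma ge_valMl N x y : integers F x -> ge_val N y -> ge_val N (x * y).
Proof. by move=> hx hy; rewrite -[N]add0r; apply: ge_valM. Qed.

Lemma ge_valMr N x y : ge_val N x -> integers F y -> ge_val N (x * y).
Proof. by move=> hx hy; rewrite -[N]addr0; apply: ge_valM. Qed.

Lemma integers0 : integers F 0. Proof. exact: ge_val0. Qed.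
Lemma integers1 : integers F 1. Proof. by right; rewrite lf_val1. Qed.
Lemma integersN x : integers F x -> integers F (- x). Proof. exact: ge_valN. Qed.
Lemma integersD x y : integers F x -> integers F y -> integers F (x + y).
Proof. exact: ge_valD. Qed.
Lemma integersB x y : integers F x -> integers F y -> integers F (x - y).
Proof. exact: ge_valB. Qed.
Lemma integersM x y : integers F x -> integers F y -> integers F (x * y).
Proof. exact: ge_valMl. Qed.
Lemma integersX x n : integers F x -> integers F (x ^+ n).
Proof.
by move=> hx; elim: n => [|n IH]; [exact: integers1|rewrite exprS; apply: integersM].
Qed.
Lemma integers_nat n : integers F n%:R.
Proof.
elim: n => [|n IH]; first exact: integers0.
by rewrite -natr1; apply: integersD => //; apply: integers1.
Qed.

Lemma ge_val1_integers x : ge_val 1 x -> integers F x.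
Proof. exact: ge_val_decr. Qed.

Lemma integer_unitsP x : integer_units F x <-> integers F x /\ ~ ge_val 1 x.
Proof.
split=> [[x0 vx]|[[->|hx] h1]].
- split; first by right; rewrite vx.
  by case=> [/eqP|]; [exact/negP|rewrite vx].
- by exfalso; apply: h1; left.
- have x0 : x != 0 by apply/eqP => x0; apply: h1; left.
  split=> //; apply/eqP; rewrite eq_le hx andbT leNgt; apply/negP => h.
  by apply: h1; right.
Qed.

Lemma units_integers x : integer_units F x -> integers F x.
Proof. by case/integer_unitsP. Qed.

Lemma units_neq0 x : integer_units F x -> x != 0.
Proof. by case. Qed.

Lemma unitsV x : integer_units F x -> integer_units F x^-1.
Proof. by move=> [x0 vx]; split; rewrite ?invr_eq0 ?lf_valV ?vx ?oppr0. Qed.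

Lemma unitsM x y : integer_units F x -> integer_units F y -> integer_units F (x * y).
Proof.
by move=> [x0 vx] [y0 vy]; split; rewrite ?mulf_neq0 // lf_valM // vx vy.
Qed.

Lemma units1 : integer_units F 1.
Proof. by split; [exact: oner_neq0|exact: lf_val1]. Qed.

Lemma unitsN x : integer_units F x -> integer_units F (- x).
Proof. by move=> [x0 vx]; split; rewrite ?oppr_eq0 ?lf_valN. Qed.

Lemma unitsD x y : integer_units F x -> ge_val 1 y -> integer_units F (x + y).
Proof.
move=> /integer_unitsP[hx nx] hy; apply/integer_unitsP; split.
  by apply: integersD => //; apply: ge_val1_integers.
by move=> h; apply: nx; rewrite -[x](addrK y); apply: ge_valB.
Qed.

Lemma units_or x : integers F x -> integer_units F x \/ ge_val 1 x.
Proof.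
move=> hx; have [h|h] := pselect (ge_val 1 x); first by right.
by left; apply/integer_unitsP.
Qed.

Lemma units_nonint x : integer_units F x -> ge_val 1 x -> False.
Proof. by case/integer_unitsP. Qed.

Lemma unitsMP x y : integers F x -> integers F y -> integer_units F (x * y) ->
  integer_units F x /\ integer_units F y.
Proof.
move=> hx hy hxy; case: (units_or hx) => ux.
  case: (units_or hy) => uy //; exfalso; apply: (units_nonint hxy).
  exact: ge_valMl.
exfalso; apply: (units_nonint hxy); exact: ge_valMr.
Qed.

Lemma ge_val_seq (s : seq F) : exists n, forall x, x \in s -> ge_val n x.
Proof.
elim: s => [|y s [n hn]]; first by exists 0.
exists (Num.min n (lf_val y)) => x; rewrite inE => /orP[/eqP ->|/hn].
  by right; rewrite ge_min lexx orbT.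
by apply: ge_val_decr; rewrite ge_min lexx.
Qed.

Lemma ge_val_mx p q (M : 'M[F]_(p, q)) : exists n, forall i j, ge_val n (M i j).
Proof.
have [n hn] := ge_val_seq [seq M ij.1 ij.2 | ij <- enum {: 'I_p * 'I_q}].
exists n => i j; apply: hn; apply/mapP; exists (i, j) => //.
by rewrite mem_enum.
Qed.

Variable pi : F.
Hypothesis pi_unif : is_uniformizer pi.

Lemma unif_neq0 : pi != 0. Proof. by case: pi_unif. Qed.
Lemma unifX_neq0 n : pi ^+ n != 0. Proof. by rewrite expf_neq0 ?unif_neq0. Qed.

Lemma lf_val_unifX n : lf_val (pi ^+ n) = n%:Z.
Proof.
elim: n => [|n IH]; first by rewrite expr0 lf_val1.
rewrite exprS lf_valM ?unif_neq0 ?unifX_neq0 // IH; case: pi_unif => _ ->; lia.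
Qed.

Lemma ge_val_unifX n x : ge_val n%:Z (pi ^+ n * x) <-> integers F x.
Proof.
split; last by move=> hx; apply: ge_valMr => //; right; rewrite lf_val_unifX.
case=> [/eqP|h].
  by rewrite mulf_eq0 (negPf (unifX_neq0 n)) /= => /eqP ->; left.
have [->|x0] := eqVneq x 0; first by left.
by right; move: h; rewrite lf_valM ?unifX_neq0 // lf_val_unifX lerDl.
Qed.

Lemma ge_val_unif x : ge_val 1 (pi * x) <-> integers F x.
Proof. by rewrite -(ge_val_unifX 1) expr1. Qed.

Lemma ge_val1_unif : ge_val 1 pi.
Proof. by rewrite -[pi]mulr1; apply/ge_val_unif; exact: integers1. Qed.

Lemma integers_unif : integers F pi.
Proof. exact: ge_val1_integers ge_val1_unif. Qed.

Lemma integers_div_unif x : integers F (x / pi) <-> ge_val 1 x.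
Proof. by rewrite -ge_val_unif mulrC divfK ?unif_neq0. Qed.

Lemma integers_div_unifX n x : integers F (x / pi ^+ n) <-> ge_val n%:Z x.
Proof. by rewrite -(ge_val_unifX n) mulrC divfK ?unifX_neq0. Qed.

Lemma nonint_unifV : ~ integers F pi^-1.
Proof.
rewrite -[pi^-1]mul1r => /integers_div_unif.
exact: units_nonint units1.
Qed.

End Valuation.

(** * Two-by-two matrices *)

Definition mx2 (A : nzRingType) (a b c d : A) : 'M[A]_2 :=
  \matrix_(i, j) if i == 0 then (if j == 0 then a else b)
                 else (if j == 0 then c else d).

Section Matrix2.
Variable A : comNzRingType.
Implicit Types (a b c d : A) (M N : 'M[A]_2).

Lemma ord2P (P : 'I_2 -> Prop) : P 0 -> P 1 -> forall i, P i.
Proof.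
move=> P0 P1 [[|[|//]] h].
- by have -> : Ordinal h = 0 by exact: val_inj.
- by have -> : Ordinal h = 1 by exact: val_inj.
Qed.

Lemma mx2_eqP M N : M 0 0 = N 0 0 -> M 0 1 = N 0 1 -> M 1 0 = N 1 0 ->
  M 1 1 = N 1 1 -> M = N.
Proof.
move=> h00 h01 h10 h11; apply/matrixP.
by apply: ord2P; apply: ord2P.
Qed.

Lemma mx2E M : M = mx2 (M 0 0) (M 0 1) (M 1 0) (M 1 1).
Proof. by apply: mx2_eqP; rewrite !mxE. Qed.

Lemma mx2_congr a b c d a' b' c' d' : a = a' -> b = b' -> c = c' -> d = d' ->
  mx2 a b c d = mx2 a' b' c' d'.
Proof. by move=> -> -> -> ->. Qed.

Lemma mx2M a b c d a' b' c' d' : mx2 a b c d *m mx2 a' b' c' d' =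
  mx2 (a * a' + b * c') (a * b' + b * d') (c * a' + d * c') (c * b' + d * d').
Proof. by apply: mx2_eqP; rewrite !mxE !big_ord_recl big_ord0 !mxE /= addr0. Qed.

Lemma mx2D a b c d a' b' c' d' : mx2 a b c d + mx2 a' b' c' d' =
  mx2 (a + a') (b + b') (c + c') (d + d').
Proof. by apply: mx2_eqP; rewrite !mxE. Qed.

Lemma mx2Z k a b c d : k *: mx2 a b c d = mx2 (k * a) (k * b) (k * c) (k * d).
Proof. by apply: mx2_eqP; rewrite !mxE. Qed.

Lemma mx2_scalar (k : A) : (k%:M : 'M[A]_2) = mx2 k 0 0 k.
Proof. by apply: mx2_eqP; rewrite !mxE. Qed.

Lemma mx2_0 : (0 : 'M[A]_2) = mx2 (0 : A) 0 0 0.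
Proof. by apply: mx2_eqP; rewrite !mxE. Qed.

Lemma det_mx2 a b c d : \det (mx2 a b c d) = a * d - b * c.
Proof.
rewrite (expand_det_row _ 0) !big_ord_recl big_ord0 addr0 /cofactor !det_mx11 !mxE /=.
by rewrite expr0 expr1 mul1r mulN1r mulrN.
Qed.

Lemma tr_mx2 a b c d : \tr (mx2 a b c d) = a + d.
Proof. by rewrite /mxtrace !big_ord_recl big_ord0 !mxE /= addr0. Qed.

End Matrix2.

Lemma map_mx2 (A B : nzRingType) (f : A -> B) a b c d :
  map_mx f (mx2 a b c d) = mx2 (f a) (f b) (f c) (f d).
Proof. by apply/matrixP; apply: ord2P; apply: ord2P; rewrite !mxE. Qed.

Lemma mx2_diag (A : comUnitRingType) (a b : A) : diag2 a b = mx2 a 0 0 b.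
Proof. by apply: mx2_eqP; rewrite !mxE. Qed.

Lemma inv_mx2 (A : comUnitRingType) (a b c d : A) :
  a * d - b * c \is a GRing.unit ->
  invmx (mx2 a b c d) = (a * d - b * c)^-1 *: mx2 d (- b) (- c) a.
Proof.
move=> u; have um : mx2 a b c d \in unitmx by rewrite unitmxE det_mx2.
apply: (can_inj (mulKmx um)); rewrite mulmxV // -scalemxAr mx2M mx2Z mx2_scalar.
have hu := mulVr u.
by apply: mx2_congr; rewrite -?[X in X = _]mulrA -?[1]hu; ring.
Qed.

Lemma invmx_mul (A : comUnitRingType) n (M N : 'M[A]_n) :
  M \in unitmx -> N \in unitmx -> invmx (M *m N) = invmx N *m invmx M.
Proof.
move=> uM uN; have uMN : M *m N \in unitmx by rewrite unitmx_mul uM.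
apply: (can_inj (mulKmx uMN)).
by rewrite mulmxV // -mulmxA (mulmxA N) mulmxV // mul1mx mulmxV.
Qed.

Definition intmx (F : localField) (M : 'M[F]_2) := forall i j, integers F (M i j).
(** This is [GL_2(O)]: the inverse is integral by Cramer's rule. *)
Definition GLO (F : localField) (M : 'M[F]_2) := intmx M /\ integer_units F (\det M).

Section IntegralMatrices.
Variable F : localField.
Implicit Types (M N : 'M[F]_2) (a b c d : F).

Lemma intmx2 a b c d : integers F a -> integers F b -> integers F c ->
  integers F d -> intmx (mx2 a b c d).
Proof. by move=> *; apply: ord2P; apply: ord2P; rewrite !mxE. Qed.

Lemma intmxM M N : intmx M -> intmx N -> intmx (M *m N).
Proof.
move=> hM hN; rewrite [M]mx2E [N]mx2E mx2M; apply: intmx2;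
  by apply: integersD; apply: integersM.
Qed.

Lemma intmxD M N : intmx M -> intmx N -> intmx (M + N).
Proof. by move=> hM hN i j; rewrite mxE; apply: integersD. Qed.

Lemma intmxZ a M : integers F a -> intmx M -> intmx (a *: M).
Proof. by move=> ha hM i j; rewrite mxE; apply: integersM. Qed.

Lemma intmx_scalar a : integers F a -> intmx a%:M.
Proof. by move=> ha; rewrite mx2_scalar; apply: intmx2 => //; exact: integers0. Qed.

Lemma intmx0 : intmx (0 : 'M[F]_2).
Proof. by move=> i j; rewrite mxE; exact: integers0. Qed.

Lemma intmx_det M : intmx M -> integers F (\det M).
Proof.
by move=> hM; rewrite [M]mx2E det_mx2; apply: integersB; apply: integersM.
Qed.

Lemma GLO_unitmx M : GLO M -> M \in unitmx.
Proof. by move=> [_ /units_neq0]; rewrite unitmxE unitfE. Qed.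

Lemma GLO1 : GLO (1%:M : 'M[F]_2).
Proof.
split; first exact/intmx_scalar/integers1.
by rewrite det1; exact: units1.
Qed.

Lemma GLOM M N : GLO M -> GLO N -> GLO (M *m N).
Proof.
move=> [hM uM] [hN uN]; split; first exact: intmxM.
by rewrite det_mulmx; apply: unitsM.
Qed.

Lemma GLOV M : GLO M -> GLO (invmx M).
Proof.
move=> gM; have uM := GLO_unitmx gM; case: gM => hM dM; split; last first.
  by rewrite det_inv; apply: unitsV.
have dd : \det M = M 0 0 * M 1 1 - M 0 1 * M 1 0 by rewrite {1}[M]mx2E det_mx2.
rewrite [M]mx2E inv_mx2; last by rewrite -dd unitfE; apply: units_neq0.
apply: intmxZ; first by rewrite -dd; apply/units_integers/unitsV.
by apply: intmx2 => //; apply: integersN.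
Qed.

Lemma GLO_scalar a : integer_units F a -> GLO (a%:M : 'M[F]_2).
Proof.
move=> ua; split; first exact/intmx_scalar/units_integers.
by rewrite det_scalar expr2; apply: unitsM.
Qed.

End IntegralMatrices.

(** * Dual numbers *)

Section DualNumbers.
Variable F : localField.
Local Notation D := (dual F).
Implicit Types (x y : D) (a b : F).

Definition re x : F := (x : {poly F})`_0.
Definition im x : F := (x : {poly F})`_1.

Lemma dual_eqP x y : re x = re y -> im x = im y -> x = y.
Proof.
have sz (z : D) : (size (z : {poly F}) <= 2)%N.
  by rewrite (leq_trans (size_npoly z)) // mk_monic_Xn size_polyXn.
move=> h0 h1; apply: val_inj; apply/polyP => -[|[|i]] //.
by rewrite !nth_default // (leq_trans (sz _)).
Qed.

Lemma coef_in_qpoly (p : {poly F}) i : (i < 2)%N ->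
  (in_qpoly 'X^2 p : {poly F})`_i = p`_i.
Proof.
move=> hi; rewrite -[p in LHS](poly_take_drop 2) in_qpolyD in_qpolyM.
have -> : in_qpoly ('X^2 : {poly F}) 'X^2 = 0.
  by apply: val_inj => /=; rewrite mk_monic_Xn Pdiv.RingMonic.rmodpp ?monicXn.
rewrite mulr0 addr0 in_qpoly_small; last first.
  by rewrite mk_monic_Xn size_polyXn ltnS size_take_poly.
by rewrite coef_take_poly hi.
Qed.

Lemma in_qpolyK x : in_qpoly ('X^2 : {poly F}) x = x.
Proof. by apply: val_inj; apply: in_qpoly_small; exact: size_mk_monic. Qed.

Lemma reD x y : re (x + y) = re x + re y. Proof. exact: coefD. Qed.
Lemma imD x y : im (x + y) = im x + im y. Proof. exact: coefD. Qed.

Lemma reM x y : re (x * y) = re x * re y.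
Proof.
by rewrite -[x in LHS]in_qpolyK -[y in LHS]in_qpolyK -rmorphM /re coef_in_qpoly //
  coefM big_ord_recl big_ord0 addr0.
Qed.

Lemma imM x y : im (x * y) = re x * im y + im x * re y.
Proof.
by rewrite -[x in LHS]in_qpolyK -[y in LHS]in_qpolyK -rmorphM /im coef_in_qpoly //
  coefM !big_ord_recl big_ord0 addr0.
Qed.

Lemma re_dualC a : re (dualC a) = a. Proof. by rewrite /re /= coefC. Qed.
Lemma im_dualC a : im (dualC a) = 0. Proof. by rewrite /im /= coefC. Qed.
Lemma re_eps : re (eps F) = 0. Proof. by rewrite /re coef_in_qpoly // coefX. Qed.
Lemma im_eps : im (eps F) = 1. Proof. by rewrite /im coef_in_qpoly // coefX. Qed.

HB.instance Definition _ := GRing.RMorphism.copy (@dualC F)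
  (qpolyC ('X^2 : {poly F})).

Lemma re0 : re 0 = 0. Proof. exact: coef0. Qed.
Lemma im0 : im 0 = 0. Proof. exact: coef0. Qed.
Lemma reN x : re (- x) = - re x. Proof. exact: coefN. Qed.
Lemma imN x : im (- x) = - im x. Proof. exact: coefN. Qed.
Lemma re1 : re 1 = 1. Proof. by rewrite -(rmorph1 (@dualC F)) re_dualC. Qed.
Lemma im1 : im 1 = 0. Proof. by rewrite -(rmorph1 (@dualC F)) im_dualC. Qed.

Definition dualE := (reD, imD, reM, imM, re_dualC, im_dualC, re_eps, im_eps,
  re0, im0, re1, im1, reN, imN,
  mul0r, mulr0, mul1r, mulr1, add0r, addr0).

Lemma dual_decomp x : x = dualC (re x) + eps F * dualC (im x).
Proof. by apply: dual_eqP; rewrite !dualE. Qed.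

Lemma re_mk a b : re (dualC a + eps F * dualC b) = a.
Proof. by rewrite reD reM re_eps !re_dualC mul0r addr0. Qed.

Lemma im_mk a b : im (dualC a + eps F * dualC b) = b.
Proof. by rewrite imD imM re_eps im_eps re_dualC !im_dualC mul0r mul1r !add0r. Qed.

Lemma dual_unitP x : (x \is a GRing.unit) = (re x != 0).
Proof.
apply/idP/idP => [/divrr/(congr1 re)|x0].
  rewrite !dualE => /eqP; apply: contraTneq => ->.
  by rewrite mul0r eq_sym oner_eq0.
apply/unitrPr; exists (dualC (re x)^-1 + eps F * dualC (- im x / re x ^+ 2)).
apply: dual_eqP; rewrite !dualE; first by rewrite divff.
by field.
Qed.

(* Locked because unification otherwise unfolds the ring structure of [dual F]. *)
Definition dmx : 'M[F]_2 -> 'M[F]_2 -> 'M[D]_2 :=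
  locked (fun g Y => map_mx (@dualC F) g + eps F *: map_mx (@dualC F) Y).

Implicit Types g Y : 'M[F]_2.

Lemma dmxE g Y : dmx g Y = map_mx (@dualC F) g + eps F *: map_mx (@dualC F) Y.
Proof. by rewrite /dmx -lock. Qed.

Lemma dmx_entry g Y i j : dmx g Y i j = dualC (g i j) + eps F * dualC (Y i j).
Proof. by rewrite dmxE !mxE. Qed.

Lemma dmx_surj (M : 'M[D]_2) : M = dmx (map_mx re M) (map_mx im M).
Proof. by apply/matrixP => i j; rewrite dmx_entry !mxE -dual_decomp. Qed.

Lemma dmxM g Y g' Y' : dmx g Y *m dmx g' Y' = dmx (g *m g') (g *m Y' + Y *m g').
Proof.
have epsM : eps F * eps F = 0.
  by apply: dual_eqP; rewrite !dualE.
rewrite !dmxE map_mxD !map_mxM mulmxDl !mulmxDr -!scalemxAl -!scalemxAr scalerA.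
by rewrite epsM scale0r addr0 scalerDr -addrA.
Qed.

Lemma dmx_scale a b g Y :
  (dualC a + eps F * dualC b) *: dmx g Y = dmx (a *: g) (a *: Y + b *: g).
Proof.
apply/matrixP => i j; rewrite [LHS]mxE !dmx_entry.
apply: dual_eqP; first by rewrite reM !re_mk [RHS]mxE.
by rewrite imM !re_mk !im_mk [RHS]mxE; congr (_ + _); rewrite mxE.
Qed.

Lemma dmx1 : dmx 1%:M 0 = 1%:M.
Proof. by rewrite !dmxE map_mx1 map_mx0 scaler0 addr0. Qed.

Lemma dmx0 g : dmx g 0 = map_mx (@dualC F) g.
Proof. by rewrite !dmxE map_mx0 scaler0 addr0. Qed.

Lemma det_dmx g Y : re (\det (dmx g Y)) = \det g.
Proof.
rewrite [dmx g Y]mx2E [g in RHS]mx2E !det_mx2 !dmx_entry.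
by rewrite reD reN !reM !reD !reM re_eps !re_dualC !mul0r !addr0.
Qed.

Lemma dmx_unit g Y : (dmx g Y \in unitmx) = (g \in unitmx).
Proof. by rewrite !unitmxE dual_unitP det_dmx unitfE. Qed.

Lemma dmxV g Y : g \in unitmx ->
  invmx (dmx g Y) = dmx (invmx g) (- (invmx g *m Y *m invmx g)).
Proof.
move=> ug; have ud : dmx g Y \in unitmx by rewrite dmx_unit.
apply: (can_inj (mulKmx ud)); rewrite mulmxV // dmxM mulmxV //.
by rewrite mulmxN !mulmxA mulmxV // mul1mx addNr dmx1.
Qed.

Lemma dmx_inj g Y g' Y' : dmx g Y = dmx g' Y' -> g = g' /\ Y = Y'.
Proof.
move=> h; split; apply/matrixP => i j.
  by move: h => /matrixP/(_ i j)/(congr1 re); rewrite !dmx_entry !re_mk.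
by move: h => /matrixP/(_ i j)/(congr1 im); rewrite !dmx_entry !im_mk.
Qed.

End DualNumbers.

(** * The groups *)

Lemma pgl_scale (A : comUnitRingType) (u : A) (M : 'M[A]_2) :
  u \is a GRing.unit -> M \in unitmx -> pgl (u *: M) = pgl M.
Proof.
move=> uu uM; apply/eq_pgl => //; last by exists u.
by rewrite unitmxE detZ unitrM unitrX //= -unitmxE.
Qed.

Section Projective.
Variable F : localField.
Implicit Types (g z X Y k : 'M[F]_2) (x : Geps F).

Lemma pglM_G g h : g \in unitmx -> h \in unitmx ->
  (pgl g * pgl h)%g = pgl (g *m h) :> G F.
Proof. exact: pgl_mulE. Qed.

Lemma pglM_Geps (M N : 'M[dual F]_2) : M \in unitmx -> N \in unitmx ->
  (pgl M * pgl N)%g = pgl (M *m N) :> Geps F.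
Proof. exact: pgl_mulE. Qed.

Lemma pgl_dmxM g Y h X : g \in unitmx -> h \in unitmx ->
  (pgl (dmx g Y) * pgl (dmx h X))%g = pgl (dmx (g *m h) (g *m X + Y *m h)) :> Geps F.
Proof. by move=> ug uh; rewrite pglM_Geps ?dmx_unit // dmxM. Qed.

Lemma G_surj (x : G F) : exists2 g, g \in unitmx & x = pgl g.
Proof. by exists (pgl_mx x); rewrite ?pgl_mx_unit ?pgl_mxK. Qed.

Lemma Geps_surj x : exists g Y, g \in unitmx /\ x = pgl (dmx g Y).
Proof.
have [g [Y e]] : exists g Y, pgl_mx x = dmx g Y.
  by do 2 eexists; exact: dmx_surj.
exists g, Y; rewrite -(dmx_unit g Y) -e; split; first exact: pgl_mx_unit.
by rewrite pgl_mxK.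
Qed.

Lemma one_plus_epsE X : one_plus_eps X = pgl (dmx 1%:M X).
Proof. by rewrite /one_plus_eps dmxE map_mx1. Qed.

Lemma incl_pgl g : g \in unitmx -> incl (pgl g) = pgl (dmx g 0).
Proof.
move=> ug; rewrite /incl; have [u uu ->] := pglK ug.
rewrite map_mxZ -dmx0 pgl_scale ?dmx_unit // dual_unitP re_dualC.
by rewrite -unitfE.
Qed.

(** The two matrices differ by the unit [1 + eps b]. This freedom is what allows the eps part to be
    made traceless. *)
Lemma pgl_dmxD g Y (b : F) : g \in unitmx ->
  pgl (dmx g (Y + b *: g)) = pgl (dmx g Y).
Proof.
move=> ug; rewrite -(@pgl_scale _ (dualC 1 + eps F * dualC b) (dmx g Y)) ?dmx_unit //.
  by rewrite dmx_scale !scale1r.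
by rewrite dual_unitP re_mk oner_eq0.
Qed.

Lemma pgl_dmxZ g Y (a : F) : a != 0 -> g \in unitmx ->
  pgl (dmx (a *: g) (a *: Y)) = pgl (dmx g Y).
Proof.
move=> a0 ug; rewrite -(@pgl_scale _ (dualC a + eps F * dualC 0) (dmx g Y)) ?dmx_unit //.
  by rewrite dmx_scale scale0r addr0.
by rewrite dual_unitP re_mk.
Qed.

Lemma pgl_dmx_split g Y : g \in unitmx ->
  pgl (dmx g Y) = (one_plus_eps (Y *m invmx g) * incl (pgl g))%g.
Proof.
move=> ug.
rewrite one_plus_epsE (incl_pgl ug) (pgl_dmxM _ _ (unitmx1 _ _) ug).
by rewrite mul1mx mulmx0 add0r (mulmxKV ug).
Qed.

Lemma stabilizer_pgl m z : z \in unitmx -> stabilizer m (pgl z) <-> z *m m = m *m z.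
Proof.
move=> uz; rewrite /stabilizer /=; have [u uu ->] := pglK uz.
have u0 : u != 0 by rewrite -unitfE.
rewrite invmxZ ?unitmxZ // -!scalemxAl -scalemxAr scalerA divff // scale1r.
split=> [h|->]; last by rewrite mulmxK.
by rewrite -[in RHS]h mulmxKV.
Qed.

(** The inverse of [k + eps Y] has eps part [- k^-1 Y k^-1], which is integral as soon as [k^-1] and
    [Y] are. *)
Lemma KepsP x : Keps F x <->
  exists k Y, [/\ GLO k, intmx Y & x = pgl (dmx k Y)].
Proof.
split=> [[M [uM hM hV ->]]|[k [Y [gk hY ->]]]].
  rewrite (dmx_surj M) in uM hM hV *.
  set k := map_mx _ M in uM hM hV *; set Y := map_mx _ M in uM hM hV *.
  rewrite dmx_unit in uM; rewrite dmxV // in hV.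
  exists k, Y; split=> //; last first.
    by move=> i j; have [_] := hM i j; rewrite -/(im _) dmx_entry im_mk.
  have hk : intmx k.
    by move=> i j; have [] := hM i j; rewrite -/(re _) dmx_entry re_mk.
  have hk' : intmx (invmx k).
    by move=> i j; have [] := hV i j; rewrite -/(re _) dmx_entry re_mk.
  split=> //; apply: (unitsMP (intmx_det hk) (intmx_det hk') _).1.
  by rewrite -det_mulmx mulmxV // det1; exact: units1.
have uk := GLO_unitmx gk.
have [hk _] := gk; have [hk' _] := GLOV gk.
exists (dmx k Y); split=> //; first by rewrite dmx_unit.
- by move=> i j; split; rewrite -/(re _) -/(im _) dmx_entry ?re_mk ?im_mk; [exact: hk|exact: hY].
- move=> i j; rewrite dmxV //.
  split; rewrite -/(re _) -/(im _) dmx_entry ?re_mk ?im_mk; first exact: hk'.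
  by rewrite mxE; apply: integersN; apply: intmxM => //; apply: intmxM.
Qed.

Lemma Keps_pgl k Y : GLO k -> intmx Y -> Keps F (pgl (dmx k Y)).
Proof. by move=> gk hY; apply/KepsP; exists k, Y. Qed.

Lemma Keps1 : Keps F 1%g.
Proof.
have -> : 1%g = pgl (dmx 1%:M 0) :> Geps F by rewrite dmx1.
by apply: Keps_pgl; [exact: GLO1|exact: intmx0].
Qed.

Lemma KepsM x y : Keps F x -> Keps F y -> Keps F (x * y)%g.
Proof.
move=> /KepsP[k [X [gk hX ->]]] /KepsP[l [Y [gl hY ->]]].
rewrite pgl_dmxM ?GLO_unitmx //; apply: Keps_pgl; first exact: GLOM.
by have [? _] := gk; have [? _] := gl; apply: intmxD; apply: intmxM.
Qed.

Lemma KepsV x : Keps F x -> Keps F x^-1%g.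
Proof.
move=> /KepsP[k [X [gk hX ->]]].
have uk := GLO_unitmx gk; have gV := GLOV gk; have uV := GLO_unitmx gV.
suff -> : (pgl (dmx k X))^-1%g =
    pgl (dmx (invmx k) (- (invmx k *m X *m invmx k))) :> Geps F.
  apply: Keps_pgl => //; have [? _] := gV.
  by rewrite -scaleN1r; apply: intmxZ; [exact/integersN/integers1|
    apply: intmxM => //; apply: intmxM].
apply: (mulgI (pgl (dmx k X) : Geps F)); rewrite mulgV pgl_dmxM //.
by rewrite mulmxV // mulmxN !mulmxA mulmxV // mul1mx addNr dmx1.
Qed.

End Projective.

(* Unification otherwise unfolds products of classes down to matrices. *)
Opaque pgl.

(** * Equivariant functions *)

Section Equivariant.
Variables (R : realType) (F : localField).
Local Notation C := R[i].
Variables (psi : F -> C) (m : 'M[F]_2) (chi : G F -> C).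
Implicit Types (f : Geps F -> C) (g z X Y k : 'M[F]_2).

(** The pointwise conditions of [VrepK]. Local constancy follows from right invariance under [Keps],
    and the support condition is kept apart because most arguments evaluate a function at single
    vertices. *)
Definition equivariant f :=
  [/\ forall (m' : 'M[F]_2) (g : G F), \tr m' = 0 ->
        f (one_plus_eps m' * incl g)%g = psi (\tr (m *m m')) * f (incl g),
      forall z g : G F, stabilizer m z ->
        f (incl z * incl g)%g = chi z * f (incl g)
    & forall x k : Geps F, Keps F k -> f (x * k)%g = f x].

Definition compact_mod_stabilizer f :=
  exists2 D : set (G F), compact D &
    [set g | f (incl g) != 0] `<=` [set (z * d)%g | z in stabilizer m & d in D].

Lemma unitmx_1D g : intmx g -> (forall i j, ge_val 1 (g i j)) -> GLO (1%:M + g).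
Proof.
move=> hg h1; split; first by apply: intmxD => //; exact/intmx_scalar/integers1.
rewrite [g]mx2E mx2_scalar mx2D det_mx2 !add0r.
set a := g 0 0; set b := g 0 1; set c := g 1 0; set d := g 1 1.
have -> : (1 + a) * (1 + d) - b * c = 1 + (d + a * (1 + d) - b * c) by ring.
apply: unitsD; first exact: units1.
apply: ge_valB; last by apply: ge_valMr; [exact: h1|exact: hg].
apply: ge_valD; first exact: h1.
apply: ge_valMr; first exact: h1.
by apply: integersD; [exact: integers1|exact: hg].
Qed.

(** For [N] close to [M], the quotient [M^-1 N = 1 + M^-1 (N - M)] lies in [Keps]; the required
    precision depends on the denominators of [M^-1]. *)
Lemma Keps_invariant_locally_constant f :
  (forall x k : Geps F, Keps F k -> f (x * k)%g = f x) -> locally_constant f.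
Proof.
move=> fK x; suff o : open [set y : Geps F | f y = f x] by exact: open_nbhs_nbhs.
move=> M uM /= fM; rewrite -{}fM {x}.
have [g [Y eM]] : exists g Y, M = dmx g Y by do 2 eexists; exact: dmx_surj.
rewrite {}eM in uM *; rewrite dmx_unit in uM.
set g' := invmx g; set Y' := - (invmx g *m Y *m invmx g).
have [a ha] := ge_val_mx g'; have [b hb] := ge_val_mx Y'.
pose c := Num.max (1 - a) (1 - b); exists c => N uN hN.
have [h [X eN]] : exists g Y, N = dmx g Y by do 2 eexists; exact: dmx_surj.
rewrite {}eN in uN hN *.
have [hN0 hN1] : (forall i j, ge_val c ((h - g) i j)) /\
                 (forall i j, ge_val c ((X - Y) i j)).
  split=> i j; have [] := hN i j; rewrite -/(re _) -/(im _) !dmx_entry.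
    by move=> + _; rewrite reD reN !re_mk !mxE.
  by move=> _; rewrite imD imN !im_mk !mxE.
have hc (A B : 'M[F]_2) d : (1 - d <= c) -> (forall i j, ge_val d (A i j)) ->
    (forall i j, ge_val c (B i j)) -> forall i j, ge_val 1 ((A *m B) i j).
  move=> dc hA hB i j; rewrite mxE !big_ord_recl big_ord0 addr0.
  have h1 : 1 <= d + c by lia.
  by apply: ge_valD; apply: (ge_val_decr h1); apply: ge_valM.
have ac : 1 - a <= c by rewrite le_max lexx.
have bc : 1 - b <= c by rewrite le_max lexx orbT.
have h1 := hc _ _ _ ac ha hN0.
have h2 := hc _ _ _ ac ha hN1; have h3 := hc _ _ _ bc hb hN0.
set k := 1%:M + g' *m (h - g).
have gk : GLO k by apply: unitmx_1D => // i j; exact: ge_val1_integers.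
set Z := g' *m (X - Y) + Y' *m (h - g).
have hZ : intmx Z by apply: intmxD => i j; exact: ge_val1_integers.
suff -> : pgl (dmx h X) = (pgl (dmx g Y) * pgl (dmx k Z))%g :> Geps F.
  exact/fK/Keps_pgl.
rewrite (pgl_dmxM _ _ uM (GLO_unitmx gk)); congr (pgl (dmx _ _)).
  by rewrite /k /g' mulmxDr mulmx1 mulKVmx // addrC subrK.
rewrite /k /Z /g' /Y' !(mulmxDr, mulNmx, mulmxN, mulmx1) !mulmxA mulmxV //.
by rewrite !mul1mx; apply/matrixP => i j; rewrite !mxE; ring.
Qed.

Lemma continuous_mulr (y : G F) : continuous (fun x : G F => (x * y)%g).
Proof.
have openE (U : set (G F)) : open U = pgl_open (@ge_val F) U by [].
apply/continuousP => U; rewrite !openE => oU M uM /=.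
have [h uh ->] := G_surj y; rewrite pglM_G // => UM.
have uMh : M *m h \in unitmx by rewrite unitmx_mul uM.
have [n hn] := oU _ uMh UM.
have [a ha] := ge_val_mx h.
exists (n - a) => N uN hN; rewrite /= pglM_G //.
apply: hn; rewrite ?unitmx_mul ?uN // => i j.
have -> : (N *m h) i j - (M *m h) i j = ((N - M) *m h) i j by rewrite mulmxBl !mxE.
rewrite mxE; apply: (@big_ind _ (fun x : F => ge_val n x)).
- exact: ge_val0.
- by move=> ? ?; exact: ge_valD.
- by move=> l _; rewrite -[n](subrK a); apply: ge_valM => //; rewrite !mxE; exact: hN.
Qed.

Lemma VrepKP f :
  VrepK psi m chi f <-> equivariant f /\ compact_mod_stabilizer f.
Proof.
split=> [[[_ h1 h2 h3] h4]|[[h1 h2 h4] h3]]; first by split.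
by split=> //; split=> //; exact: Keps_invariant_locally_constant.
Qed.

End Equivariant.

Section EquivariantFacts.
Variables (R : realType) (F : localField).
Local Notation C := R[i].
Variables (psi : F -> C) (m : 'M[F]_2) (chi : G F -> C).
Implicit Types (f : Geps F -> C) (g z X Y k : 'M[F]_2).
Hypothesis charF : (2%:R : F) != 0.
Hypothesis psi_char : additive_character psi.
Hypothesis trm : \tr m = 0.
Hypothesis chi_char : stabilizer_character m chi.
Local Notation equivariant := (equivariant psi m chi).
Local Notation VrepK := (VrepK psi m chi).

Definition restr f g : C := f (pgl (dmx g 0)).

Lemma psi_integers x : integers F x -> psi x = 1.
Proof.
have [_ _ h] := psi_char; rewrite -h => /(_ 1 (@integers1 F)).
by rewrite mulr1.
Qed.

Lemma restr_incl f g : g \in unitmx -> f (incl (pgl g)) = restr f g.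
Proof. by move=> ug; rewrite /restr incl_pgl. Qed.

(** Equivariance only covers traceless [m'], so a multiple of [g] is first subtracted from [Y]; this
    divides a trace by 2. The character does not see the change because [\tr m = 0]. *)
Lemma equivariant_dmx f g Y : equivariant f -> g \in unitmx ->
  f (pgl (dmx g Y)) = psi (\tr (m *m (Y *m invmx g))) * restr f g.
Proof.
move=> [feps _ _] ug; pose b := \tr (Y *m invmx g) / 2%:R.
rewrite -(pgl_dmxD Y (- b) ug) (pgl_dmx_split _ ug).
have -> : (Y + - b *: g) *m invmx g = Y *m invmx g - b%:M.
  by rewrite mulmxDl -scalemxAl mulmxV // scaleNr scalemx1.
rewrite feps; last by rewrite mxtraceD raddfN /= mxtrace_scalar -mulr_natr divfK ?subrr.
rewrite restr_incl //; congr (psi _ * _).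
by rewrite mulmxBr raddfB /= mul_mx_scalar mxtraceZ trm mulr0 subr0.
Qed.

Lemma restr_stabilizer f z g : equivariant f -> z \in unitmx -> z *m m = m *m z ->
  g \in unitmx -> restr f (z *m g) = chi (pgl z) * restr f g.
Proof.
move=> [_ fZ _] uz cz ug.
have := fZ (pgl z) (pgl g) ((stabilizer_pgl m uz).2 cz).
rewrite (incl_pgl uz) (incl_pgl ug) (pgl_dmxM _ _ uz ug).
by rewrite mulmx0 mul0mx addr0.
Qed.

Lemma restr_GLO f g k : equivariant f -> g \in unitmx -> GLO k ->
  restr f (g *m k) = restr f g.
Proof.
move=> [_ _ fK] ug gk.
have := fK (pgl (dmx g 0)) _ (Keps_pgl gk (@intmx0 F)).
rewrite (pgl_dmxM _ _ ug (GLO_unitmx gk)).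
by rewrite mulmx0 mul0mx addr0.
Qed.

Lemma restr_scale f g (a : F) : a != 0 -> g \in unitmx ->
  restr f (a *: g) = restr f g.
Proof.
by move=> a0 ug; rewrite /restr -(pgl_dmxZ 0 a0 ug) scaler0.
Qed.

Lemma restr_neq0_intmx f g : equivariant f -> g \in unitmx -> restr f g != 0 ->
  intmx (invmx g *m m *m g).
Proof.
move=> ef ug f0 i j; set M := invmx g *m m *m g.
have hY Y : intmx Y -> psi (\tr (M *m Y)) = 1.
  move=> hY; have [_ _ fK] := ef.
  have := fK (pgl (dmx g 0)) _ (Keps_pgl (@GLO1 F) hY).
  rewrite (pgl_dmxM _ _ ug (unitmx1 _ _)) mulmx1 mul0mx addr0.
  move=> /(etrans (esym (equivariant_dmx (g *m Y) ef ug))) h.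
  apply: (mulIf f0); rewrite mul1r -[RHS]h; congr (psi _ * _).
  by rewrite /M [in RHS]mulmxA [RHS]mxtrace_mulC !mulmxA.
have [_ _ <-] := psi_char => y hy /=.
(* Integral multiples of a matrix unit isolate one entry of [M]; the conductor of [psi] then turns
   triviality on all these multiples into integrality of the entry. *)
clearbody M; have <- : \tr (M *m (y *: delta_mx j i)) = M i j * y.
  rewrite -scalemxAr mxtraceZ mulrC; congr (_ * _).
  rewrite /mxtrace (bigD1 i) //= big1 ?addr0 => [|l li].
    rewrite mxE (bigD1 j) //= big1 ?addr0 => [|l lj]; first by rewrite mxE !eqxx mulr1.
    by rewrite mxE (negPf lj) mulr0.
  by rewrite mxE big1 // => l' _; rewrite mxE (negPf li) andbF mulr0.
apply: hY; apply: intmxZ => // a b; rewrite mxE.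
by case: andP => _; [exact: integers1|exact: integers0].
Qed.

Lemma fct_scaleE f (c : C) x : (c *: f) x = c * f x. Proof. by []. Qed.
Lemma fct_addE f f' x : (f + f') x = f x + f' x. Proof. by []. Qed.

Lemma equivariantZ f (c : C) : equivariant f -> equivariant (c *: f).
Proof.
move=> [h1 h2 h3]; split=> [m' g t|z g s|x k kk].
- exact: etrans (congr1 ( *%R c) (h1 _ _ t)) (mulrCA _ _ _).
- exact: etrans (congr1 ( *%R c) (h2 _ _ s)) (mulrCA _ _ _).
- exact (congr1 ( *%R c) (h3 x k kk)).
Qed.

Lemma equivariantD f f' : equivariant f -> equivariant f' -> equivariant (f + f').
Proof.
move=> [h1 h2 h3] [h1' h2' h3'].
split=> [m' g t|z g s|x k kk].
- exact: etrans (congr2 +%R (h1 _ _ t) (h1' _ _ t)) (esym (mulrDr _ _ _)).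
- exact: etrans (congr2 +%R (h2 _ _ s) (h2' _ _ s)) (esym (mulrDr _ _ _)).
- exact (congr2 +%R (h3 x k kk) (h3' x k kk)).
Qed.

Lemma equivariant0 : equivariant (0 : Geps F -> C).
Proof.
by split=> [m' g t|z g s|x k kk]; rewrite ?[RHS]mulr0.
Qed.

Lemma VrepK_sum (I : Type) (s : seq I) (c : I -> C) (f : I -> Geps F -> C) :
  (forall i, VrepK (f i)) -> VrepK (\sum_(i <- s) c i *: f i).
Proof.
move=> Vf; apply: (@big_ind _ VrepK).
- apply/VrepKP; split; first exact: equivariant0.
  by exists set0; [exact: compact0|move=> g /eqP []].
- move=> f1 f2 /VrepKP[e1 [D1 c1 s1]] /VrepKP[e2 [D2 c2 s2]].
  apply/VrepKP; split; first exact: equivariantD.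
  exists (D1 `|` D2); first exact: compactU.
  move=> g /= h; have [h1|h1] := eqVneq (f1 (incl g)) 0.
    have [|z sz [d dD zd]] := s2 g; last by exists z => //; exists d => //; right.
    by move: h; rewrite fct_addE h1 add0r.
  by have [//|z sz [d dD zd]] := s1 g; exists z => //; exists d => //; left.
- move=> i _; have /VrepKP[e1 [D1 c1 s1]] := Vf i.
  apply/VrepKP; split; first exact: equivariantZ.
  exists D1 => // g /= h; apply: s1; apply: contraNneq h.
  by rewrite fct_scaleE => ->; rewrite mulr0.
Qed.

(** Applied to level sets below, it extracts the part of a function that lives on a single level
    without leaving [VrepK]. *)
Definition cutoff (P : set (Geps F)) f : Geps F -> C :=
  fun x => if `[< P x >] then f x else 0.

Definition invariant_set (P : set (Geps F)) :=
  [/\ forall (m' : 'M[F]_2) (g : G F), P (one_plus_eps m' * incl g)%g <-> P (incl g),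
      forall z g : G F, stabilizer m z -> P (incl z * incl g)%g <-> P (incl g)
    & forall x k : Geps F, Keps F k -> P (x * k)%g <-> P x].

Lemma cutoffM P f x y c : (P x <-> P y) -> f x = c * f y ->
  cutoff P f x = c * cutoff P f y.
Proof.
move=> /asbool_equiv_eq; rewrite /cutoff => -> ->.
by case: asboolP => _; rewrite ?mulr0.
Qed.

Lemma cutoff_eq P f x y : (P x <-> P y) -> f x = f y -> cutoff P f x = cutoff P f y.
Proof. by move=> /asbool_equiv_eq; rewrite /cutoff => -> ->. Qed.

Lemma VrepK_cutoff P f : invariant_set P -> VrepK f -> VrepK (cutoff P f).
Proof.
move=> [p1 p2 p3] /VrepKP[[h1 h2 h3] [D1 c1 s1]]; apply/VrepKP; split.
  split=> [m' g t|z g s|x k kk].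
  - exact: cutoffM (p1 _ _) (h1 _ _ t).
  - exact: cutoffM (p2 _ _ s) (h2 _ _ s).
  - exact: cutoff_eq (p3 _ _ kk) (h3 _ _ kk).
exists D1 => // g /=; rewrite /cutoff; case: asboolP => _; last by rewrite eqxx.
exact: s1.
Qed.

End EquivariantFacts.

(** * The neighbours of a lattice *)

Section ResidueSystem.
Variable F : localField.

(** A list of representatives of the residue field, so that sums over residue classes become sums
    over a list. *)
Record residue_system (s : seq F) : Prop := ResidueSystem {
  rs_uniq : uniq s;
  rs_size : size s = residue_card F;
  rs_int : forall b, b \in s -> integers F b;
  rs_surj : forall x, integers F x -> exists2 b, b \in s & ge_val 1 (x - b);
  rs_inj : forall b c, b \in s -> c \in s -> ge_val 1 (b - c) -> b = c }.

Lemma residue_system_exists : exists s, residue_system s.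
Proof.
pose cls := residue_classes (@lf_val F).
have fin : finite_set cls := lf_finite_residue F.
pose rep (c : set F) := xget 0 c.
have repP c : cls c -> c (rep c) /\ (forall y, c y <-> ge_val 1 (y - rep c)) /\ integers F (rep c).
  move=> [x hx ec].
  have cx : c x by rewrite -ec /= subrr; exact: ge_val0.
  have cr : c (rep c) by exact: xgetI cx.
  have hr : ge_val 1 (rep c - x) by move: cr; rewrite -{1}ec.
  split=> //; split.
    move=> y; rewrite -{1}ec /=; split=> h.
      have -> : y - rep c = (y - x) - (rep c - x) by ring.
      exact: ge_valB.
    have -> : y - x = (y - rep c) + (rep c - x) by ring.
      exact: ge_valD.
  rewrite -[rep c](subrK x); apply: integersD => //; exact: ge_val1_integers.
have inj c c' : cls c -> cls c' -> ge_val 1 (rep c - rep c') -> c = c'.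
  move=> /repP[_ [h _]] /repP[_ [h' _]] cc'; apply/seteqP; split=> y.
    rewrite h h' => hy.
    have -> : y - rep c' = (y - rep c) + (rep c - rep c') by ring.
      exact: ge_valD.
  rewrite h h' => hy.
  have -> : y - rep c = (y - rep c') - (rep c - rep c') by ring.
      exact: ge_valB.
have mem c : c \in fset_set cls -> cls c by rewrite in_fset_set // inE.
exists [seq rep c | c <- fset_set cls]; split.
- rewrite map_inj_in_uniq ?fset_uniq // => c c' /mem hc /mem hc' e; apply: inj => //.
  by rewrite e subrr; exact: ge_val0.
- by rewrite size_map.
- by move=> b /mapP[c /mem hc ->]; have [_ []] := repP c hc.
- move=> x hx; pose c := [set y | ge_val 1 (y - x)].
  have hc : cls c by exists x.
  exists (rep c); first by apply/map_f; rewrite in_fset_set // inE.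
  by have [_ [h _]] := repP c hc; apply/h; rewrite /c /= subrr; exact: ge_val0.
- move=> b b' /mapP[c /mem hc ->] /mapP[c' /mem hc' ->] h.
  by rewrite (inj _ _ hc hc' h).
Qed.

Lemma residue_card_gt1 : (1 < residue_card F)%N.
Proof.
have [s hs] := residue_system_exists; rewrite -(rs_size hs).
have [b bs hb] := rs_surj hs (@integers0 F).
have [c cs hc] := rs_surj hs (@integers1 F).
have bc : b != c.
  apply: contra_not_neq (@units_nonint F 1 (units1 F)) => e; rewrite -e in hc.
  have -> : 1 = (1 - b) - (0 - b) :> F by ring.
  exact: ge_valB.
have : (size [:: b; c] <= size s)%N.
  apply: uniq_leq_size; first by rewrite /= inE bc.
  by move=> x; rewrite !inE => /orP[] /eqP ->.
by [].
Qed.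

End ResidueSystem.

Section DoubleCoset.
Variables (F : localField) (pi : F).
Hypothesis pi_unif : is_uniformizer pi.
Implicit Types (b c x y : F) (g h k X Y : 'M[F]_2).

Lemma pgl_dmx_congr g Y h X : g = h -> Y = X ->
  pgl (dmx g Y) = pgl (dmx h X) :> Geps F.
Proof. by move=> -> ->. Qed.

Lemma left_coset_eq (x y : Geps F) :
  (exists2 k, Keps F k & x = (y * k)%g) -> left_coset x = left_coset y.
Proof.
move=> [k kk ->]; apply/seteqP; split=> _ [l kl <-].
  by exists (k * l)%g; [exact: KepsM|exact: mulgA].
exists (k^-1 * l)%g; first by apply: KepsM => //; exact: KepsV.
by rewrite -mulgA (mulgA k) mulgV mul1g.
Qed.

Lemma left_coset_refl (x : Geps F) : left_coset x x.
Proof. by exists 1%g; [exact: Keps1|exact: mulg1]. Qed.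

Lemma left_coset_mem (x y : Geps F) :
  left_coset x = left_coset y -> exists2 k, Keps F k & x = (y * k)%g.
Proof.
move=> h; have := left_coset_refl x.
by rewrite h => -[k kk e]; exists k.
Qed.

(** The lattice spanned by the columns is the preimage of the line through [(b, 1)] modulo [pi];
    [lower_nbr] belongs to the remaining line, through [(1, 0)]. Together they give the [q + 1]
    neighbours in the tree. *)
Definition upper_nbr b : 'M[F]_2 := mx2 pi b 0 1.
Definition lower_nbr : 'M[F]_2 := mx2 1 0 0 pi.

(** Each neighbour has [q] lifts to a left coset of [Keps], told apart by one residue class in the
    eps part; in all there are [q (q + 1)] cosets. *)
Definition nbr (i : F * F + F) : Geps F :=
  match i with
  | inl bc => pgl (dmx (upper_nbr bc.1) (mx2 0 bc.2 0 0))
  | inr y => pgl (dmx lower_nbr (mx2 0 0 y 0))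
  end.

Lemma det_upper_nbr b : \det (upper_nbr b) = pi.
Proof. by rewrite det_mx2 mulr1 mulr0 subr0. Qed.

Lemma det_lower_nbr : \det lower_nbr = pi.
Proof. by rewrite det_mx2 mul1r mulr0 subr0. Qed.

Lemma upper_nbr_unit b : upper_nbr b \in unitmx.
Proof. by rewrite unitmxE det_upper_nbr unitfE (unif_neq0 pi_unif). Qed.

Lemma lower_nbr_unit : lower_nbr \in unitmx.
Proof. by rewrite unitmxE det_lower_nbr unitfE (unif_neq0 pi_unif). Qed.

Lemma g_elt0 : g_elt pi 0 = pgl (dmx (mx2 pi 0 0 1) 0).
Proof.
rewrite /g_elt rmorph0 mulr0 addr0 mx2_diag dmx0 map_mx2 rmorph0 rmorph1 //.
Qed.

Lemma diag_unit : mx2 pi 0 0 1 \in unitmx.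
Proof. by rewrite unitmxE det_mx2 mulr1 mul0r subr0 unitfE (unif_neq0 pi_unif). Qed.

Lemma nbr_double_coset i :
  match i with inl bc => integers F bc.1 /\ integers F bc.2 | inr y => integers F y end ->
  double_coset (g_elt pi 0) (nbr i).
Proof.
have [i0 i1] := (@integers0 F, @integers1 F).
rewrite g_elt0; case: i => [[b c] [hb hc]|y hy] /=.
  have gk : GLO (mx2 1 b 0 1).
    by split; [exact: intmx2|rewrite det_mx2 mulr1 mulr0 subr0; exact: units1].
  exists (pgl (dmx (mx2 1 b 0 1) (mx2 0 c 0 0))).
    by apply: Keps_pgl => //; apply: intmx2.
  exists 1%g; first exact: Keps1.
  rewrite mulg1 (pgl_dmxM _ _ (GLO_unitmx gk) diag_unit) mulmx0 add0r !mx2M /upper_nbr.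
  by apply: pgl_dmx_congr; apply: mx2_congr; ring.
have gw : GLO (mx2 0 1 1 0 : 'M[F]_2).
  split; first exact: intmx2.
  by rewrite det_mx2 mulr1 mulr0 sub0r; apply/unitsN/units1.
exists (pgl (dmx (mx2 0 1 1 0) (mx2 0 0 0 y))).
  by apply: Keps_pgl => //; apply: intmx2.
exists (pgl (dmx (mx2 0 1 1 0) 0)); first by apply: Keps_pgl => //; exact: intmx0.
rewrite (pgl_dmxM _ _ (GLO_unitmx gw) diag_unit).
have u2 : mx2 0 1 1 0 *m mx2 pi 0 0 1 \in unitmx.
  by rewrite unitmx_mul (GLO_unitmx gw) diag_unit.
rewrite (pgl_dmxM _ _ u2 (GLO_unitmx gw)) !mulmx0 !add0r !mx2M /lower_nbr.
by apply: pgl_dmx_congr; apply: mx2_congr; ring.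
Qed.

(** Column reduction: modulo [pi], the lattice of [k diag(pi, 1)] is the line spanned by the second
    column [(q, t)] of [k]. It is an upper neighbour with [b = q / t] when [t] is a unit; otherwise
    [q] is a unit and it is the lower one. *)
Lemma double_coset_nbr (s : seq F) (x : Geps F) : residue_system s -> Keps F x ->
  exists2 i, match i with inl bc => bc.1 \in s /\ bc.2 \in s | inr y => y \in s end
    & left_coset (x * g_elt pi 0)%g = left_coset (nbr i).
Proof.
move=> hs /KepsP[k [Y [gk hY ->]]]; rewrite g_elt0.
rewrite (pgl_dmxM _ _ (GLO_unitmx gk) diag_unit) mulmx0 add0r.
have [hk dk] := gk; have p0 := unif_neq0 pi_unif.
have hpi := integers_unif pi_unif.
set p := k 0 0; set q := k 0 1; set r := k 1 0; set t := k 1 1.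
have ek : k = mx2 p q r t by exact: mx2E.
set p' := Y 0 0; set q' := Y 0 1; set r' := Y 1 0; set t' := Y 1 1.
have eY : Y = mx2 p' q' r' t' by exact: mx2E.
have [hp hq hr ht] : [/\ integers F p, integers F q, integers F r & integers F t].
  by split; exact: hk.
have [hp' hq' hr' ht'] : [/\ integers F p', integers F q', integers F r' & integers F t'].
  by split; exact: hY.
have detk : \det k = p * t - q * r by rewrite ek det_mx2.
case: (units_or ht) => [ut|nt].
  have t0 := units_neq0 ut; have hV := units_integers (unitsV ut).
  have [b bs hb] := rs_surj hs (integersM hq hV).
  have ib := rs_int hs bs.
  have [c cs hc] := rs_surj hs (integersM (integersB hq' (integersM ib ht')) hV).
  have ic := rs_int hs cs.
  exists (inl (b, c)); first by [].
  apply: left_coset_eq.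
  (* [K0] and [Y0] are obtained by dividing by the neighbour. Their entries with denominator [pi]
     are integral exactly by the choice of [b] and [c]. *)
  pose K0 := mx2 (p - b * r) ((q - b * t) / pi) (r * pi) t.
  pose Y0 := mx2 (p' - c * r - b * r') ((q' - c * t - b * t') / pi) (r' * pi) t'.
  have gK0 : GLO K0.
    split.
      apply: intmx2 => //; try exact: integersM.
        by apply: integersB => //; exact: integersM.
      apply/(integers_div_unif pi_unif).
      have -> : q - b * t = (q / t - b) * t by field.
      exact: ge_valMr.
    suff -> : \det K0 = \det k by [].
    by rewrite detk det_mx2; field.
  exists (pgl (dmx K0 Y0)).
    apply: Keps_pgl => //; apply: intmx2 => //; try exact: integersM.
      by apply: integersB; [apply: integersB => //|]; exact: integersM.
    apply/(integers_div_unif pi_unif).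
    have -> : q' - c * t - b * t' = ((q' - b * t') / t - c) * t by field.
    exact: ge_valMr.
  rewrite /= (pgl_dmxM _ _ (upper_nbr_unit b) (GLO_unitmx gK0)) ek eY /K0 /Y0.
  rewrite /upper_nbr !mx2M mx2D.
  by apply: pgl_dmx_congr; apply: mx2_congr; field.
have uqr : integer_units F (q * r).
  have -> : q * r = - \det k + t * p by rewrite detk; ring.
  by apply: unitsD; [exact: unitsN|exact: ge_valMr].
have [uq _] := unitsMP hq hr uqr.
have q0 := units_neq0 uq; have hV := units_integers (unitsV uq).
have [y ys hy] := rs_surj hs (integersM ht' hV).
have iy := rs_int hs ys.
exists (inr y); first by [].
apply: left_coset_eq.
pose K0 := mx2 (p * pi) q r (t / pi).
pose Y0 := mx2 (p' * pi) q' (r' - y * p) ((t' - y * q) / pi).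
have gK0 : GLO K0.
  split.
    by apply: intmx2 => //; [exact: integersM|apply/(integers_div_unif pi_unif)].
  suff -> : \det K0 = \det k by [].
  by rewrite detk det_mx2; field.
exists (pgl (dmx K0 Y0)).
  apply: Keps_pgl => //; apply: intmx2 => //; try exact: integersM.
    by apply: integersB => //; exact: integersM.
  apply/(integers_div_unif pi_unif).
  have -> : t' - y * q = (t' / q - y) * q by field.
  exact: ge_valMr.
rewrite /= (pgl_dmxM _ _ lower_nbr_unit (GLO_unitmx gK0)) ek eY /K0 /Y0.
rewrite /lower_nbr !mx2M mx2D.
by apply: pgl_dmx_congr; apply: mx2_congr; field.
Qed.

End DoubleCoset.

Section HeckeSum.
Variables (F : localField) (pi : F).
Hypothesis pi_unif : is_uniformizer pi.
Implicit Types (b c x y : F) (g h k X Y : 'M[F]_2).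

(** Equality in [Geps] is up to a unit [v + eps w]. Equal determinants force [v] to be an integral
    unit, which [k] absorbs; [w] survives in the scalar [t], whose integrality is not controlled. *)
Lemma left_coset_dmx a a' X X' : a' \in unitmx -> a \in unitmx -> \det a = \det a' ->
  left_coset (pgl (dmx a X)) = left_coset (pgl (dmx a' X')) :> set (Geps F) ->
  exists k Z t, [/\ GLO k, intmx Z, a = a' *m k & X = a' *m (Z + t *: k) + X' *m k].
Proof.
move=> ua' ua dd /left_coset_mem[_ /KepsP[l [Y [gl hY ->]]]].
have ul := GLO_unitmx gl.
rewrite (pgl_dmxM _ _ ua' ul) => /eq_pgl[||u uu e].
- by rewrite dmx_unit.
- by rewrite dmx_unit unitmx_mul ua' ul.
move: e; rewrite (dual_decomp u) dmx_scale => /dmx_inj[ea eX].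
have {uu} u0 : re u != 0 by rewrite -dual_unitP.
set v := re u in u0 ea eX; set w := im u in eX.
have da' : \det a' != 0 by rewrite -unitfE -unitmxE.
have hu : integer_units F v.
  have [hl [dl0 vl]] := gl.
  have e1 : v ^+ 2 * \det l = 1.
    apply: (mulfI da'); rewrite mulr1 -[in RHS]dd ea detZ det_mulmx; ring.
  split=> //; have := congr1 (@lf_val F) e1.
  rewrite lf_valM ?sqrf_eq0 // vl expr2 lf_valM // lf_val1; lia.
exists (v *: l), (v *: Y), (w / v); split.
- by rewrite -mul_scalar_mx; apply: GLOM => //; exact: GLO_scalar.
- by apply: intmxZ => //; exact: units_integers.
- by rewrite ea -scalemxAr.
- rewrite eX scalerA divfK // scalerDr -!scalemxAr -scalerDr.
  rewrite mulmxDr -!scalemxAr !scalerDr.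
  by rewrite -!addrA; congr (_ + _); rewrite addrC.
Qed.

Definition nbr_in (s : seq F) (i : F * F + F) : Prop :=
  match i with inl bc => bc.1 \in s /\ bc.2 \in s | inr y => y \in s end.

Lemma nbr_inj (s : seq F) i j : residue_system s -> nbr_in s i -> nbr_in s j ->
  left_coset (nbr pi i) = left_coset (nbr pi j) -> i = j.
Proof.
move=> hs; have p0 := unif_neq0 pi_unif.
have mixed b c y : left_coset (nbr pi (inl (b, c))) <> left_coset (nbr pi (inr y)).
  move=> /(left_coset_dmx (lower_nbr_unit pi_unif) (upper_nbr_unit pi_unif b)).
  rewrite det_upper_nbr det_lower_nbr => /(_ erefl)[k [Z [t [[hk _] _ e _]]]].
  apply: (nonint_unifV pi_unif).
  suff <- : k 1 1 = pi^-1 by [].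
  move: e => /(congr1 (mulmx (mx2 1 0 0 pi^-1))).
  rewrite mulmxA /lower_nbr /upper_nbr !mx2M [k]mx2E mx2M => /matrixP/(_ 1 1).
  rewrite !mxE /= !(mul0r, mul1r, mulr1, mulr0, add0r, addr0) mulVf // mul1r.
  by move->.
case: i j => [[b c]|y] [[b' c']|y'] /= hi hj.
- case: hi hj => bs cs [bs' cs'].
  move=> /(left_coset_dmx (upper_nbr_unit pi_unif b') (upper_nbr_unit pi_unif b)).
  rewrite !det_upper_nbr => /(_ erefl)[k [Z [t [[hk _] hZ e eX]]]].
  pose V := mx2 pi^-1 (- b' / pi) 0 1.
  have VA : V *m upper_nbr pi b' = 1%:M.
    by rewrite /V /upper_nbr mx2M mx2_scalar; apply: mx2_congr; field.
  have ek : k = mx2 1 ((b - b') / pi) 0 1.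
    rewrite -[k]mul1mx -VA -mulmxA -e /V /upper_nbr mx2M.
    by apply: mx2_congr; field.
  have eb : b = b'.
    apply: (rs_inj hs) => //; apply/(integers_div_unif pi_unif).
    by have := hk 0 1; rewrite ek mxE.
  subst b'; rewrite subrr mul0r in ek.
  (* Now [k = 1], so [t] only affects the diagonal and the entry [(0, 1)] of the integral matrix [Z]
     is [(c - c') / pi]. *)
  suff -> : c = c' by [].
  apply: (rs_inj hs) => //; apply/(integers_div_unif pi_unif).
  suff <- : Z 0 1 = (c - c') / pi by [].
  move: eX => /(congr1 (mulmx V)).
  rewrite mulmxDr mulmxA VA mul1mx ek /V !mx2M => /matrixP/(_ 0 1).
  rewrite !mxE /= !(mul0r, mul1r, mulr1, mulr0, add0r, addr0) => h.
  by rewrite mulrBl [c / _]mulrC h; ring.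
- by move=> h; case: (mixed _ _ _ h).
- by move=> h; case: (mixed _ _ _ (esym h)).
- move=> /(left_coset_dmx (lower_nbr_unit pi_unif) (lower_nbr_unit pi_unif)).
  move=> /(_ erefl)[k [Z [t [[hk _] hZ e eX]]]].
  pose V : 'M[F]_2 := mx2 1 0 0 pi^-1.
  have VA : V *m lower_nbr pi = 1%:M.
    by rewrite /V /lower_nbr mx2M mx2_scalar; apply: mx2_congr; field.
  have ek : k = mx2 1 0 0 1.
    by rewrite -[k]mul1mx -VA -mulmxA -e VA mx2_scalar.
  suff -> : y = y' by [].
  apply: (rs_inj hs) => //; apply/(integers_div_unif pi_unif).
  suff <- : Z 1 0 = (y - y') / pi by [].
  move: eX => /(congr1 (mulmx V)).
  rewrite mulmxDr [V *m (_ *m (Z + _))]mulmxA VA mul1mx ek /V !mx2M => /matrixP/(_ 1 0).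
  rewrite !mxE /= !(mul0r, mul1r, mulr1, mulr0, add0r, addr0) => h.
  by rewrite mulrBl [y / _]mulrC h; ring.
Qed.

Definition nbr_index (s : seq F) : seq (F * F + F) :=
  [seq inl bc | bc <- [seq (b, c) | b <- s, c <- s]] ++ [seq inr y | y <- s].

Lemma nbr_indexP s i : i \in nbr_index s <-> nbr_in s i.
Proof.
rewrite mem_cat; split=> [/orP[/mapP[_ /allpairsP[[b c] [bs cs ->]] ->]|
  /mapP[y ys ->]]|] //=.
case: i => [[b c] [bs cs]|y ys]; apply/orP; [left|right].
  by apply: map_f; apply/allpairsP; exists (b, c).
by rewrite map_f.
Qed.

Lemma nbr_index_uniq s : uniq s -> uniq (nbr_index s).
Proof.
move=> us; rewrite cat_uniq !map_inj_uniq ?us ?andbT; last 2 first.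
- by move=> x y [].
- by move=> x y [].
rewrite allpairs_uniq //=; last by move=> [? ?] [? ?] _ _ [-> ->].
by apply/hasPn => _ /mapP[y _ ->]; apply/mapP => -[].
Qed.

Lemma big_nbr_index (V : nmodType) (h : F * F + F -> V) s :
  \sum_(i <- nbr_index s) h i =
  \sum_(b <- s) \sum_(c <- s) h (inl (b, c)) + \sum_(y <- s) h (inr y).
Proof. by rewrite big_cat !big_map big_allpairs. Qed.

Lemma HeckeE (R : realType) (f : Geps F -> R[i]) (s : seq F) (h : Geps F) :
  residue_system s -> (forall x k : Geps F, Keps F k -> f (x * k)%g = f x) ->
  Hecke pi 0 f h =
    (residue_card F)%:R^-1 * \sum_(i <- nbr_index s) f (h * nbr pi i)%g.
Proof.
move=> hs fK; rewrite /Hecke; congr (_ * _).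
have inj : {in nbr_index s &, injective (fun i => left_coset (nbr pi i))}.
  by move=> i j /nbr_indexP hi /nbr_indexP hj; exact: (nbr_inj hs hi hj).
have -> : [set c | c `<=` double_coset (g_elt pi 0) /\ exists x : Geps F, c = left_coset x] =
    [set` [seq left_coset (nbr pi i) | i <- nbr_index s]].
  apply/seteqP; split=> c /=.
    move=> [cD [x ec]].
    have : double_coset (g_elt pi 0) x.
      by apply: cD; rewrite ec; exact: left_coset_refl.
    move=> [k kk [k' kk' ex]]; have [i hi ei] := double_coset_nbr pi_unif hs kk.
    apply/mapP; exists i; first exact/nbr_indexP.
    by rewrite ec -ei; apply: left_coset_eq; exists k'.
  move=> /mapP[i /nbr_indexP hi ->]; split; last by eexists.
  move=> _ [k kk <-]; have [|k1 kk1 [k2 kk2 <-]] := @nbr_double_coset _ _ pi_unif i.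
    by case: (i) hi => [[b b'] [] |y] /=; do 2?[move/(rs_int hs) => ?].
  by exists k1 => //; exists (k2 * k)%g; [exact: KepsM|exact: mulgA].
rewrite -fsbig_seq; last by rewrite map_inj_in_uniq ?nbr_index_uniq ?rs_uniq.
rewrite big_map; apply: eq_bigr => i _.
set c := left_coset _.
have := xgetI 1%g (left_coset_refl (nbr pi i)); rewrite -/c.
by move=> [k kk <-]; rewrite mulgA; exact: fK.
Qed.

End HeckeSum.

(** * The Hecke operator *)

Section CosetSum.
Variables (T : groupType) (V : nmodType) (K : set T).
Hypothesis KM : forall x y, K x -> K y -> K (x * y)%g.
Hypothesis KV : forall x, K x -> K x^-1%g.
Hypothesis K1 : K 1%g.
Local Notation lcos x := [set (x * k)%g | k in K].

(** Left translation by [k] permutes the left cosets inside the double coset, and the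
    representatives chosen before and after it differ by right multiplication by elements of [K]. *)
Lemma coset_sum_invariant (g : T) (f : T -> V) (x k : T) :
  (forall x k, K k -> f (x * k)%g = f x) -> K k ->
  let S := [set c | c `<=` [set (k * g * k')%g | k in K & k' in K] /\
                    exists x, c = lcos x] in
  \sum_(c \in S) f (x * k * xget 1%g c)%g = \sum_(c \in S) f (x * xget 1%g c)%g.
Proof.
move=> fK kk S.
pose tr (l : T) (c : set T) := [set (l * y)%g | y in c].
have trK l c : tr l^-1%g (tr l c) = c.
  apply/seteqP; split=> [_ [_ [y cy <-] <-]|y cy].
    by rewrite mulgA mulVg mul1g.
  by exists (l * y)%g; [exists y|rewrite mulgA mulVg mul1g].
have trS l c : K l -> S c -> S (tr l c).
  move=> kl [cD [y ey]]; split.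
    move=> _ [w /cD [a ka [b kb <-]] <-].
    by exists (l * a)%g; [exact: KM|exists b; rewrite // !mulgA].
  exists (l * y)%g; rewrite ey; apply/seteqP; split.
    by move=> _ [_ [w kw <-] <-]; exists w; rewrite // mulgA.
  by move=> _ [w kw <-]; exists (y * w)%g; [exists w|rewrite mulgA].
have bij : set_bij S S (tr k).
  split; first by move=> c /(trS _ _ kk).
    by move=> c c' _ _ e; rewrite -[c](trK k) e trK.
  move=> c Sc; exists (tr k^-1%g c); first exact: (trS _ _ (KV kk) Sc).
  by rewrite -{1}(invgK k) trK.
have coset_mem y : lcos y (xget 1%g (lcos y)).
  by apply: (@xgetI _ _ _ y); exists 1%g; rewrite ?mulg1.
rewrite [RHS](reindex_fsbig _ _ _ _ bij); apply: eq_fsbigr => c; rewrite inE => Sc.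
have [_ [y ey]] := Sc; have [_ [w ew]] := trS _ _ kk Sc.
have := coset_mem y; rewrite -{2}ey => -[l1 kl1 <-].
have h := coset_mem w; rewrite -ew in h.
have [a ca <-] := h; move: ca; rewrite ey => -[l2 kl2 <-].
by rewrite !mulgA (fK _ _ kl1) (fK _ _ kl2).
Qed.

End CosetSum.

Section HeckeAction.
Variables (R : realType) (F : localField).
Local Notation C := R[i].
Variables (psi : F -> C) (m : 'M[F]_2) (chi : G F -> C) (pi : F).
Implicit Types (f : Geps F -> C) (g z X Y k : 'M[F]_2).
Hypothesis charF : (2%:R : F) != 0.
Hypothesis psi_char : additive_character psi.
Hypothesis trm : \tr m = 0.
Hypothesis pi_unif : is_uniformizer pi.
Local Notation equivariant := (equivariant psi m chi).
Local Notation VrepK := (VrepK psi m chi).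
Local Notation T := (Hecke pi 0).

(** The definition of [Vrep] imposes its covariance only at points of [G], but the translates by
    [nbr] in the Hecke sum leave [G]. This lemma and the next extend both rules to all of [Geps]. *)
Lemma equivariant_epsM f (m' : 'M[F]_2) (x : Geps F) : equivariant f -> \tr m' = 0 ->
  f (one_plus_eps m' * x)%g = psi (\tr (m *m m')) * f x.
Proof.
move=> ef t; have [g [Y [ug ->]]] := Geps_surj x.
rewrite one_plus_epsE (pgl_dmxM _ _ (unitmx1 _ _) ug) !mul1mx.
apply: (etrans (equivariant_dmx charF trm (Y + m' *m g) ef ug)).
apply: (etrans _ (congr1 _ (esym (equivariant_dmx charF trm Y ef ug)))).
rewrite mulrA; congr (_ * _); have [psiD _ _] := psi_char; rewrite -psiD.
by rewrite mulmxDl mulmxK // mulmxDr mxtraceD addrC.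
Qed.

Lemma equivariant_inclM f (z : G F) (x : Geps F) : equivariant f -> stabilizer m z ->
  f (incl z * x)%g = chi z * f x.
Proof.
move=> ef; have [h uh ->] := G_surj z; move=> /(stabilizer_pgl m uh) ch.
have [g [Y [ug ->]]] := Geps_surj x; rewrite (incl_pgl uh) (pgl_dmxM _ _ uh ug).
have uhg : h *m g \in unitmx by rewrite unitmx_mul uh.
apply: (etrans (equivariant_dmx charF trm (h *m Y + 0 *m g) ef uhg)).
apply: (etrans _ (congr1 _ (esym (equivariant_dmx charF trm Y ef ug)))).
rewrite (restr_stabilizer ef uh ch ug) mulrCA; congr (_ * (psi _ * _)).
rewrite mul0mx addr0 (invmx_mul uh ug) !mulmxA -ch -!mulmxA mxtrace_mulC -!mulmxA.
by rewrite mulVmx // mulmx1.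
Qed.

Lemma Hecke_Keps f (x k : Geps F) : (forall x k : Geps F, Keps F k -> f (x * k)%g = f x) ->
  Keps F k -> T f (x * k)%g = T f x.
Proof.
move=> fK kk.
have e := coset_sum_invariant (K := Keps F) (@KepsM F) (@KepsV F) (Keps1 F)
  (g_elt pi 0) x fK kk.
rewrite /Hecke; exact (congr1 (fun t : C => (residue_card F)%:R^-1 * t) e).
Qed.

Lemma Hecke_equivariant f : equivariant f -> equivariant (T f).
Proof.
move=> ef; have [_ _ fK] := ef; have [s hs] := residue_system_exists F.
split=> [m' g t|z g sz|x k kk]; last exact: Hecke_Keps.
- rewrite [LHS](HeckeE pi_unif (one_plus_eps m' * incl g)%g hs fK).
  rewrite [X in _ = _ * X](HeckeE pi_unif (incl g) hs fK) [RHS]mulrCA.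
  congr (_ * _); rewrite big_distrr; apply: eq_bigr => i _.
  apply: (etrans (congr1 f (esym (mulgA (one_plus_eps m') (incl g) (nbr pi i))))).
  exact: equivariant_epsM.
- rewrite [LHS](HeckeE pi_unif (incl z * incl g)%g hs fK).
  rewrite [X in _ = _ * X](HeckeE pi_unif (incl g) hs fK) [RHS]mulrCA.
  congr (_ * _); rewrite big_distrr; apply: eq_bigr => i _.
  apply: (etrans (congr1 f (esym (mulgA (incl z) (incl g) (nbr pi i))))).
  exact: equivariant_inclM.
Qed.

Definition nbr_mx (i : F * F + F) : 'M[F]_2 :=
  match i with inl bc => upper_nbr pi bc.1 | inr _ => lower_nbr pi end.

Definition nbr_eps (i : F * F + F) : 'M[F]_2 :=
  match i with inl bc => mx2 0 bc.2 0 0 | inr y => mx2 0 0 y 0 end.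

Lemma nbr_mx_unit i : nbr_mx i \in unitmx.
Proof. by case: i => [[b c]|y]; [exact: upper_nbr_unit|exact: lower_nbr_unit]. Qed.

Lemma equivariant_nbr f g i : equivariant f -> g \in unitmx ->
  f (pgl (dmx g 0) * nbr pi i)%g =
  psi (\tr (invmx g *m m *m g *m nbr_eps i)) * restr f (g *m nbr_mx i).
Proof.
move=> ef ug; have un := nbr_mx_unit i.
have -> : nbr pi i = pgl (dmx (nbr_mx i) (nbr_eps i)) by case: i {un} => [[]|].
rewrite (pgl_dmxM _ _ ug un).
have ugn : g *m nbr_mx i \in unitmx by rewrite unitmx_mul ug.
apply: (etrans (equivariant_dmx charF trm (g *m nbr_eps i + 0 *m nbr_mx i) ef ugn)).
congr (psi _ * _); rewrite mul0mx addr0 (invmx_mul ug un).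
have en : nbr_eps i *m invmx (nbr_mx i) = nbr_eps i.
  rewrite -[in LHS](_ : nbr_eps i *m nbr_mx i = nbr_eps i) ?mulmxK //.
  case: (i) => [[b c]|y]; rewrite /nbr_eps /nbr_mx /= /upper_nbr /lower_nbr mx2M;
  by apply: mx2_congr; ring.
rewrite !mulmxA -[m *m g *m _ *m _]mulmxA en [LHS]mxtrace_mulC !mulmxA //.
Qed.

Lemma Hecke_VrepK f : VrepK f -> VrepK (T f).
Proof.
move=> /VrepKP[ef [D cD sD]]; apply/VrepKP; split; first exact: Hecke_equivariant.
have [_ _ fK] := ef; have [s hs] := residue_system_exists F.
(* If [T f] is nonzero at [g], then [f] is nonzero at some neighbour of [g]. So finitely many right
   translates of [D] cover the support modulo the stabilizer. *)
exists (\big[setU/set0]_(i <- nbr_index s)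
  [set (d * (pgl (nbr_mx i) : G F)^-1)%g | d in D]).
  apply: bigsetU_compact => i _; apply: continuous_compact => //.
  by apply: continuous_subspaceT; exact: continuous_mulr.
move=> x /=; have [g ug ->] := G_surj x.
rewrite (HeckeE pi_unif _ hs fK) (incl_pgl ug) mulf_eq0 negb_or => /andP[_ h].
have [i iI fi] : exists2 i, i \in nbr_index s & f (pgl (dmx g 0) * nbr pi i)%g != 0.
  apply/not_exists2P => hn; move/eqP: h; apply; rewrite big_seq big1 // => i iI.
  by apply/eqP; have [|/negP] := hn i => //; rewrite negbK.
move: fi; rewrite equivariant_nbr // mulf_eq0 negb_or => /andP[_].
have un := nbr_mx_unit i.
have ugn : g *m nbr_mx i \in unitmx by rewrite unitmx_mul ug.
rewrite -(restr_incl f ugn) => /sD[z sz [d dD e]].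
exists z => //; exists (d * (pgl (nbr_mx i) : G F)^-1)%g.
  rewrite -bigcup_seq; exists i => //; by exists d.
by rewrite mulgA e -(pglM_G ug un) -mulgA mulgV mulg1.
Qed.

(** Integrality of [M] makes every factor [psi] equal to 1, so the [q] lifts of a neighbour
    contribute equally and cancel the normalising factor. *)
Lemma Hecke_restr f (s : seq F) g : residue_system s -> equivariant f -> g \in unitmx ->
  intmx (invmx g *m m *m g) ->
  restr (T f) g = \sum_(b <- s) restr f (g *m upper_nbr pi b) +
    restr f (g *m lower_nbr pi).
Proof.
move=> hs ef ug hM; have [_ _ fK] := ef.
have e i : nbr_in s i -> f (pgl (dmx g 0) * nbr pi i)%g = restr f (g *m nbr_mx i).
  move=> hi; apply: (etrans (equivariant_nbr i ef ug)).
  rewrite psi_integers ?mul1r // [X in X *m _]mx2E.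
  have [i0 h] := (@integers0 F, rs_int hs).
  case: i hi => [[b c] [/= /h hb /h hc]|y /= /h hy]; rewrite mx2M tr_mx2;
    by rewrite ?mulr0 ?addr0 ?add0r; apply: integersM.
have q0 : (residue_card F)%:R != 0 :> C.
  by rewrite pnatr_eq0 -lt0n (ltn_trans _ (residue_card_gt1 F)).
have cst (c : C) : \sum_(y <- s) c = (residue_card F)%:R * c.
  by rewrite big_const_seq iter_addr_0 count_predT rs_size // mulr_natl.
apply: (etrans (HeckeE pi_unif (pgl (dmx g 0)) hs fK)).
have -> : \sum_(i <- nbr_index s) f (pgl (dmx g 0) * nbr pi i)%g =
    \sum_(i <- nbr_index s) restr f (g *m nbr_mx i).
  by apply: eq_big_seq => i /nbr_indexP; exact: e.
rewrite big_nbr_index [X in _ * (_ + X)](cst (restr f (g *m lower_nbr pi))).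
rewrite (eq_bigr (fun b => (residue_card F)%:R * restr f (g *m upper_nbr pi b))).
  by rewrite -mulr_sumr -mulrDr mulKf.
by move=> b _; exact: (cst (restr f (g *m upper_nbr pi b))).
Qed.

End HeckeAction.

(** * Levels of lattices *)

Section Levels.
Variables (F : localField) (m : 'M[F]_2) (pi : F).
Implicit Types (g k z M N : 'M[F]_2) (a b t d : F) (n : nat).
Hypothesis charF : (2%:R : F) != 0.
Hypothesis trm : \tr m = 0.
Hypothesis pi_unif : is_uniformizer pi.

Definition conjm g : 'M[F]_2 := invmx g *m m *m g.

Definition scalar_mod n M : Prop :=
  exists s N, [/\ integers F s, intmx N & M = s%:M + pi ^+ n *: N].

(** Multiplication by a root of [X^2 - t X + d] in the basis formed by 1 and that root. *)
Definition companion t d : 'M[F]_2 := mx2 0 (- d) 1 t.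

(** The first column of [g] is a cyclic vector for [(M - a) / pi ^ n]. This is a choice of basis
    within the lattice, made so that [lower_nbr] always points to the level below. *)
Definition companion_basis n g a t d : Prop :=
  [/\ g \in unitmx, integers F a, integers F t, integers F d
    & m *m g = g *m (a%:M + pi ^+ n *: companion t d)].

Definition at_level n g : Prop := exists a t d, companion_basis n g a t d.

Lemma conjmM g k : g \in unitmx -> k \in unitmx ->
  conjm (g *m k) = invmx k *m conjm g *m k.
Proof. by move=> ug uk; rewrite /conjm invmx_mul // !mulmxA. Qed.

Lemma scalar_mod_intmx n M : scalar_mod n M -> intmx M.
Proof.
move=> [s [N [hs hN ->]]]; apply: intmxD; first exact: intmx_scalar.
by apply: intmxZ => //; apply/integersX/integers_unif.
Qed.

Lemma scalar_mod_le n n' M : (n <= n')%N -> scalar_mod n' M -> scalar_mod n M.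
Proof.
move=> le [s [N [hs hN ->]]]; exists s, (pi ^+ (n' - n) *: N); split=> //.
  by apply: intmxZ => //; apply/integersX/integers_unif.
by rewrite scalerA -exprD subnKC.
Qed.

Lemma scalar_mod_conj n M k : GLO k -> scalar_mod n M ->
  scalar_mod n (invmx k *m M *m k).
Proof.
move=> gk [s [N [hs hN ->]]]; have uk := GLO_unitmx gk.
exists s, (invmx k *m N *m k); split=> //.
  by have [? _] := gk; have [? _] := GLOV gk; apply: intmxM => //; apply: intmxM.
rewrite mulmxDr mulmxDl -!mulmxA mul_scalar_mx -scalemxAr mulVmx // scalemx1.
by rewrite -scalemxAl -scalemxAr.
Qed.

Lemma conjm_companion n g a t d : companion_basis n g a t d ->
  conjm g = a%:M + pi ^+ n *: companion t d.
Proof. by move=> [ug _ _ _ e]; rewrite /conjm -mulmxA e mulKmx. Qed.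

Lemma intmx_companion t d : integers F t -> integers F d -> intmx (companion t d).
Proof.
move=> ht hd; apply: intmx2 => //; first exact: integers0.
- exact: integersN.
- exact: integers1.
Qed.

Lemma at_level_scalar_mod n g : at_level n g -> scalar_mod n (conjm g).
Proof.
move=> [a [t [d h]]]; have [_ ha ht hd _] := h; rewrite (conjm_companion h).
by exists a, (companion t d); split=> //; exact: intmx_companion.
Qed.

Lemma at_level_not_scalar_mod n g : at_level n g -> ~ scalar_mod n.+1 (conjm g).
Proof.
move=> [a [t [d h]]]; rewrite (conjm_companion h) => -[s [N [hs hN]]].
rewrite !mx2_scalar mx2Z [N]mx2E mx2Z !mx2D => /matrixP/(_ 1 0).
rewrite !mxE /= !add0r mulr1 exprS -mulrA mulrCA => /eqP.
rewrite -{1}[pi ^+ n]mulr1 (inj_eq (mulfI (unifX_neq0 pi_unif n))) => /eqP e.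
by apply: (@units_nonint F 1 (units1 F)); rewrite e; apply/(ge_val_unif pi_unif).
Qed.

Lemma at_level_unit n g : at_level n g -> g \in unitmx.
Proof. by case=> [a [t [d []]]]. Qed.

Lemma at_level_intmx n g : at_level n g -> intmx (conjm g).
Proof. by move=> /at_level_scalar_mod/scalar_mod_intmx. Qed.

Lemma at_level_uniq n n' g : at_level n g -> scalar_mod n' (conjm g) ->
  ~ scalar_mod n'.+1 (conjm g) -> n = n'.
Proof.
move=> h h' nh'; have s := at_level_scalar_mod h; have ns := at_level_not_scalar_mod h.
have [lt|lt|//] := ltngtP n n'.
  by case: ns; exact: scalar_mod_le lt h'.
by case: nh'; exact: scalar_mod_le lt s.
Qed.

Lemma last_nat (P : nat -> Prop) n : P 0%N -> ~ P n -> exists n, P n /\ ~ P n.+1.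
Proof.
move=> P0; elim: n => [//|n IH] hn.
by have [Pn|/IH//] := pselect (P n); exists n.
Qed.

(** With [w = -2x], [M] is the scalar [x] plus the matrix with rows [(0, y)] and [(z, w)]. The
    largest power of [pi] dividing [y], [z] and [w] exists because [M] and 2 are nonzero, and
    dividing it out leaves a matrix that is not scalar modulo [pi]. *)
Lemma at_level_exists g : m != 0 -> g \in unitmx -> intmx (conjm g) ->
  exists n k, GLO k /\ at_level n (g *m k).
Proof.
move=> m_neq0 ug; set M := conjm g => hM.
have trM : \tr M = 0 by rewrite /M /conjm mxtrace_mulC mulmxA mulmxV // mul1mx.
set x := M 0 0; set y := M 0 1; set z := M 1 0; pose w := - (2%:R * x).
have eM : M = mx2 x y z (- x).
  rewrite [LHS]mx2E; apply: mx2_congr => //.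
  by move: trM; rewrite {1}[M]mx2E tr_mx2 -/x => /eqP; rewrite addrC addr_eq0 => /eqP.
have M0 : M != 0.
  apply: contra_neq m_neq0 => M0.
  have : g *m M *m invmx g = m.
    by rewrite /M /conjm !mulmxA mulmxV // mul1mx mulmxK.
  by rewrite M0 mulmx0 mul0mx.
pose P (n : nat) := [/\ ge_val n%:Z y, ge_val n%:Z z & ge_val n%:Z w].
have [hx hy hz] : [/\ integers F x, integers F y & integers F z] by split; exact: hM.
have hw : integers F w by apply/integersN/integersM => //; exact: integers_nat.
have [n notP] : exists n, ~ P n.
  have no u : u != 0 -> integers F u -> exists n : nat, ~ ge_val n%:Z u.
    move=> u0 [/eqP|hu]; first by rewrite (negPf u0).
    exists `|lf_val u|.+1%N => -[/eqP|]; first by rewrite (negPf u0).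
    lia.
  have [y0|/no/(_ hy)[n hn]] := eqVneq y 0; last by exists n => -[].
  have [z0|/no/(_ hz)[n hn]] := eqVneq z 0; last by exists n => -[].
  have [w0|/no/(_ hw)[n hn]] := eqVneq w 0; last by exists n => -[].
  move: w0 => /eqP; rewrite oppr_eq0 mulf_eq0 (negPf charF) /= => /eqP x0.
  by move: M0; rewrite eM x0 y0 z0 oppr0 -mx2_0 eqxx.
have [n' [Pn nP]] := last_nat (And3 hy hz hw : P 0%N) notP.
move: n' Pn nP {n notP} => n [Py Pz Pw] nP.
have p0 := unifX_neq0 pi_unif n.
have dec u : ge_val n%:Z u -> exists2 u0, integers F u0 & u = pi ^+ n * u0.
  move=> /(integers_div_unifX pi_unif) hu; exists (u / pi ^+ n) => //.
  by rewrite mulrC divfK.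
have [y0 hy0 ey] := dec _ Py; have [z0 hz0 ez] := dec _ Pz.
have [w0 hw0 ew] := dec _ Pw.
have some : integer_units F z0 \/ integer_units F y0 \/
    [/\ ge_val 1 z0, ge_val 1 y0 & integer_units F w0].
  have [uz|nz] := units_or hz0; first by left.
  have [uy|ny] := units_or hy0; first by right; left.
  have [uw|nw] := units_or hw0; first by right; right.
  have e (u : F) : ge_val 1 u -> ge_val n.+1%:Z (pi ^+ n * u).
    have -> : n.+1%:Z = n%:Z + 1 by lia.
    by apply: ge_valM; right; rewrite lf_val_unifX.
  by case: nP; split; rewrite ?ey ?ez ?ew; exact: e.
suff [k gk ek] : exists2 k, GLO k &
    mx2 0 y0 z0 w0 *m k = k *m companion w0 (- (y0 * z0)).
  exists n, k; split=> //; exists x, w0, (- (y0 * z0)).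
  have uk := GLO_unitmx gk; split=> //; first by rewrite unitmx_mul ug.
    by apply/integersN/integersM.
  have -> : m *m (g *m k) = g *m (M *m k).
    by rewrite /M /conjm !mulmxA mulmxV // mul1mx.
  have -> : M = x%:M + pi ^+ n *: mx2 0 y0 z0 w0.
    rewrite eM mx2_scalar mx2Z mx2D -ey -ez -ew /w; apply: mx2_congr; ring.
  rewrite -[RHS]mulmxA; congr (g *m _).
  by rewrite mulmxDl mulmxDr mul_scalar_mx mul_mx_scalar -scalemxAl -scalemxAr ek.
have [i0 i1] := (@integers0 F, @integers1 F).
(* The cyclic vectors, as first columns of [k], are in turn [e_1], [e_2] and [e_1 + e_2]. *)
case: some => [uz|[uy|[nz ny uw]]].
- exists (mx2 1 0 0 z0).
    by split; [exact: intmx2|rewrite det_mx2 mul1r mul0r subr0].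
  by rewrite /companion !mx2M; apply: mx2_congr; ring.
- exists (mx2 0 y0 1 w0).
    by split; [exact: intmx2|rewrite det_mx2 mul0r mulr1 sub0r; exact: unitsN].
  by rewrite /companion !mx2M; apply: mx2_congr; ring.
- exists (mx2 1 y0 1 (z0 + w0)).
    split; first by apply: intmx2 => //; exact: integersD.
    rewrite det_mx2; have -> : 1 * (z0 + w0) - y0 * 1 = w0 + (z0 - y0) by ring.
    by apply: unitsD => //; exact: ge_valB.
  by rewrite /companion !mx2M; apply: mx2_congr; ring.
Qed.

Lemma companion_trace n g a t d : companion_basis n g a t d ->
  pi ^+ n * t = - (2%:R * a).
Proof.
move=> h; have [ug _ _ _ _] := h.
have : \tr (conjm g) = 0 by rewrite /conjm mxtrace_mulC mulmxA mulmxV // mul1mx.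
rewrite (conjm_companion h) mx2_scalar mx2Z mx2D tr_mx2 => /eqP.
rewrite -subr_eq0 => /eqP h'; apply/eqP; rewrite -subr_eq0 -[X in _ == X]h'; apply/eqP; ring.
Qed.

Lemma companion_det n g a t d : companion_basis n g a t d ->
  \det m = (pi ^+ n) ^+ 2 * d - a ^+ 2.
Proof.
move=> h; have [ug _ _ _ _] := h.
have -> : \det m = \det (conjm g).
  by rewrite /conjm !det_mulmx mulrC mulrA -det_mulmx mulmxV // det1 mul1r.
rewrite (conjm_companion h) mx2_scalar mx2Z mx2D det_mx2.
rewrite (companion_trace h); ring.
Qed.

(** Trace and determinant of [m] tie [t] and [d] to [a]. Once [a] and [a'] agree modulo [pi ^ n], a
    unipotent change of basis makes the two companion matrices equal, and the map between the two
    bases then commutes with [m]. *)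
Lemma at_level_conj n g g' : at_level n g -> at_level n g' ->
  exists z k, [/\ z \in unitmx, z *m m = m *m z, GLO k & g' = z *m g *m k].
Proof.
move=> [a [t [d h]]] [a' [t' [d' h']]].
have [ug ha ht hd e] := h; have [ug' ha' ht' hd' e'] := h'.
set p := pi ^+ n in e e'; have p0 : p != 0 := unifX_neq0 pi_unif n.
have tr := companion_trace h; have tr' := companion_trace h'.
have det : p ^+ 2 * (d - d') = (a - a') * (a + a').
  have := companion_det h; rewrite (companion_det h') -/p => ed.
  have -> : (a - a') * (a + a') = a ^+ 2 - a' ^+ 2 by ring.
  have -> : p ^+ 2 * (d - d') = (p ^+ 2 * d - a ^+ 2) -
        (p ^+ 2 * d' - a' ^+ 2) + (a ^+ 2 - a' ^+ 2) by ring.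
  by rewrite ed subrr add0r.
have vp : lf_val p = n%:Z by exact: lf_val_unifX.
have h2 : ge_val n%:Z (2%:R * a').
  by rewrite -[_ * a']opprK -tr' -mulrN; apply/(ge_val_unifX pi_unif)/integersN.
(* If [v(a - a') < n], then [v(a + a') <= v(a - a')] because [pi ^ n] divides [2 a']. The product
   would have valuation below [2n], against [det]. No division by 2 is involved. *)
have aa : ge_val n%:Z (a - a').
  have [->|n0] := eqVneq (a - a') 0; first by left.
  right; rewrite leNgt; apply/negP => lt.
  have nn : ~ ge_val (lf_val (a - a') + 1) (a - a').
    by move=> [/eqP|]; [rewrite (negPf n0)|lia].
  have n2 : ~ ge_val (lf_val (a - a') + 1) (a + a').
    move=> h3; apply: nn; have e3 : a - a' = (a + a') - 2%:R * a' by ring.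
    rewrite [X in ge_val _ X]e3.
    apply: ge_valB => //.
    have le : lf_val (a - a') + 1 <= n%:Z by lia.
    exact: (ge_val_decr le h2).
  have m0 : a + a' != 0 by apply/eqP => e0; apply: n2; left.
  have lt2 : lf_val (a + a') < lf_val (a - a') + 1.
    by rewrite ltNge; apply/negP => le; apply: n2; right.
  have : ge_val (n%:Z + n%:Z) (p ^+ 2 * (d - d')).
    apply: ge_valMr; last exact: integersB.
    by right; rewrite expr2 lf_valM // vp.
  rewrite det => -[/eqP|]; first by rewrite mulf_eq0 (negPf n0) (negPf m0).
  rewrite lf_valM //; lia.
pose s := (a - a') / p; have hs : integers F s by apply/(integers_div_unifX pi_unif).
have ea : a = a' + p * s by rewrite /s mulrC divfK // addrC subrK.
have et : t' = t + 2%:R * s.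
  by apply: (mulfI p0); rewrite tr' mulrDr tr ea; ring.
have edd : d = d' - s * (t + s).
  apply: (mulfI (expf_neq0 2 p0)); apply/eqP; rewrite -subr_eq0; apply/eqP.
  have -> : p ^+ 2 * d - p ^+ 2 * (d' - s * (t + s)) =
        p ^+ 2 * (d - d') + p * s * (p * t + p * s) by ring.
  rewrite det tr ea; ring.
pose k := mx2 1 s 0 1.
have gk : GLO k.
  split; first by apply: intmx2 => //; [exact: integers1|exact: integers0|exact: integers1].
  by rewrite det_mx2 mulr1 mulr0 subr0; exact: units1.
have uk := GLO_unitmx gk.
have e1 : m *m (g *m k) = (g *m k) *m (a'%:M + p *: companion t' d').
  rewrite mulmxA e -mulmxA -[RHS]mulmxA; congr (g *m _).
  rewrite !mx2_scalar /companion /k !mx2Z !mx2D !mx2M et ea edd.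
  by apply: mx2_congr; ring.
have ugk : g *m k \in unitmx by rewrite unitmx_mul ug.
exists (g' *m invmx (g *m k)), k; split=> //.
- by rewrite unitmx_mul ug' unitmx_inv.
- rewrite mulmxA e'; set M := _ + _ in e' e1 *.
  rewrite -[LHS]mulmxA; have -> : invmx (g *m k) *m m = M *m invmx (g *m k).
    by apply: (can_inj (mulmxK ugk)); rewrite /= mulmxKV // -mulmxA e1 mulKmx.
  by rewrite mulmxA.
- by rewrite -mulmxA mulmxKV.
Qed.

End Levels.

(** * The neighbours of a vertex of given level *)

Section Neighbours.
Variables (R : realType) (F : localField).
Local Notation C := R[i].
Variables (psi : F -> C) (m : 'M[F]_2) (chi : G F -> C) (pi : F).
Implicit Types (f : Geps F -> C) (g h z k : 'M[F]_2) (a b t d : F) (n : nat).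
Hypothesis charF : (2%:R : F) != 0.
Hypothesis psi_char : additive_character psi.
Hypothesis trm : \tr m = 0.
Hypothesis pi_unif : is_uniformizer pi.
Local Notation equivariant := (equivariant psi m chi).
Local Notation T := (Hecke pi 0).
Local Notation A := (upper_nbr pi).
Local Notation B := (lower_nbr pi).
Local Notation basis := (companion_basis m pi).

(** Write [C] for the companion matrix and [e] for its cyclic vector: [e] and [pi C e] form a
    companion basis for [pi C], whose trace and determinant are [pi t] and [pi^2 d]. *)
Lemma companion_basis_lower n g a t d : basis n.+1 g a t d ->
  basis n (g *m B) a (pi * t) (pi ^+ 2 * d).
Proof.
move=> [ug ha ht hd e]; have hp := integers_unif pi_unif; split=> //.
- by rewrite unitmx_mul ug lower_nbr_unit.
- exact: integersM.
- by apply: integersM => //; exact: integersX.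
- rewrite mulmxA e -mulmxA -[RHS]mulmxA; congr (g *m _).
  rewrite !mx2_scalar /companion /lower_nbr !mx2Z !mx2D !mx2M exprS.
  by apply: mx2_congr; ring.
Qed.

Lemma companion_basis0_lower g a t d : basis 0 g a t d -> ~ intmx (conjm m (g *m B)).
Proof.
move=> h; have [ug _ _ _ _] := h; have p0 := unif_neq0 pi_unif.
rewrite (conjmM _ ug (lower_nbr_unit pi_unif)) (conjm_companion h) => /(_ 1 0).
rewrite inv_mx2; last by rewrite mulr0 subr0 mul1r unitfE.
rewrite mx2_scalar /companion !mx2Z !mx2D !mx2M mxE /=.
rewrite [X in integers F X](_ : _ = pi^-1); first exact: nonint_unifV.
by field.
Qed.

Lemma restr_level0_lower f g a t d : equivariant f -> basis 0 g a t d ->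
  restr f (g *m B) = 0.
Proof.
move=> ef h; have [ug _ _ _ _] := h; apply/eqP/negPn/negP => n0.
apply: (companion_basis0_lower h).
by apply: (restr_neq0_intmx charF psi_char trm ef _ n0); rewrite unitmx_mul ug lower_nbr_unit.
Qed.

(** In the basis [g], a matrix commuting with the companion matrix is an element [z] of the
    centralizer of [m]. Right multiplication by it thus becomes left multiplication by [z], which
    [chi] describes. *)
Lemma centralizer_act n g a t d k : basis n g a t d -> k \in unitmx ->
  k *m companion t d = companion t d *m k ->
  exists z, [/\ z \in unitmx, z *m m = m *m z, z *m g = g *m k &
    forall f h, equivariant f -> h \in unitmx ->
      restr f (g *m k *m h) = chi (pgl z) * restr f (g *m h)].
Proof.
move=> [ug _ _ _ e] uk ck; set M := _ + _ in e.
have cM : k *m M = M *m k.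
  by rewrite mulmxDr mulmxDl mul_scalar_mx mul_mx_scalar -scalemxAr -scalemxAl ck.
have uz : g *m k *m invmx g \in unitmx by rewrite !unitmx_mul ug uk unitmx_inv.
have zg : g *m k *m invmx g *m g = g *m k by rewrite mulmxKV.
have cz : g *m k *m invmx g *m m = m *m (g *m k *m invmx g).
  apply: (can_inj (mulmxK ug)); rewrite /= -[LHS]mulmxA e [LHS]mulmxA zg -[LHS]mulmxA cM.
  by rewrite -[RHS]mulmxA zg !mulmxA e.
exists (g *m k *m invmx g); split=> // f h ef uh.
have ugh : g *m h \in unitmx by rewrite unitmx_mul ug.
by rewrite -(restr_stabilizer ef uz cz ugh) [in RHS]mulmxA zg.
Qed.

Definition shift_companion b t d : 'M[F]_2 := mx2 b (- d) 1 (t + b).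

Lemma shift_companion_comm b t d :
  shift_companion b t d *m companion t d = companion t d *m shift_companion b t d.
Proof. by rewrite !mx2M; apply: mx2_congr; ring. Qed.

Lemma det_shift_companion b t d : \det (shift_companion b t d) = b ^+ 2 + t * b + d.
Proof. by rewrite det_mx2; ring. Qed.

(** [companion t d + b] commutes with the companion matrix and sends [(1, 0)] to [(b, 1)], hence
    neighbour [B] to neighbour [A b]; its determinant is a unit, so it fixes the vertex [g]. If some
    equivariant function is nonzero at [g], this forces [chi] to be 1 there; otherwise both values
    vanish with [restr f (g *m B)]. *)
Lemma restr_nonroot f n g a t d b : equivariant f -> basis n g a t d -> integers F b ->
  integer_units F (b ^+ 2 + t * b + d) ->
  (exists2 f0, equivariant f0 & restr f0 g != 0) \/ restr f (g *m B) = 0 ->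
  restr f (g *m A b) = restr f (g *m B).
Proof.
move=> ef h hb ur nz; have [ug ha ht hd e] := h.
have [i0 i1] := (@integers0 F, @integers1 F); have p0 := unif_neq0 pi_unif.
have gk : GLO (shift_companion b t d).
  split; last by rewrite det_shift_companion.
  by apply: intmx2 => //; [exact: integersN|exact: integersD].
have uk := GLO_unitmx gk.
pose k2 := mx2 0 (- (b ^+ 2 + t * b + d)) 1 ((t + b) * pi).
have gk2 : GLO k2.
  split; last by rewrite det_mx2 mul0r mulr1 sub0r opprK.
  apply: intmx2 => //; first exact/integersN/units_integers.
  by apply: integersM; [exact: integersD|exact: integers_unif].
have ek : shift_companion b t d *m B = A b *m k2.
  by rewrite !mx2M; apply: mx2_congr; ring.
have [z [uz cz zg act]] := centralizer_act h uk (shift_companion_comm b t d).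
have uB := lower_nbr_unit pi_unif; have uA := upper_nbr_unit pi_unif b.
have ugA : g *m A b \in unitmx by rewrite unitmx_mul ug.
have e1 : restr f (g *m A b) = chi (pgl z) * restr f (g *m B).
  by rewrite -(act _ _ ef uB) -[in RHS]mulmxA ek mulmxA (restr_GLO ef ugA gk2).
case: nz => [[f0 ef0 n0]|z0]; last by rewrite e1 z0 mulr0.
have := act f0 1%:M ef0 (unitmx1 _ _); rewrite !mulmx1 (restr_GLO ef0 ug gk) => h1.
have c1 : chi (pgl z) = 1 by apply: (mulIf n0); rewrite mul1r.
by rewrite e1 c1 mul1r.
Qed.

(** The condition that [(b, 1)] spans an eigenline of [companion t d] modulo [pi]. The polynomial is
    the characteristic polynomial at [-b], so roots here are the negatives of eigenvalues. *)
Definition is_root_mod t d b : bool := `[< ge_val 1 (b ^+ 2 + t * b + d) >].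

Lemma Hecke_at_level f (s : seq F) n g a t d : residue_system s -> equivariant f ->
  basis n g a t d ->
  (exists2 f0, equivariant f0 & restr f0 g != 0) \/ restr f (g *m B) = 0 ->
  restr (T f) g = \sum_(b <- s | is_root_mod t d b) restr f (g *m A b) +
    (count (predC (is_root_mod t d)) s).+1%:R * restr f (g *m B).
Proof.
move=> hs ef h nz; have [ug ha ht hd _] := h.
have hM : intmx (invmx g *m m *m g).
  by apply: (at_level_intmx pi_unif (n := n)); exists a, t, d.
rewrite (Hecke_restr charF psi_char trm pi_unif hs ef ug hM).
rewrite (bigID (is_root_mod t d)) /= -addrA; congr (_ + _).
rewrite -natr1 mulrDl mul1r; congr (_ + _).
rewrite big_seq_cond (eq_bigr (fun=> restr f (g *m B))); last first.
  move=> b /andP[bs /asboolPn nb]; have hb := rs_int hs bs.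
  apply: (restr_nonroot ef h hb _ nz); apply/integer_unitsP; split=> //.
  by apply: integersD => //; apply: integersD; [exact: integersX|exact: integersM].
by rewrite -big_seq_cond big_const_seq iter_addr_0 mulr_natl.
Qed.

Lemma upper_nbr_congr b c : ge_val 1 (b - c) ->
  exists2 k, GLO k & A b = A c *m k.
Proof.
move=> bc; have p0 := unif_neq0 pi_unif; exists (mx2 1 ((b - c) / pi) 0 1).
  split; last by rewrite det_mx2 mulr1 mulr0 subr0; exact: units1.
  apply: intmx2; [exact: integers1| |exact: integers0|exact: integers1].
  exact/(integers_div_unif pi_unif).
by rewrite /upper_nbr mx2M; apply: mx2_congr; field.
Qed.

Lemma restr_upper_congr f g b c : equivariant f -> g \in unitmx -> ge_val 1 (b - c) ->
  restr f (g *m A b) = restr f (g *m A c).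
Proof.
move=> ef ug /upper_nbr_congr[k gk ->]; rewrite mulmxA (restr_GLO ef _ gk) //.
by rewrite unitmx_mul ug upper_nbr_unit.
Qed.

(** At [g *m B] the polynomial reduces to [X^2], whose only root is 0, and [B *m A 0 = pi] leads
    back to [g]. The other [q - 1] upper neighbours agree with the lower one. *)
Lemma Hecke_inner f n g a t d : equivariant f -> basis n.+1 g a t d ->
  (exists2 f0, equivariant f0 & restr f0 (g *m B) != 0) \/ restr f (g *m B *m B) = 0 ->
  restr (T f) (g *m B) =
    restr f g + (residue_card F)%:R * restr f (g *m B *m B).
Proof.
move=> ef h nz; have [ug ha ht hd _] := h; have p0 := unif_neq0 pi_unif.
have h' := companion_basis_lower h; have [s hs] := residue_system_exists F.
have [ugB _ _ _ _] := h'.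
rewrite (Hecke_at_level hs ef h' nz).
have [b0 b0s hb0] := rs_surj hs (@integers0 F); rewrite sub0r in hb0.
have gb0 : ge_val 1 b0 by rewrite -[b0]opprK; apply: ge_valN.
have rootE b : b \in s -> is_root_mod (pi * t) (pi ^+ 2 * d) b = (b == b0).
  move=> bs; have hb := rs_int hs bs; apply/asboolP/eqP => [hr|->]; last first.
    apply: ge_valD; last by apply: ge_valMr => //; rewrite expr2; apply: ge_valMr;
      [exact: ge_val1_unif|exact: integers_unif].
    apply: ge_valD; first by rewrite expr2; apply: ge_valMl => //; exact: rs_int hs _ b0s.
    by apply: ge_valMl; [apply: integersM => //; exact: integers_unif|].
  apply: (rs_inj hs) => //; apply: ge_valB => //.
  have : ge_val 1 (b ^+ 2).
    have -> : b ^+ 2 = (b ^+ 2 + pi * t * b + pi ^+ 2 * d) - pi * (t * b + pi * d) by ring.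
    apply: ge_valB => //; apply: ge_valMr; first exact: ge_val1_unif.
    by apply: integersD; apply: integersM => //; exact: integers_unif.
  case: (units_or hb) => // ub; rewrite expr2 => h2.
  by case: (units_nonint (unitsM ub ub) h2).
have -> : \sum_(b <- s | is_root_mod (pi * t) (pi ^+ 2 * d) b) restr f (g *m B *m A b) =
    restr f g.
  rewrite big_seq_cond (eq_bigl (fun b => (b \in s) && (b == b0))); last first.
    by move=> b; case bs: (b \in s) => //=; rewrite rootE.
  rewrite -big_seq_cond -big_filter.
  have -> : [seq b <- s | b == b0] = [:: b0].
    by rewrite (@filter_pred1_uniq _ s b0 (rs_uniq hs) b0s).
  rewrite big_seq1 (restr_upper_congr (c := 0) ef ugB); last by rewrite subr0.
  have -> : g *m B *m A 0 = pi *: g.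
    rewrite -mulmxA -[RHS]mul_mx_scalar; congr (g *m _).
    by rewrite mx2M mx2_scalar; apply: mx2_congr; ring.
  exact: restr_scale.
congr (_ + _%:R * _); rewrite -(rs_size hs).
rewrite (eq_in_count (a2 := predC (pred1 b0))); last by move=> b bs /=; rewrite rootE.
by rewrite -(count_predC (pred1 b0)) count_uniq_mem ?b0s ?rs_uniq.
Qed.

End Neighbours.

(** Newton's iteration with the slope frozen at [b]: each step gains only one power of [pi], which
    suffices for a Cauchy sequence and avoids tracking inverses. *)
Lemma hensel_quadratic (F : localField) (pi : F) (t d b : F) : is_uniformizer pi ->
  integers F t -> integers F d -> integers F b ->
  ge_val 1 (b ^+ 2 + t * b + d) -> integer_units F (2%:R * b + t) ->
  exists c, [/\ integers F c, ge_val 1 (c - b) & c ^+ 2 + t * c + d = 0].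
Proof.
move=> pi_unif ht hd hb hr hu; pose r x := x ^+ 2 + t * x + d.
pose s := (2%:R * b + t)^-1.
have hs : integers F s by apply/units_integers/unitsV.
pose u n := iter n (fun x => x - s * r x) b.
have uP n : [/\ integers F (u n), ge_val 1 (u n - b) & ge_val n.+1%:Z (r (u n))].
  elim: n => [|n [h1 h2 h3]]; first by split=> //; rewrite subrr; exact: ge_val0.
  have hr1 : ge_val 1 (r (u n)) by apply: (ge_val_decr _ h3); lia.
  have sr1 : ge_val 1 (s * r (u n)) by exact: ge_valMl.
  split.
  - by apply: integersB => //; exact: ge_val1_integers.
  - have -> : u n.+1 - b = (u n - b) - s * r (u n) by rewrite /u /=; ring.
    exact: ge_valB.
  have -> : r (u n.+1) = r (u n) * ((1 - s * (2%:R * u n + t)) + s * (s * r (u n))).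
    by rewrite /u /= -/(u n) /r; ring.
  have -> : n.+2%:Z = n.+1%:Z + 1 by lia.
  apply: ge_valM => //; apply: ge_valD; last exact: ge_valMl.
  have -> : 1 - s * (2%:R * u n + t) = - (s * 2%:R) * (u n - b).
    have e : s * (2%:R * b + t) = 1 by rewrite mulVf // units_neq0.
    by rewrite -[X in X - _]e; ring.
  by apply: ge_valMl => //; apply/integersN/integersM => //; exact: integers_nat.
have uD n k : ge_val n.+1%:Z (u (n + k)%N - u n).
  elim: k => [|k IH]; first by rewrite addn0 subrr; exact: ge_val0.
  have -> : u (n + k.+1)%N - u n = (u (n + k)%N - u n) - s * r (u (n + k)%N).
    by rewrite addnS /u /=; ring.
  apply: ge_valB => //; apply: ge_valMl => //; have [_ _ h] := uP (n + k)%N.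
  by apply: (ge_val_decr _ h); lia.
have [|c hc] := @lf_complete F u.
  move=> N; exists `|N|%N => i j hi hj.
  have h i' : (`|N| <= i')%N -> ge_val N (u i' - u `|N|%N).
    by move=> /subnKC <-; apply: (ge_val_decr _ (uD _ _)); lia.
  have -> : u i - u j = (u i - u `|N|%N) - (u j - u `|N|%N) by ring.
  by apply: ge_valB; exact: h.
have cb : ge_val 1 (c - b).
  have [n0 /(_ n0 (leqnn _)) h] := hc 1; have [_ h2 _] := uP n0.
  have -> : c - b = (u n0 - b) - (u n0 - c) by ring.
  exact: ge_valB.
have ic : integers F c.
  by rewrite -[c](subrK b); apply: integersD => //; exact: ge_val1_integers.
exists c; split=> //.
have all N : ge_val N (r c).
  have [n0 h] := hc N; pose n := (n0 + `|N|)%N.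
  have hn := h n (leq_addr _ _); have [h1 _ h3] := uP n.
  have -> : r c = r (u n) - (u n - c) * (u n + c + t) by rewrite /r; ring.
  apply: ge_valB; first by apply: (ge_val_decr _ h3); lia.
  by apply: ge_valMr => //; apply: integersD => //; exact: integersD.
have := all (lf_val (r c) + 1); case=> [//|]; lia.
Qed.

(** * The neighbours of a vertex at the last level *)

Section TopLevel.
Variables (R : realType) (F : localField).
Local Notation C := R[i].
Variables (psi : F -> C) (m : 'M[F]_2) (chi : G F -> C) (pi : F).
Implicit Types (f : Geps F -> C) (g h z k : 'M[F]_2) (a b c t d : F) (n : nat).
Hypothesis charF : (2%:R : F) != 0.
Hypothesis psi_char : additive_character psi.
Hypothesis trm : \tr m = 0.
Hypothesis pi_unif : is_uniformizer pi.
Local Notation equivariant := (equivariant psi m chi).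
Local Notation VrepK := (VrepK psi m chi).
Local Notation T := (Hecke pi 0).
Local Notation A := (upper_nbr pi).
Local Notation B := (lower_nbr pi).
Local Notation basis := (companion_basis m pi).
Local Notation q := (residue_card F).

(** On the lattice of [A b] the matrix [companion t d + b], of trace [2 b + t] and determinant
    [b^2 + t b + d], becomes [pi] times a companion matrix. *)
Lemma at_level_upper n g a t d b : basis n g a t d -> integers F b ->
  ge_val 1 (2%:R * b + t) -> ge_val 2 (b ^+ 2 + t * b + d) ->
  at_level m pi n.+1 (g *m A b).
Proof.
move=> [ug ha ht hd e] hb h1 h2; have p0 := unif_neq0 pi_unif.
exists (a - pi ^+ n * b), ((2%:R * b + t) / pi), ((b ^+ 2 + t * b + d) / pi ^+ 2).
split.
- by rewrite unitmx_mul ug upper_nbr_unit.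
- apply: integersB => //; apply: integersM => //; exact/integersX/integers_unif.
- exact/(integers_div_unif pi_unif).
- exact/(integers_div_unifX pi_unif).
- rewrite mulmxA e -mulmxA -[RHS]mulmxA; congr (g *m _).
  rewrite !mx2_scalar /companion /upper_nbr !mx2Z !mx2D !mx2M exprS.
  by apply: mx2_congr; field.
Qed.

(* The vertex [g *m A b] is then the image of [g] under a uniformizer of a
   ramified quadratic order, whose square is [pi] up to a unit. *)
Lemma restr_ramified n g a t d b f0 : basis n g a t d -> integers F b ->
  ge_val 1 (2%:R * b + t) -> ge_val 1 (b ^+ 2 + t * b + d) ->
  ~ ge_val 2 (b ^+ 2 + t * b + d) -> equivariant f0 -> restr f0 g != 0 ->
  exists2 x : C, x ^+ 2 = 1 & forall f, equivariant f ->
    restr f (g *m A b) = x * restr f g.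
Proof.
move=> h hb h1 h2 h3 ef0 n0; have [ug ha ht hd e] := h; have p0 := unif_neq0 pi_unif.
have [i0 i1] := (@integers0 F, @integers1 F).
set r := b ^+ 2 + t * b + d in h2 h3 *.
have ur : integer_units F (r / pi).
  apply/integer_unitsP; split; first exact/(integers_div_unif pi_unif).
  move=> h4; apply: h3; have -> : r = pi * (r / pi) by field.
  by apply: (@ge_valM F 1 1) => //; exact: ge_val1_unif.
set k1 := shift_companion b t d.
have uk1 : k1 \in unitmx.
  rewrite unitmxE unitfE det_shift_companion -/r.
  by apply: contraTneq (units_neq0 ur) => ->; rewrite mul0r eqxx.
have [z [uz cz zg act]] := centralizer_act psi chi h uk1 (shift_companion_comm b t d).
exists (chi (pgl z)).
  pose k2 := mx2 ((b ^+ 2 - d) / pi) (- (d * ((2%:R * b + t) / pi)))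
    ((2%:R * b + t) / pi) (((t + b) ^+ 2 - d) / pi).
  have e2 : k1 *m k1 = pi *: k2.
    by rewrite mx2M mx2Z; apply: mx2_congr; field.
  have gk2 : GLO k2.
    have hv : integers F ((2%:R * b + t) / pi) by apply/(integers_div_unif pi_unif).
    have hr : integers F (r / pi) by apply/(integers_div_unif pi_unif).
    split.
      apply: intmx2 => //.
      - have -> : (b ^+ 2 - d) / pi = b * ((2%:R * b + t) / pi) - r / pi by rewrite /r; field.
        by apply: integersB => //; exact: integersM.
      - by apply/integersN/integersM.
      - have -> : ((t + b) ^+ 2 - d) / pi = (t + b) * ((2%:R * b + t) / pi) - r / pi.
          by rewrite /r; field.
        by apply: integersB => //; apply: integersM => //; exact: integersD.
    have -> : \det k2 = (r / pi) ^+ 2 by rewrite det_mx2 /r; field.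
    by rewrite expr2; exact: unitsM.
  have s1 : restr f0 (g *m k1) = chi (pgl z) * restr f0 g.
    by have := act f0 1%:M ef0 (unitmx1 _ _); rewrite !mulmx1.
  have s3 : restr f0 (g *m k1 *m k1) = restr f0 g.
    have ugk2 : g *m k2 \in unitmx by rewrite unitmx_mul ug (GLO_unitmx gk2).
    by rewrite -mulmxA e2 -scalemxAr (restr_scale f0 p0 ugk2) (restr_GLO ef0 ug gk2).
  apply: (mulIf n0); rewrite mul1r expr2 -mulrA.
  apply: (etrans (congr1 ( *%R (chi (pgl z))) (esym s1))).
  exact: (etrans (esym (act f0 k1 ef0 uk1)) s3).
move=> f ef.
pose k2 := mx2 0 (- (r / pi)) 1 (t + b).
have gk2 : GLO k2.
  split; last by rewrite det_mx2 mul0r mulr1 sub0r opprK.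
  by apply: intmx2 => //; [exact/integersN/units_integers|exact: integersD].
have ek : k1 = A b *m k2 by rewrite mx2M; apply: mx2_congr; rewrite /r; field.
have ugA : g *m A b \in unitmx by rewrite unitmx_mul ug upper_nbr_unit.
rewrite -(restr_GLO ef ugA gk2) -mulmxA -ek.
by have := act f 1%:M ef (unitmx1 _ _); rewrite !mulmx1.
Qed.

Lemma companion_diag b c : companion (- (b + c)) (b * c) *m mx2 c b 1 1 =
  mx2 c b 1 1 *m mx2 (- b) 0 0 (- c).
Proof. by rewrite !mx2M; apply: mx2_congr; ring. Qed.

(** In the eigenbasis [k], [diag(pi, 1)] and [diag(1, pi)] move the vertex to the neighbours [A b]
    and [A c]. Their product is scalar, so the values of [chi] are inverse to each other. *)
Lemma restr_split n g a t d b c f0 : basis n g a t d -> integers F b -> integers F c ->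
  integer_units F (c - b) -> t = - (b + c) -> d = b * c ->
  equivariant f0 -> restr f0 g != 0 ->
  (forall (h : 'M[F]_2) (x : F), h \in unitmx -> x != 0 ->
    m = h *m diag2 x (- x) *m invmx h ->
    is_conductor (fun y => chi (pgl (h *m diag2 y 1 *m invmx h))) 0 ->
    forall z : G F, stabilizer m z -> `|chi z| = 1) ->
  exists2 x : C, `|x| = 1 & forall f, equivariant f ->
    restr f (g *m A b) = x * restr f g /\ restr f (g *m A c) = x^-1 * restr f g.
Proof.
move=> h hb hc ubc et ed ef0 n0 hypb; have [ug ha ht hd e] := h.
have p0 := unif_neq0 pi_unif; have [i0 i1] := (@integers0 F, @integers1 F).
pose k := mx2 c b 1 1.
have gk : GLO k.
  by split; [exact: intmx2|rewrite det_mx2 !mulr1].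
have uk := GLO_unitmx gk; have gkV := GLOV gk.
pose conj (x y : F) := k *m mx2 x 0 0 y *m invmx k.
have udiag (x y : F) : x != 0 -> y != 0 -> mx2 x 0 0 y \in unitmx.
  by move=> x0 y0; rewrite unitmxE det_mx2 mulr0 subr0 unitfE mulf_neq0.
have uconj (x y : F) : x != 0 -> y != 0 -> conj x y \in unitmx.
  by move=> x0 y0; rewrite !unitmx_mul uk unitmx_inv uk udiag.
have eC : companion t d = conj (- b) (- c).
  by rewrite /conj -companion_diag -et -ed mulmxK.
have conjM (x y x' y' : F) : conj x y *m conj x' y' = conj (x * x') (y * y').
  rewrite /conj !mulmxA mulmxKV // -[k *m _ *m _]mulmxA mx2M.
  by congr (_ *m _ *m _); apply: mx2_congr; ring.
have comm (x y : F) : conj x y *m companion t d = companion t d *m conj x y.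
  by rewrite eC !conjM; congr conj; ring.
have act (x y : F) : x != 0 -> y != 0 -> exists z, [/\ z \in unitmx, z *m m = m *m z,
    z *m g = g *m conj x y & forall f k', equivariant f -> k' \in unitmx ->
      restr f (g *m conj x y *m k') = chi (pgl z) * restr f (g *m k')].
  by move=> x0 y0; exact: (centralizer_act psi chi h (uconj _ _ x0 y0) (comm x y)).
have ugk : g *m k \in unitmx by rewrite unitmx_mul ug.
have zE z (x y : F) : z *m g = g *m conj x y ->
    z = (g *m k) *m diag2 x y *m invmx (g *m k).
  move=> zg; rewrite -[z](mulmxK ug) zg /conj mx2_diag invmx_mul //.
  by rewrite !mulmxA.
(* An eigenvalue of [m]; the other one is [- x0] by the trace, and [2 x0 = pi ^ n (c - b)] shows
   that they are nonzero. *)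
pose x0 := a - pi ^+ n * b.
have ex : a - pi ^+ n * c = - x0.
  have := companion_trace trm h; rewrite et => tr.
  apply/eqP; rewrite -subr_eq0 /x0; apply/eqP.
  have -> : a - pi ^+ n * c - - (a - pi ^+ n * b) = pi ^+ n * - (b + c) + 2%:R * a by ring.
  by rewrite tr addNr.
have x0n : x0 != 0.
  have e2 : 2%:R * x0 = pi ^+ n * (c - b).
    by rewrite mulr2n mulrDl mul1r -{2}[x0]opprK -ex /x0; ring.
  apply: contraTneq (units_neq0 ubc) => xz; move: e2; rewrite xz mulr0 => /esym/eqP.
  by rewrite mulf_eq0 (negPf (unifX_neq0 pi_unif n)) /= => ->.
have conj_scalar (x : F) : x%:M = conj x x.
  by rewrite /conj -mx2_scalar mul_mx_scalar -scalemxAl mulmxV // scalemx1.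
have em : m = (g *m k) *m diag2 x0 (- x0) *m invmx (g *m k).
  apply: zE; rewrite e; congr (g *m _).
  rewrite eC conj_scalar /conj scalemxAl scalemxAr -mulmxDl -mulmxDr mx2Z mx2D.
  by congr (_ *m _ *m _); apply: mx2_congr; rewrite -?ex /x0; ring.
have act1 z (x y : F) f : (forall f k', equivariant f -> k' \in unitmx ->
      restr f (g *m conj x y *m k') = chi (pgl z) * restr f (g *m k')) ->
    equivariant f -> restr f (g *m conj x y) = chi (pgl z) * restr f g.
  by move=> av ef; have := av f 1%:M ef (unitmx1 _ _); rewrite !mulmx1.
(* For a unit [y], [diag(y, 1)] fixes the vertex [g], where [f0] is nonzero; so [chi] is unramified
   and the assumption on its absolute value applies. *)
have cond : is_conductor (fun y => chi (pgl (g *m k *m diag2 y 1 *m invmx (g *m k)))) 0.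
  split=> // y /= uy; have [z [uz cz zg av]] := act _ _ (units_neq0 uy) (oner_neq0 F).
  rewrite -(zE _ _ _ zg); have h1 := act1 _ _ _ _ av ef0.
  have gy : GLO (mx2 y 0 0 1).
    by split; [apply: intmx2 => //; exact: units_integers|rewrite det_mx2 mulr1 mulr0 subr0].
  have gc : GLO (conj y 1) by apply: GLOM => //; exact: GLOM.
  apply: (mulIf n0); rewrite mul1r.
  exact: (etrans (esym h1) (restr_GLO ef0 ug gc)).
have [z1 [uz1 cz1 zg1 av1]] := act _ _ p0 (oner_neq0 F).
have [z2 [uz2 cz2 zg2 av2]] := act _ _ (oner_neq0 F) p0.
have c12 : chi (pgl z1) * chi (pgl z2) = 1.
  apply: (mulIf n0); rewrite mul1r -mulrA.
  apply: (etrans (congr1 _ (esym (act1 _ _ _ _ av2 ef0)))).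
  apply: (etrans (esym (av1 f0 _ ef0 (uconj _ _ (oner_neq0 F) p0)))).
  rewrite -mulmxA conjM mul1r mulr1 -conj_scalar mul_mx_scalar.
  exact: restr_scale.
have n1 : `|chi (pgl z1)| = 1.
  by apply: (hypb _ _ ugk x0n em cond); apply/stabilizer_pgl.
have e2 : (chi (pgl z1))^-1 = chi (pgl z2).
  have c0 : chi (pgl z1) != 0 by rewrite -normr_eq0 n1 oner_eq0.
  by apply: (mulfI c0); rewrite c12 mulfV.
have nbr_eq f (M k' N : 'M[F]_2) : equivariant f -> M \in unitmx -> GLO k' ->
    M *m k' = N -> restr f (g *m M) = restr f (g *m N).
  move=> ef uM gk' <-; have ugM : g *m M \in unitmx by rewrite unitmx_mul ug.
  by rewrite mulmxA (restr_GLO ef ugM gk').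
have upi := integers_unif pi_unif.
exists (chi (pgl z1)) => // f ef; rewrite e2; split.
  have g1 : GLO (mx2 (c - b) 0 pi 1).
    split; last by rewrite det_mx2 mulr1 mul0r subr0.
    by apply: intmx2 => //; exact: integersB.
  have e3 : A b *m mx2 (c - b) 0 pi 1 = conj pi 1 *m k.
    by rewrite /conj mulmxKV // !mx2M; apply: mx2_congr; ring.
  apply: (etrans (nbr_eq _ _ _ _ ef (upper_nbr_unit pi_unif b) g1 e3)).
  rewrite mulmxA; apply: (etrans (av1 f k ef uk)).
  exact: (congr1 ( *%R _) (restr_GLO ef ug gk)).
have g1 : GLO (mx2 0 (b - c) 1 pi).
  split; first by apply: intmx2 => //; exact: integersB.
  by rewrite det_mx2 mulr1 mul0r sub0r opprB.
have e3 : A c *m mx2 0 (b - c) 1 pi = conj 1 pi *m k.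
  by rewrite /conj mulmxKV // !mx2M; apply: mx2_congr; ring.
apply: (etrans (nbr_eq _ _ _ _ ef (upper_nbr_unit pi_unif c) g1 e3)).
rewrite mulmxA; apply: (etrans (av2 f k ef uk)).
exact: (congr1 ( *%R _) (restr_GLO ef ug gk)).
Qed.

End TopLevel.

Section TopFormula.
Variables (R : realType) (F : localField).
Local Notation C := R[i].
Variables (psi : F -> C) (m : 'M[F]_2) (chi : G F -> C) (pi : F).
Implicit Types (f : Geps F -> C) (g h z k : 'M[F]_2) (a b c t d : F) (n : nat).
Hypothesis charF : (2%:R : F) != 0.
Hypothesis psi_char : additive_character psi.
Hypothesis trm : \tr m = 0.
Hypothesis pi_unif : is_uniformizer pi.
Local Notation equivariant := (equivariant psi m chi).
Local Notation VrepK := (VrepK psi m chi).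
Local Notation T := (Hecke pi 0).
Local Notation A := (upper_nbr pi).
Local Notation B := (lower_nbr pi).
Local Notation basis := (companion_basis m pi).
Local Notation q := (residue_card F).

Lemma is_root_modD t d b c : integers F t -> integers F b -> integers F c ->
  ge_val 1 (b - c) -> is_root_mod t d b -> is_root_mod t d c.
Proof.
move=> ht hb hc bc /asboolP h; apply/asboolP.
have -> : c ^+ 2 + t * c + d = (b ^+ 2 + t * b + d) - (b - c) * (b + c + t) by ring.
apply: ge_valB => //; apply: ge_valMr => //.
by apply: integersD => //; exact: integersD.
Qed.

(** Vieta's formula modulo [pi]. It also rules out three incongruent roots. *)
Lemma root_mod_sum t d b c : integers F t -> integers F b -> integers F c ->
  ~ ge_val 1 (b - c) -> is_root_mod t d b -> is_root_mod t d c ->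
  ge_val 1 (b + c + t).
Proof.
move=> ht hb hc bc /asboolP h1 /asboolP h2.
have h : ge_val 1 ((b - c) * (b + c + t)).
  have -> : (b - c) * (b + c + t) = (b ^+ 2 + t * b + d) - (c ^+ 2 + t * c + d) by ring.
  exact: ge_valB.
have i1 := integersB hb hc; have i2 := integersD (integersD hb hc) ht.
case: (units_or i2) => // u2; exfalso; case: (units_or i1) => // u1.
exact: (units_nonint (unitsM u1 u2) h).
Qed.

(** [be] counts the non-roots together with the lower neighbour, [al] collects the roots. For two
    roots the bound reads [2 sqrt q <= q + 1], that is [(sqrt q - 1)^2 >= 0]. *)
Lemma Hecke_top n g a t d f0 : basis n g a t d -> equivariant f0 -> restr f0 g != 0 ->
  (forall f g', VrepK f -> at_level m pi n.+1 g' -> restr f g' = 0) ->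
  (forall (h : 'M[F]_2) (x : F), h \in unitmx -> x != 0 ->
    m = h *m diag2 x (- x) *m invmx h ->
    is_conductor (fun y => chi (pgl (h *m diag2 y 1 *m invmx h))) 0 ->
    forall z : G F, stabilizer m z -> `|chi z| = 1) ->
  exists al be : R, [/\ 0 < be, `|al| * Num.sqrt q%:R <= 2 * q%:R - be &
    forall f, VrepK f ->
      restr (T f) g = al%:C%C * restr f g + be%:C%C * restr f (g *m B)].
Proof.
move=> h ef0 n0 top hypb; have [ug ha ht hd e] := h.
have [s hs] := residue_system_exists F.
have q1 := residue_card_gt1 F.
pose S : R := Num.sqrt q%:R; pose Q : R := q%:R.
have hS : S ^+ 2 = Q by rewrite sqr_sqrtr // ler0n.
have S0 : 0 <= S by exact: sqrtr_ge0.
have Q2 : 2 <= Q by rewrite /Q (ler_nat _ 2).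
have SQ : S <= Q by nra.
have S2 : 2 * S <= Q + 1 by have := sqr_ge0 (S - 1); rewrite sqrrB hS expr1n; lra.
pose P := is_root_mod t d; pose rts := [seq b <- s | P b].
have rP b : b \in rts -> [/\ b \in s, integers F b & P b].
  by rewrite mem_filter => /andP[Pb bs]; split=> //; exact: rs_int hs _ bs.
have rInj b c : b \in rts -> c \in rts -> ge_val 1 (b - c) -> b = c.
  by move=> /rP[bs _ _] /rP[cs _ _]; exact: (rs_inj hs bs cs).
have cnt : (size rts + count (predC P) s = q)%N.
  by rewrite size_filter count_predC (rs_size hs).
have TE f : VrepK f -> restr (T f) g =
    \sum_(b <- rts) restr f (g *m A b) + (count (predC P) s).+1%:R * restr f (g *m B).
  move=> /VrepKP[ef _]; rewrite big_filter.
  by apply: (Hecke_at_level charF psi_char trm pi_unif hs ef h); left; exists f0.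
have urts : uniq rts by rewrite filter_uniq ?(rs_uniq hs).
have repr c : integers F c -> P c -> exists2 b, b \in rts & ge_val 1 (c - b).
  move=> hc Pc; have [b bs cb] := rs_surj hs hc; exists b => //.
  by rewrite mem_filter bs andbT; exact: (is_root_modD ht hc (rs_int hs bs) cb).
have natC (j : nat) : j%:R = (j%:R)%:C%C :> C by rewrite rmorph_nat.
clearbody rts; case: rts => [|b [|c [|c' l]]] in rP rInj cnt TE urts repr *.
- exists 0, (Q + 1); split; [lra| by rewrite normr0 mul0r -/S -/Q; lra |].
  have cnt' : (count (predC P) s).+1 = q.+1 by rewrite -cnt.
  move=> f Vf; rewrite (TE f Vf) big_nil cnt' natC.
  by rewrite mul0r /Q natr1.
- have [bs hb Pb] := rP b (mem_head _ _).
  have cnt' : (count (predC P) s).+1 = q by [].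
  (* A single root is double: [- t - b] is a root as well, hence congruent to [b]. *)
  have h1 : ge_val 1 (2%:R * b + t).
    case: (units_or (integersD (integersM (integers_nat F 2) hb) ht)) => // u.
    have hc : integers F (- t - b) by apply: integersB => //; exact: integersN.
    have Pc : P (- t - b).
      apply/asboolP; move/asboolP: Pb.
      by have -> : (- t - b) ^+ 2 + t * (- t - b) + d = b ^+ 2 + t * b + d by ring.
    have [c] := repr _ hc Pc; rewrite inE => /eqP -> hcb; exfalso.
    apply: (units_nonint u); rewrite -[_ + t]opprK; apply: ge_valN.
    by have -> : - (2%:R * b + t) = - t - b - b by ring.
  (* Either the neighbour is one level higher, where functions vanish by [top], or the quadratic
     order is ramified and the neighbour contributes a sign. *)
  have [h2|h2] := pselect (ge_val 2 (b ^+ 2 + t * b + d)).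
    exists 0, Q; split; [lra| by rewrite normr0 mul0r -/S -/Q; lra |].
    move=> f Vf; rewrite (TE f Vf) big_seq1 cnt' natC; congr (_ + _); rewrite mul0r.
    by apply: top Vf _; exact: (at_level_upper pi_unif h hb h1 h2).
  have [x x1 xE] := restr_ramified pi_unif h hb h1 (asboolW Pb) h2 ef0 n0.
  have [al [al1 alx]] : exists al : R, `|al| = 1 /\ x = al%:C%C.
    have : (x == 1) || (x == -1) by rewrite -sqrf_eq1 x1.
    case/orP => /eqP ->; [exists 1|exists (-1)]; rewrite ?normrN normr1; split=> //.
    by rewrite rmorphN1.
  exists al, Q; split; [lra| by rewrite al1 mul1r -/S -/Q; lra |].
  move=> f Vf; rewrite (TE f Vf) big_seq1 cnt' natC; congr (_ + _).
  by rewrite -alx; apply: xE; have /VrepKP[] := Vf.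
- have [bs hb Pb] := rP b (mem_head _ _).
  have [cs hc Pc] : [/\ c \in s, integers F c & P c] by apply: rP; rewrite !inE eqxx orbT.
  have nbc : b != c by move: urts; rewrite /= inE andbT.
  have bc : ~ ge_val 1 (b - c).
    by move=> /rInj e'; move: nbc; rewrite e' ?inE ?eqxx ?orbT.
  have sum := root_mod_sum ht hb hc bc Pb Pc.
  have ubc : integer_units F (b - c).
    by apply/integer_unitsP; split=> //; exact: integersB.
  have u2 : integer_units F (2%:R * b + t).
    have -> : 2%:R * b + t = (b - c) + (b + c + t) by ring.
    exact: unitsD.
  (* Roots modulo [pi] do not diagonalise [m]. The lifted root [b'] and its partner [- t - b'] do,
     which gives access to the hypothesis on split elements. *)
  have [b' [hb' bb' rb']] := hensel_quadratic pi_unif ht hd hb (asboolW Pb) u2.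
  pose c1 := - t - b'.
  have hc1 : integers F c1 by apply: integersB => //; exact: integersN.
  have cc1 : ge_val 1 (c - c1).
    have -> : c - c1 = (b + c + t) + (b' - b) by rewrite /c1; ring.
    exact: ge_valD.
  have ucb : integer_units F (c1 - b').
    have -> : c1 - b' = - (b - c) + (- (c - c1) - (b' - b)) by ring.
    by apply: unitsD; [exact: unitsN|apply: ge_valB => //; exact: ge_valN].
  have et : t = - (b' + c1) by rewrite /c1; ring.
  have ed : d = b' * c1.
    apply/eqP; rewrite -subr_eq0; apply/eqP.
    by rewrite -[RHS]rb' /c1; ring.
  have [x x1 xE] := restr_split trm pi_unif h hb' hc1 ucb et ed ef0 n0 hypb.
  pose al : R := 2 * complex.Re x.
  (* As [|x| = 1], the inverse of [x] is its conjugate, which makes [al] real. *)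
  have alE : al%:C%C = x + x^-1.
    by rewrite invc_norm x1 expr1n invr1 mul1r addcJ rmorphM rmorph_nat.
  have al2 : `|al| <= 2.
    rewrite normrM ger0_norm // ler_piMr //.
    by have := normc_ge_Re x; rewrite x1 -[1]/(1%:C%C) lecR.
  have cnt' : (count (predC P) s).+1 = q.-1 by rewrite -cnt.
  exists al, (Q - 1); split; first by lra.
    apply: (le_trans (ler_wpM2r S0 al2)); rewrite -/Q; lra.
  move=> f Vf; have /VrepKP[ef _] := Vf; have [xb xc] := xE f ef.
  rewrite (TE f Vf) big_cons big_seq1 cnt' natC.
  have -> : q.-1%:R = Q - 1 by rewrite /Q -subn1 natrB // ltnW.
  have bb : ge_val 1 (b - b') by rewrite -[b - b']opprB; exact: ge_valN.
  have eb := etrans (restr_upper_congr pi_unif ef ug bb) xb.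
  have ec := etrans (restr_upper_congr pi_unif ef ug cc1) xc.
  rewrite alE mulrDl; exact: (congr2 +%R (congr2 +%R eb ec) erefl).
- exfalso.
  have [bs hb Pb] := rP b (mem_head _ _).
  have [cs hc Pc] : [/\ c \in s, integers F c & P c] by apply: rP; rewrite !inE eqxx orbT.
  have [cs' hc' Pc'] : [/\ c' \in s, integers F c' & P c'].
    by apply: rP; rewrite !inE eqxx !orbT.
  move: urts; rewrite /= !inE !negb_or -!andbA => /and5P[bc bc' _ cc' _].
  have no x y : x \in [:: b, c, c' & l] -> y \in [:: b, c, c' & l] -> x != y ->
      ~ ge_val 1 (x - y).
    by move=> hx hy /eqP xy /(rInj _ _ hx hy).
  have mb : b \in [:: b, c, c' & l] by rewrite inE eqxx.
  have mc : c \in [:: b, c, c' & l] by rewrite !inE eqxx orbT.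
  have mc' : c' \in [:: b, c, c' & l] by rewrite !inE eqxx !orbT.
  apply: (no _ _ mc mc' cc').
  have -> : c - c' = (b + c + t) - (b + c' + t) by ring.
  apply: ge_valB.
    exact: (root_mod_sum ht hb hc (no _ _ mb mc bc) Pb Pc).
  exact: (root_mod_sum ht hb hc' (no _ _ mb mc' bc') Pb Pc').
Qed.
End TopFormula.

(** * The Hecke operator is a Jacobi operator *)

Section Structure.
Variables (R : realType) (F : localField).
Local Notation C := R[i].
Variables (psi : F -> C) (m : 'M[F]_2) (chi : G F -> C) (pi : F).
Implicit Types (f w : Geps F -> C) (g h z : 'M[F]_2) (a b c t d : F) (n : nat).
Hypothesis charF : (2%:R : F) != 0.
Hypothesis psi_char : additive_character psi.
Hypothesis pi_unif : is_uniformizer pi.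
Hypothesis m_neq0 : m != 0.
Hypothesis trm : \tr m = 0.
Hypothesis chi_char : stabilizer_character m chi.
Hypothesis fin_dim : finite_dim (VrepK psi m chi).
Hypothesis hypb : forall (h : 'M[F]_2) (x : F), h \in unitmx -> x != 0 ->
    m = h *m diag2 x (- x) *m invmx h ->
    is_conductor (fun y => chi (pgl (h *m diag2 y 1 *m invmx h))) 0 ->
    forall z : G F, stabilizer m z -> `|chi z| = 1.
Local Notation equivariant := (equivariant psi m chi).
Local Notation VrepK := (VrepK psi m chi).
Local Notation T := (Hecke pi 0).
Local Notation B := (lower_nbr pi).
Local Notation basis := (companion_basis m pi).
Local Notation at_level := (at_level m pi).
Local Notation q := (residue_card F).

(** Unlike [at_level], which asks for a particular basis, this depends only on the vertex, and so is
    visibly invariant under [GLO] and under the centralizer of [m]. *)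
Definition exact_level n g : Prop :=
  scalar_mod pi n (conjm m g) /\ ~ scalar_mod pi n.+1 (conjm m g).

Definition level_set n : set (Geps F) :=
  [set x | exists g Y, [/\ g \in unitmx, x = pgl (dmx g Y) & exact_level n g]].

Lemma at_level_exact n g : at_level n g -> exact_level n g.
Proof.
move=> h; split; first exact: at_level_scalar_mod.
exact: (at_level_not_scalar_mod pi_unif).
Qed.

Lemma at_level_exact_uniq n n' g : at_level n g -> exact_level n' g -> n = n'.
Proof. by move=> h [h1 h2]; exact: (at_level_uniq pi_unif h h1 h2). Qed.

Lemma conjm_scale (u : F) g : u != 0 -> g \in unitmx -> conjm m (u *: g) = conjm m g.
Proof.
move=> u0 ug; rewrite /conjm invmxZ ?unitmxZ ?unitfE //.
by rewrite -!scalemxAl -scalemxAr scalerA mulVf // scale1r.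
Qed.

Lemma level_setP n g Y : g \in unitmx ->
  level_set n (pgl (dmx g Y)) <-> exact_level n g.
Proof.
move=> ug; split=> [[g' [Y' [ug' e h]]]|h]; last by exists g, Y.
move: e => /eq_pgl[||u uu]; rewrite ?dmx_unit //.
rewrite (dual_decomp u) dmx_scale => /dmx_inj[-> _].
by rewrite /exact_level conjm_scale // -dual_unitP.
Qed.

Lemma level_set_invariant n : invariant_set m (level_set n).
Proof.
split.
- move=> m' x; have [g ug ->] := G_surj x.
  rewrite one_plus_epsE (incl_pgl ug) (pgl_dmxM _ _ (unitmx1 _ _) ug) mul1mx.
  exact: (iff_trans (level_setP _ _ ug) (iff_sym (level_setP _ _ ug))).
- move=> z x; have [g ug ->] := G_surj x; have [h uh ->] := G_surj z.
  move=> /(stabilizer_pgl m uh) ch.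
  rewrite (incl_pgl ug) (incl_pgl uh) (pgl_dmxM _ _ uh ug).
  have uhg : h *m g \in unitmx by rewrite unitmx_mul uh.
  apply: (iff_trans (level_setP _ _ uhg)); apply: (iff_trans _ (iff_sym (level_setP _ _ ug))).
  suff e : conjm m (h *m g) = conjm m g by rewrite /exact_level e.
  rewrite /conjm (invmx_mul uh ug) -!mulmxA; congr (_ *m _).
  by rewrite (mulmxA m) -ch !mulmxA mulVmx // mul1mx.
- move=> x k' /KepsP[k [Y' [gk hY' ->]]]; have [g [Y [ug ->]]] := Geps_surj x.
  have uk := GLO_unitmx gk; rewrite (pgl_dmxM _ _ ug uk).
  have ugk : g *m k \in unitmx by rewrite unitmx_mul ug.
  apply: (iff_trans (level_setP _ _ ugk)); apply: (iff_trans _ (iff_sym (level_setP _ _ ug))).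
  have e j : scalar_mod pi j (conjm m (g *m k)) <-> scalar_mod pi j (conjm m g).
    rewrite (conjmM _ ug uk); split=> [/(scalar_mod_conj (GLOV gk))|]; last exact: scalar_mod_conj.
    by rewrite invmxK !mulmxA mulmxV // mul1mx mulmxK.
  by rewrite /exact_level !e.
Qed.

Lemma cutoff_restr n f g : g \in unitmx -> exact_level n g ->
  restr (cutoff (level_set n) f) g = restr f g.
Proof.
move=> ug h; rewrite /restr /cutoff; case: asboolP => // -[].
exact/(level_setP _ _ ug).
Qed.

Lemma cutoff_restr0 n f g : g \in unitmx -> ~ exact_level n g ->
  restr (cutoff (level_set n) f) g = 0.
Proof.
by move=> ug h; rewrite /restr /cutoff; case: asboolP => // /(level_setP _ _ ug).
Qed.

Definition occurs n : Prop :=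
  exists f g, [/\ VrepK f, at_level n g & restr f g != 0].

(** Cut [f] off to level [n + 1] and apply [T_0]: one level lower, at [g *m B], the result is the
    value at [g] plus [q] times a value at [g *m B *m B], which is zero after the cutoff. *)
Lemma occurs_pred n : occurs n.+1 -> occurs n.
Proof.
move=> [f [g [Vf hg n0]]]; pose f' := cutoff (level_set n.+1) f.
have Vf' : VrepK f' := VrepK_cutoff (level_set_invariant _) Vf.
have /VrepKP[ef' _] := Vf'.
have [a [t [d h]]] := hg; have h' := companion_basis_lower pi_unif h.
have ug := at_level_unit hg.
have z0 : restr f' (g *m B *m B) = 0.
  apply/eqP/negPn/negP => nz; have uB := lower_nbr_unit pi_unif.
  have ugB : g *m B *m B \in unitmx by rewrite !unitmx_mul ug uB.
  have hx : exact_level n.+1 (g *m B *m B).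
    by apply: contrapT => hn; rewrite (cutoff_restr0 _ ugB hn) eqxx in nz.
  have hM := restr_neq0_intmx charF psi_char trm ef' ugB nz.
  move: h' hx hM; case: (n) => [|j] h' hx hM.
    exact: (companion_basis0_lower pi_unif h' hM).
  have hl : at_level j (g *m B *m B).
    by do 3 eexists; exact: (companion_basis_lower pi_unif h').
  by have := at_level_exact_uniq hl hx; lia.
exists (T f'), (g *m B); split.
- exact: Hecke_VrepK.
- by do 3 eexists; exact: h'.
- rewrite (Hecke_inner charF psi_char trm pi_unif ef' h); last by right.
  rewrite z0 mulr0 addr0 /f' cutoff_restr //; exact: at_level_exact.
Qed.

Lemma occurs_le n n' : (n <= n')%N -> occurs n' -> occurs n.
Proof.
move=> /subnKC <-; elim: (n' - n)%N => [|j IH]; first by rewrite addn0.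
by rewrite addnS => /occurs_pred.
Qed.

Lemma restr_at_level_neq0 n f g g' : equivariant f -> at_level n g -> at_level n g' ->
  restr f g != 0 -> restr f g' != 0.
Proof.
move=> ef hg hg' n0; have ug := at_level_unit hg.
have [z [k [uz cz gk ->]]] := at_level_conj charF trm pi_unif hg hg'.
have uzg : z *m g \in unitmx by rewrite unitmx_mul uz.
rewrite (restr_GLO ef uzg gk) (restr_stabilizer ef uz cz ug) mulf_neq0 //.
by have [h _ _] := chi_char; apply/h/stabilizer_pgl.
Qed.

Lemma restr_sum (I : Type) (s : seq I) (c : I -> C) (f : I -> Geps F -> C) g :
  restr (\sum_(i <- s) c i *: f i) g = \sum_(i <- s) c i * restr (f i) g.
Proof. by rewrite /restr fct_sumE. Qed.

Lemma level_basis n : occurs n -> forall g, at_level n g -> exists e,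
  [/\ VrepK e, restr e g = 1 &
      forall n' g', at_level n' g' -> n' != n -> restr e g' = 0].
Proof.
move=> [f [g' [Vf hg' n0]]] g hg; have /VrepKP[ef _] := Vf.
have n1 := restr_at_level_neq0 ef hg' hg n0; have ug := at_level_unit hg.
have Vc : VrepK (cutoff (level_set n) f).
  exact: (VrepK_cutoff (level_set_invariant _) Vf).
exists ((restr f g)^-1 *: cutoff (level_set n) f); split.
- have := @VrepK_sum _ _ psi m chi unit [:: tt] (fun=> (restr f g)^-1) (fun=> cutoff (level_set n) f).
  by rewrite big_seq1; apply.
- rewrite -[LHS]/((restr f g)^-1 * restr (cutoff (level_set n) f) g).
  by rewrite cutoff_restr // ?mulVf //; exact: at_level_exact.
- move=> n' g2 h2 nn.
  rewrite -[LHS]/((restr f g)^-1 * restr (cutoff (level_set n) f) g2).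
  rewrite cutoff_restr0 ?mulr0 //; first exact: at_level_unit h2.
  by move=> /(at_level_exact_uniq h2) e; rewrite e eqxx in nn.
Qed.

Lemma equivariant_ext f : equivariant f ->
  (forall n g, at_level n g -> restr f g = 0) -> f = 0.
Proof.
move=> ef h; apply: funext => x; have [g [Y [ug ->]]] := Geps_surj x.
apply: (etrans (equivariant_dmx charF trm Y ef ug)).
suff -> : restr f g = 0 by rewrite mulr0.
apply/eqP/negPn/negP => nz; have hM := restr_neq0_intmx charF psi_char trm ef ug nz.
have [n [k [gk hl]]] := at_level_exists charF trm pi_unif m_neq0 ug hM.
by move: nz; rewrite -(restr_GLO ef ug gk) (h _ _ hl) eqxx.
Qed.

(** Functions supported on distinct levels are independent, so a space of dimension [n0] cannot
    carry the [n0 + 1] levels from 0 to [n0]. *)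
Lemma occurs_initial : exists n, forall k, occurs k <-> (k < n)%N.
Proof.
have [n0 [b hb]] := fin_dim.
have notn : ~ occurs n0.
  move=> occ; suff : (n0.+1 <= n0)%N by rewrite ltnn.
  have /choice[eg hg] : forall k : 'I_n0.+1, exists eg : (Geps F -> C) * 'M[F]_2,
      [/\ VrepK eg.1, at_level k eg.2, restr eg.1 eg.2 = 1 &
        forall n' g', at_level n' g' -> n' != k -> restr eg.1 g' = 0].
    move=> k; have ok := occurs_le (ltn_ord k : (k <= n0)%N) occ.
    have [_ [g [_ hg _]]] := ok; have [e [h1 h2 h3]] := level_basis ok hg.
    by exists (e, g).
  apply: (basis_size_bound (w := fun k => (eg k).1) hb) => [k|c hc i].
    by have [] := hg k.
  have := restr_sum (index_enum 'I_n0.+1) c (fun k => (eg k).1) (eg i).2.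
  rewrite hc (bigD1 i) //= big1 => [|j ji].
    by have [_ _ -> _] := hg i; rewrite mulr1 addr0.
  have [_ hi _ _] := hg i; have [_ _ _ hj] := hg j.
  rewrite (hj _ _ hi) ?mulr0 //; apply: contra_neq ji => e.
  exact/val_inj/esym.
have [occ0|nocc0] := pselect (occurs 0%N).
  have [K [occK nK]] := last_nat occ0 notn; exists K.+1 => k; rewrite ltnS.
  split=> [ok|kK]; last exact: occurs_le occK.
  by rewrite leqNgt; apply/negP => Kk; apply: nK; exact: occurs_le ok.
by exists 0%N => k; split=> // ok; case: nocc0; exact: occurs_le ok.
Qed.

Theorem VrepK_jacobi : exists n (al be : R) (l : nat -> (Geps F -> C) -> C)
    (e : nat -> Geps F -> C),
  [/\ 0 < be, `|al| * Num.sqrt q%:R <= 2 * q%:R - be &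
    jacobi VrepK T n q%:R al%:C%C be%:C%C l e].
Proof.
have [[|K] occ] := occurs_initial.
  (* No level occurs and the space is zero; [al] and [be] are placeholders satisfying the bounds. *)
  exists 0%N, 0, 1, (fun _ _ => 0), (fun _ => 0); split.
  - exact: ltr01.
  - rewrite normr0 mul0r subr_ge0.
    have : (1 : R) <= q%:R by rewrite (ler_nat _ 1) ltnW // residue_card_gt1.
    lra.
  - apply: Jacobi.
    + by move=> c; apply: VrepK_sum => -[].
    + by move=> c i; rewrite ltn0.
    + move=> w Vw; rewrite big_ord0; have /VrepKP[ew _] := Vw.
      apply: (equivariant_ext ew) => k g hg; apply/eqP/negPn/negP => nz.
      by have /occ : occurs k by exists w, g.
    + move=> w Vw; exact: (Hecke_VrepK charF psi_char trm pi_unif Vw).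
    + by move=> w i _; rewrite ltn0.
    + by move=> w i _ /eqP.
have [f0 [g [Vf0 hg n0]]] : occurs K by apply/occ.
have /VrepKP[ef0 _] := Vf0.
(* A descending chain from a vertex of the last level [K]: its term of index [K - k] has level [k]
   and serves to read off the coordinate [k]. *)
pose gs i := iter i (fun g => g *m B) g.
have hgs i : (i <= K)%N -> exists a t d, basis (K - i) (gs i) a t d.
  elim: i => [|i IH] hi; first by rewrite subn0.
  have [a [t [d h]]] := IH (ltnW hi); exists a, (pi * t), (pi ^+ 2 * d).
  apply: (companion_basis_lower pi_unif); have -> : (K - i.+1).+1 = (K - i)%N by lia.
  exact: h.
have hl k : (k <= K)%N -> at_level k (gs (K - k)%N).
  move=> hk; have [|a [t [d h]]] := hgs (K - k)%N; first exact: leq_subr.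
  by rewrite subKn // in h; exists a, t, d.
have /choice[e he] : forall k, exists e, (k <= K)%N -> [/\ VrepK e,
    restr e (gs (K - k)%N) = 1 &
    forall n' g', at_level n' g' -> n' != k -> restr e g' = 0].
  move=> k; have [kK|_] := leqP k K; last by exists 0.
  by have [|e] := level_basis (n := k) _ (hl k kK); [apply/occ|exists e].
pose l k w := restr w (gs (K - k)%N).
have lsum (c : nat -> C) n' g' : at_level n' g' ->
    restr (\sum_(k < K.+1) c k *: e k) g' =
      if (n' <= K)%N then c n' * restr (e n') g' else 0.
  move=> hg'; rewrite restr_sum; case: leqP => hn.
    rewrite (bigD1 (Ordinal (hn : (n' < K.+1)%N))) //= big1 ?addr0 // => k kn.
    have [_ _ h] := he k (ltn_ord k); rewrite (h _ _ hg') ?mulr0 //.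
    by apply: contra_neq kn => e'; exact/val_inj/esym.
  rewrite big1 // => k _; have [_ _ h] := he k (ltn_ord k).
  rewrite (h _ _ hg') ?mulr0 //; have := ltn_ord k; lia.
have lcoord (c : nat -> C) k : (k <= K)%N -> l k (\sum_(k < K.+1) c k *: e k) = c k.
  move=> kK; have [_ h _] := he k kK.
  by rewrite /l (lsum _ _ _ (hl k kK)) kK h mulr1.
have Vsum (c : nat -> C) : VrepK (\sum_(k < K.+1) c k *: e k).
  by apply: VrepK_sum => k; have [] := he k (ltn_ord k).
have span w : VrepK w -> w = \sum_(k < K.+1) l k w *: e k.
  move=> Vw; have /VrepKP[ew _] := Vw; apply/eqP; rewrite -subr_eq0; apply/eqP.
  set S := \sum_(k < K.+1) _.
  have Vs : VrepK S := Vsum (fun k => l k w).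
  have DE g' : restr (w - S) g' = restr w g' - restr S g' by [].
  have eD : equivariant (w - S).
    rewrite -scaleN1r; apply: (equivariantD ew); apply: equivariantZ.
    by have /VrepKP[] := Vs.
  apply: (equivariant_ext eD) => n' g' hg'; case: (leqP n' K) => hn; last first.
    rewrite DE [restr S g'](lsum (fun k => l k w) _ _ hg') leqNgt hn subr0; apply/eqP/negPn/negP => nz.
    have /occ : occurs n' by exists w, g'.
    by rewrite ltnS leqNgt hn.
  apply/eqP/negPn/negP => /(restr_at_level_neq0 eD hg' (hl _ hn)).
  by rewrite DE -/(l n' w) -/(l n' S) (lcoord (fun k => l k w) _ hn) subrr eqxx.
have occ_level k : (k <= K)%N -> exists2 f, equivariant f & restr f (gs (K - k)%N) != 0.
  move=> kK; have [/VrepKP[ek _] h _] := he k kK; exists (e k) => //.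
  by rewrite h oner_neq0.
have low w k : VrepK w -> (k <= K)%N -> restr w (gs (K - k)%N *m B) =
    if k is j.+1 then l j w else 0.
  move=> /VrepKP[ew _]; case: k => [|k] kK.
    have [|a [t [d h]]] := hgs K; first by [].
    rewrite subnn in h; rewrite subn0.
    exact: (restr_level0_lower charF psi_char trm pi_unif ew h).
  rewrite /l; have -> : (K - k = (K - k.+1).+1)%N by lia.
  by [].
have [a [t [d h]]] := hg.
have [|al [be [be0 albe topE]]] := Hecke_top charF psi_char trm pi_unif h ef0 n0 _ hypb.
  move=> f g' Vf hg'; apply/eqP/negPn/negP => nz.
  have /occ : occurs K.+1 by exists f, g'.
  by rewrite ltnn.
exists K.+1, al, be, l, e; split; [exact: be0|exact: albe|apply: Jacobi].
- exact: Vsum.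
- by move=> c k; rewrite ltnS; exact: lcoord.
- exact: span.
- move=> w Vw; exact: (Hecke_VrepK charF psi_char trm pi_unif Vw).
- move=> w k Vw; rewrite ltnS => kK; rewrite -(low _ _ Vw (ltnW kK)).
  have [a' [t' [d' h']]] := hgs _ (leq_subr k.+1 K).
  have e1 : (K - k = (K - k.+1).+1)%N by lia.
  have e2 : (K - (K - k.+1) = k.+1)%N by lia.
  rewrite e2 in h'; have /VrepKP[ew _] := Vw.
  rewrite /l e1 /=; apply: (Hecke_inner charF psi_char trm pi_unif ew h').
  by left; have := occ_level k (ltnW kK); rewrite e1.
- move=> w k Vw [->]; rewrite -(low _ _ Vw (leqnn K)) /l subnn.
  exact: topE.
Qed.

End Structure.

(** * Chebyshev polynomials *)

Section ChebyshevRoots.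
Variable R : realType.
Implicit Types (y t a b : R) (j k n N : nat).

Fixpoint cheb k : {poly R} :=
  match k with
  | 0 => 1
  | k'.+1 => 2%:P * 'X * cheb k' - (if k' is j.+1 then cheb j else 0)
  end.

(** The predecessor [U_(N-1)] with the convention [U_(-1) = 0], which covers dimension 1. *)
Definition cheb_pred N : {poly R} := if N is j.+1 then cheb j else 0.

Lemma chebS k : cheb k.+1 = 2%:P * 'X * cheb k - cheb_pred k.
Proof. by []. Qed.

(** The usual quotient of sines, multiplied out so that it holds for every [t]. Two consecutive
    indices are carried along because the recurrence has order two. *)
Lemma cheb_sin k t : (cheb k).[cos t] * sin t = sin (k.+1%:R * t) /\
  (cheb_pred k).[cos t] * sin t = sin (k%:R * t).
Proof.
elim: k => [|k [IH1 IH2]].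
  by rewrite /= hornerC mul1r mul1r mul0r sin0 horner0 mul0r.
split; last exact: IH1.
rewrite chebS !hornerE mulrBl IH2 -[_ * _ * sin t]mulrA IH1.
have -> : k.+2%:R * t = k.+1%:R * t + t by rewrite -[k.+2%:R]natr1 mulrDl mul1r.
have -> : k%:R * t = k.+1%:R * t - t by rewrite -[k.+1%:R]natr1 mulrDl mul1r addrK.
by rewrite sinB sinD; ring.
Qed.

(** At [t = 0] and [t = pi] the sine vanishes and [cheb_sin] gives no information, so the values at
    1 and -1 are computed by recursion. *)
Lemma cheb1 k : (cheb k).[1] = k.+1%:R /\ (cheb_pred k).[1] = k%:R.
Proof.
elim: k => [|k [IH1 IH2]]; first by rewrite /= hornerC horner0.
split; last exact: IH1.
by rewrite chebS !hornerE IH2 IH1 -!natr1; ring.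
Qed.

Lemma chebN1 k : (cheb k).[-1] = (-1) ^+ k * k.+1%:R /\
  (cheb_pred k).[-1] = - ((-1) ^+ k * k%:R).
Proof.
elim: k => [|k [IH1 IH2]]; first by rewrite /= hornerC horner0 mul1r mulr0 oppr0.
split; last by rewrite exprS mulN1r mulNr opprK; exact: IH1.
by rewrite chebS !hornerE IH2 IH1 !exprS -!natr1; ring.
Qed.

Lemma cos_sin_natpi j : cos (j%:R * pi) = (-1) ^+ j :> R /\ sin (j%:R * pi) = 0 :> R.
Proof.
elim: j => [|j [IH1 IH2]]; first by rewrite mul0r cos0 sin0.
by rewrite -natr1 mulrDl mul1r cosDpi sinDpi IH1 IH2 exprS mulN1r oppr0.
Qed.

Variables (a b : R) (N : nat).
Hypothesis b_gt0 : 0 < b.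
Hypothesis ab : `|a| <= 2 - b.

Definition perturbed_cheb : {poly R} :=
  (2%:P * 'X - a%:P) * cheb N - b *: cheb_pred N.
Local Notation P := perturbed_cheb.

Definition node j : R := cos (j%:R * pi / N.+1%:R).

(* At the zeros [node j] of [cheb N] only the second term of the perturbed
   polynomial survives, and it alternates in sign. *)
Lemma perturbed_cheb_sign j : (j <= N.+1)%N -> 0 < (-1) ^+ j * P.[node j].
Proof.
move=> jN; have N0 : N.+1%:R != 0 :> R by rewrite pnatr_eq0.
move: ab; rewrite ler_norml => /andP[a1 a2]; have b0 := b_gt0.
(* At the two extreme nodes both terms survive; there the sign comes from [|a| <= 2 - b], with
   [b > 0] making it strict. *)
have [->|j0] := eqVneq j 0%N.
  rewrite /node !mul0r cos0 /P !hornerE.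
  have [-> ->] := cheb1 N.
  have -> : (1 + 1 - a) * N.+1%:R - b * N%:R =
      N%:R * (2 - b - a) + (2 - a) by rewrite -natr1; ring.
  have h : 0 <= N%:R * (2 - b - a) by rewrite mulr_ge0 // subr_ge0.
  have h' : 0 < 2 - a by lra.
  by apply: ltr_wpDl.
have [->|jn] := eqVneq j N.+1.
  have -> : node N.+1 = -1 by rewrite /node mulrAC divff // mul1r cospi.
  rewrite /P !hornerE.
  have [-> ->] := chebN1 N.
  have s : (-1) ^+ N * (-1) ^+ N = 1 :> R by rewrite -expr2 sqrr_sign.
  have -> : (-1) ^+ N.+1 * ((2 * -1 - a) * ((-1) ^+ N * N.+1%:R) - b * - ((-1) ^+ N * N%:R)) =
      (-1) ^+ N * (-1) ^+ N * ((2 + a) * N.+1%:R - b * N%:R) :> R by rewrite exprS; ring.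
  have -> : (-1) ^+ N * (-1) ^+ N * ((2 + a) * N.+1%:R - b * N%:R) =
      N%:R * (2 - b + a) + (2 + a) by rewrite s mul1r -natr1; ring.
  by apply: ltr_wpDl; [rewrite mulr_ge0 //; lra|lra].
have jlt : (j < N.+1)%N by rewrite ltn_neqAle jn.
pose t : R := j%:R * pi / N.+1%:R.
have ts : 0 < sin t.
  apply: sin_gt0_pi; rewrite divr_gt0 ?mulr_gt0 ?pi_gt0 ?ltr0n ?lt0n //=.
  by rewrite ltr_pdivrMr ?ltr0n // mulrC ltr_pM2l ?pi_gt0 // ltr_nat.
have [h1 h2] := cheb_sin N t.
have Nt : N.+1%:R * t = j%:R * pi by rewrite /t mulrC divfK.
have c0 : (cheb N).[cos t] = 0.
  move: h1; rewrite Nt; have [_ ->] := cos_sin_natpi j.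
  by move/eqP; rewrite mulf_eq0 (gt_eqF ts) orbF => /eqP.
have c1 : (cheb_pred N).[cos t] = - (-1) ^+ j.
  apply: (mulIf (lt0r_neq0 ts)); rewrite h2.
  have -> : N%:R * t = j%:R * pi - t by rewrite -Nt -natr1 mulrDl mul1r addrK.
  by rewrite sinB; have [-> ->] := cos_sin_natpi j; rewrite mul0r sub0r mulNr.
have -> : P.[node j] = b * (-1) ^+ j.
  by rewrite /node -/t /P !hornerE c0 c1; ring.
by rewrite mulrCA -expr2 sqrr_sign mulr1.
Qed.

Lemma node_lt i j : (i < j <= N.+1)%N -> node j < node i.
Proof.
move=> /andP[ij jN]; have NR : 0 < N.+1%:R :> R by rewrite ltr0n.
have itv k : (k <= N.+1)%N -> k%:R * pi / N.+1%:R \in `[0, pi : R].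
  move=> kN; rewrite in_itv /= divr_ge0 ?mulr_ge0 ?pi_ge0 //=.
  by rewrite ler_pdivrMr // mulrC ler_pM2l ?pi_gt0 // ler_nat.
rewrite /node ltr_cos ?itv ?(leq_trans (ltnW ij)) //.
by rewrite ltr_pM2r ?invr_gt0 // ltr_pM2r ?pi_gt0 // ltr_nat.
Qed.

Lemma node_le i j : (i <= j <= N.+1)%N -> node j <= node i.
Proof.
move=> /andP[ij jN]; have [->//|ne] := eqVneq i j.
by apply/ltW/node_lt; rewrite ltn_neqAle ne ij.
Qed.

(** The polynomial changes sign between consecutive nodes. The inequalities are strict because it
    does not vanish at the nodes, and this keeps roots from adjacent intervals distinct. *)
Lemma perturbed_cheb_root j : (j < N.+1)%N ->
  exists y, [/\ node j.+1 < y, y < node j & root P y].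
Proof.
move=> jN; have h1 := perturbed_cheb_sign (ltnW jN); have h2 := perturbed_cheb_sign jN.
have le : node j.+1 <= node j by rewrite node_le ?leqnSn.
have [y yin ry] : exists2 y, y \in `[node j.+1, node j] & root P y.
  have [s0|s1] := eqVneq ((-1) ^+ j : R) 1.
    have := @poly_ivt R (P) _ _ le; apply.
    rewrite s0 mul1r in h1; rewrite exprS s0 mulr1 mulN1r in h2.
    by rewrite -oppr_ge0 !ltW.
  have s0 : (-1) ^+ j = -1 :> R.
    have : ((-1) ^+ j == 1 :> R) || ((-1) ^+ j == -1 :> R).
      by rewrite -sqrf_eq1 sqrr_sign.
    by rewrite (negPf s1) => /eqP.
  have [|y yi] := @poly_ivt R (- P) _ _ le.
    rewrite s0 mulN1r in h1; rewrite exprS s0 mulN1r opprK mul1r in h2.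
    by rewrite !hornerN oppr_le0 !ltW.
  by rewrite rootN => ry; exists y.
exists y; move: yin; rewrite in_itv /= => /andP[y1 y2]; split=> //.
- rewrite lt_neqAle y1 andbT; apply: contraTneq h2 => e.
  by rewrite e (eqP ry) mulr0 ltxx.
- rewrite lt_neqAle y2 andbT; apply: contraTneq h1 => e.
  by rewrite -e (eqP ry) mulr0 ltxx.
Qed.

Lemma perturbed_cheb_roots : exists y : nat -> R,
  [/\ forall j, (j < N.+1)%N -> root P (y j),
      forall j, (j < N.+1)%N -> node j.+1 <= y j <= node j,
      {in iota 0 N.+1 &, injective y}
    & forall j, (j < N.+1)%N -> -1 <= y j <= 1].
Proof.
have /choice[y hy] : forall j, exists y, (j < N.+1)%N ->
    [/\ node j.+1 < y, y < node j & root P y].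
  by move=> j; have [/perturbed_cheb_root[y h]|_] := ltnP j N.+1; [exists y|exists 0].
exists y; split.
- by move=> j /hy[].
- by move=> j /hy[/ltW -> /ltW ->].
- have mono i j : (i < j < N.+1)%N -> y j < y i.
    move=> /andP[ij jN]; have [_ h1 _] := hy j jN.
    have [h2 _ _] := hy i (ltn_trans ij jN).
    by rewrite (lt_le_trans h1) // (le_trans _ (ltW h2)) // node_le // ij ltnW.
  move=> i j; rewrite !mem_iota !add0n /= => iN jN e.
  have [lt|lt|//] := ltngtP i j.
    by have := mono i j; rewrite lt jN e ltxx => /(_ isT).
  by have := mono j i; rewrite lt iN e ltxx => /(_ isT).
- move=> j /hy[h1 h2 _]; apply/andP; split.
    by apply: le_trans (ltW h1); exact: cos_geN1.
  by apply: le_trans (ltW h2) _; exact: cos_le1.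
Qed.

End ChebyshevRoots.

(** * The arcsine law *)

Section ArcsineLaw.
Variable R : realType.
Local Notation mu := (@lebesgue_measure R).
Implicit Types (g h H : R -> R).

(** Only [x] is confined to the segment. The radius is the parameter of the filter in the covering
    form of compactness. *)
Lemma uniform_continuity_segment g (e : R) : continuous g -> 0 < e ->
  exists2 d : R, 0 < d & forall x y, -1 <= x <= 1 -> `|x - y| < d -> `|g x - g y| < e.
Proof.
move=> cg e0.
have /compact_near_coveringP cK : compact `[(-1 : R), 1] := @segment_compact R (-1) 1.
have := cK R (at_right (0 : R)) (fun d x => forall y, `|x - y| < d -> `|g x - g y| < e) _.
case.
  move=> x _; have /cvgrPdist_lt/(_ _ (divr_gt0 e0 (ltr0n R 2)))/nbhs_ballP[d /= d0 hd] := cg x.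
  have d20 : 0 < d / 2 by rewrite divr_gt0.
  exists (ball x (d / 2), [set t | 0 < t < d / 2]); first split => /=.
  - exact: nbhsx_ballx.
  - by near=> t; apply/andP; split.
  move=> [x' t] /= [xx' /andP[t0 t2]] y x'y.
  have h1 : ball x d x'.
    by apply: le_ball xx'; rewrite ler_pdivrMr // ler_pMr // ler1n.
  have h2 : ball x d y.
    rewrite -ball_normE /= in xx' *; rewrite -(subrK x' x) -addrA.
    by rewrite (le_lt_trans (ler_normD _ _)) // (splitr d) ltrD // (lt_trans x'y).
  have := hd _ h1; have := hd _ h2 => /= a1 a2.
  have -> : g x' - g y = (g x - g y) - (g x - g x') by ring.
  by rewrite (le_lt_trans (ler_normB _ _)) // (splitr e) ltrD.
move=> d /= d0 hd; exists (d / 2); first by rewrite divr_gt0.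
move=> x y xK; apply: (hd (d / 2)) => //=.
- by rewrite sub0r normrN gtr0_norm ?divr_gt0 // ltr_pdivrMr // ltr_pMr // ltr1n.
- by rewrite divr_gt0.
Unshelve. all: by end_near.
Qed.

Lemma antiderivative h : continuous h ->
  exists H, forall t : R, -1 < t -> is_derive t 1 H (h t).
Proof.
(* Starting the integral at -1 instead of 0 gives a two-sided derivative at 0 as well. *)
move=> ch; exists (fun x => (\int[mu]_(t in `[(-1)%R, x]) h t)%R) => t t1.
have tt : t < t + 1 by rewrite ltrDl.
have ih : mu.-integrable `[(-1)%R, t + 1] (EFin \o h).
  apply: continuous_compact_integrable; first exact: segment_compact.
  exact: continuous_subspaceT.
have [d1 d2] := continuous_FTC1_closed tt ih t1 (ch t).
by apply: DeriveDef; [exact: d1|rewrite -derive1E; exact: d2].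
Qed.

Variables (H g : R -> R).
Hypothesis cg : continuous g.
Hypothesis dH : forall t : R, 0 <= t <= pi -> is_derive t 1 H (g (cos t)).

Definition arcsine_density (x : R) : R := g x / Num.sqrt (1 - x ^+ 2).

Lemma sqrt_1B_gt0 (x : R) : -1 < x < 1 -> 0 < Num.sqrt (1 - x ^+ 2).
Proof. by move=> /andP[x1 x2]; rewrite sqrtr_gt0; nra. Qed.

Lemma continuous_arcsine (x : R) : -1 < x < 1 -> {for x, continuous arcsine_density}.
Proof.
move=> x1; apply: cvgM; first exact: cg.
apply: cvgV; first by rewrite gt_eqF // sqrt_1B_gt0.
apply: continuous_comp; last exact: sqrt_continuous.
by apply: cvgB; [exact: cvg_cst|exact: exprn_continuous].
Qed.

Lemma acos_itv (x : R) : -1 < x < 1 -> 0 < acos x < pi.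
Proof.
by move=> /andP[x1 x2]; rewrite acos_gt0 ?ltW // acos_ltpi // x1 ltW.
Qed.

(** The substitution [x = cos t], phrased as an antiderivative of the arcsine density. *)
Lemma is_derive_H_acos (x : R) : -1 < x < 1 ->
  is_derive x 1 (fun x => - H (acos x)) (arcsine_density x).
Proof.
move=> x1; have /andP[a0 api] := acos_itv x1.
have da := is_derive1_acos x1.
have dHa : is_derive (acos x) 1 H (g (cos (acos x))).
  by apply: dH; rewrite !ltW.
have := is_derive1_comp dHa da.
rewrite acosK; last by rewrite in_itv /=; case/andP: x1 => x2 x3; rewrite !ltW.
move=> dc; have := is_deriveN dc.
by rewrite mulrN opprK.
Qed.

Lemma continuous_H_acos (x : R) : -1 < x < 1 ->
  {for x, continuous (fun x => - H (acos x))}.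
Proof.
move=> x1; apply: differentiable_continuous; apply/derivable1_diffP.
by have := is_derive_H_acos x1 => -[].
Qed.

Lemma arcsine_segment (a b : R) : -1 < a -> a < b -> b < 1 ->
  (\int[mu]_(x in `[a, b]) (arcsine_density x)%:E =
   (H (acos a) - H (acos b))%:E)%E.
Proof.
move=> a1 ab b1; have in1 x : x \in `[a, b] -> -1 < x < 1.
  by rewrite in_itv /= => /andP[ax xb]; rewrite (lt_le_trans a1 ax) (le_lt_trans xb b1).
have aI : -1 < a < 1 by rewrite a1 (lt_trans ab).
have bI : -1 < b < 1 by rewrite b1 (lt_trans a1).
rewrite (@continuous_FTC2 _ arcsine_density (fun x => - H (acos x)) a b) //.
- by rewrite -EFinB opprK addrC.
- by apply: continuous_in_subspaceT => x; rewrite inE => /in1; exact: continuous_arcsine.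
- split.
  + move=> x xab; have /in1 x1 : x \in `[a, b] by exact: subset_itv_oo_cc.
    by have := is_derive_H_acos x1 => -[].
  + by apply: cvg_at_right_filter; exact: continuous_H_acos.
  + by apply: cvg_at_left_filter; exact: continuous_H_acos.
- move=> x xab; have /in1 x1 : x \in `[a, b] by exact: subset_itv_oo_cc.
  by rewrite derive1E; have := is_derive_H_acos x1 => -[].
Qed.

Lemma measurable_arcsine_open : measurable_fun (`](-1), 1[%classic : set R) arcsine_density.
Proof.
apply: open_continuous_measurable_fun; first exact: interval_open.
by move=> x; rewrite inE /= in_itv /= => /continuous_arcsine.
Qed.

Lemma measurable_arcsine : measurable_fun (`[(-1), 1]%classic : set R) arcsine_density.
Proof.
apply/measurable_fun_itv_bndo_bndcP/measurable_fun_itv_obnd_cbndP.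
exact: measurable_arcsine_open.
Qed.

(** The open interval is exhausted by segments with end points [cos (delta k)] up to sign, on which
    [acos] takes the values [delta k] and [pi - delta k]. The shift by 2 keeps [delta k] strictly
    between 0 and 1, hence below [pi / 2]. *)
Let delta k : R := k.+2%:R^-1.

Lemma delta_itv k : 0 < delta k < 1.
Proof. by rewrite /delta invr_gt0 ltr0n /= invf_lt1 ?ltr0n // ltr1n. Qed.

Lemma cos_delta_itv k : 0 < cos (delta k) < 1.
Proof.
have /andP[d0 d1] := delta_itv k; have p2 := @pi_ge2 R.
rewrite cos_gt0_pihalf /=; last by lra.
by rewrite -cos0 ltr_cos // in_itv /=; lra.
Qed.

Lemma acos_cos_delta k : acos (cos (delta k)) = delta k /\
  acos (- cos (delta k)) = pi - delta k.
Proof.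
have /andP[d0 d1] := delta_itv k; have p2 := @pi_ge2 R.
have e : acos (cos (delta k)) = delta k by apply: cosK; rewrite in_itv /=; lra.
by split=> //; rewrite acosN ?e // cos_le1 cos_geN1.
Qed.

(** The density may blow up at both ends, so the fundamental theorem is applied on inner segments;
    positivity of [g] allows passing to the limit by monotone convergence. *)
Lemma arcsine_integral_ge0 : (forall x, -1 <= x <= 1 -> 0 <= g x) ->
  (\int[mu]_(x in `[(-1)%R, 1%R]) (arcsine_density x)%:E = (H pi - H 0)%:E)%E.
Proof.
move=> g0; pose A k : set R := `[- cos (delta k), cos (delta k)]%classic.
have f0 (x : R) : -1 <= x <= 1 -> 0 <= arcsine_density x.
  by move=> /g0 gx; rewrite divr_ge0 // sqrtr_ge0.
have Ain k (x : R) : A k x -> -1 < x < 1.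
  rewrite /A /= in_itv /= => /andP[h1 h2]; have /andP[c0 c1] := cos_delta_itv k.
  by rewrite (lt_le_trans _ h1) ?ltrN2 // (le_lt_trans h2).
pose D : set R := `](-1), 1[%classic.
have mf : measurable_fun D arcsine_density := measurable_arcsine_open.
have UA : \bigcup_k A k = D.
  apply/seteqP; split=> x.
    by move=> [k _ /Ain]; rewrite /D /= in_itv.
  rewrite /D /= in_itv /= => x1; have /andP[x2 x3] := x1.
  have /andP[a0 api] := acos_itv x1.
  have xc : x \in `[(-1), 1] by rewrite in_itv /= !ltW.
  pose e := Num.min (acos x) (pi - acos x).
  have e0 : 0 < e by rewrite lt_min a0 subr_gt0.
  have [k hk] : exists k, delta k < e.
    have [k _ hk] := near_infty_natSinv_lt (PosNum e0); exists k.
    exact: (hk k.+1 (leqnSn k)).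
  move: hk; rewrite lt_min => /andP[h1 h2].
  have /andP[d0 d1] := delta_itv k; have p2 := @pi_ge2 R.
  exists k => //; rewrite /A /= in_itv /= -(acosK xc).
  apply/andP; split.
    rewrite -cosN -cosDpi; apply: ltW; rewrite ltr_cos ?in_itv /=; lra.
  by apply: ltW; rewrite ltr_cos ?in_itv /=; lra.
rewrite integral_itv_bndoo; last exact/measurable_EFinP.
rewrite -/D -UA.
have cv : (\int[mu]_(x in A i) (arcsine_density x)%:E @[i --> \oo] -->
    \int[mu]_(x in \bigcup_i A i) (arcsine_density x)%:E)%E.
  apply: ge0_nondecreasing_set_cvg_integral.
  - apply/nondecreasing_seqP => k; rewrite subsetEset => x.
    have c : cos (delta k) <= cos (delta k.+1).
      have /andP[d0 d1] := delta_itv k; have /andP[d0' d1'] := delta_itv k.+1.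
      have p2 := @pi_ge2 R; apply: ltW.
      rewrite ltr_cos ?in_itv /=; [|lra|lra].
      by rewrite /delta ltf_pV2 ?posrE ?ltr0n // ltr_nat.
    rewrite /A /= !in_itv /= => /andP[h1 h2]; rewrite (le_trans h2) // andbT.
    by rewrite (le_trans _ h1) // lerN2.
  - by move=> k; exact: measurable_itv.
  - move=> k; apply/measurable_EFinP; apply: measurable_funS mf; first exact: measurable_itv.
    move=> x h; have := Ain k x h; rewrite /D /= in_itv; exact: id.
  - by move=> k x h; have /andP[x1 x2] := Ain k x h; rewrite lee_fin f0 // !ltW.
have intA k : (\int[mu]_(x in A k) (arcsine_density x)%:E =
    (H (pi - delta k) - H (delta k))%:E)%E.
  have /andP[c0 c1] := cos_delta_itv k.
  rewrite /A arcsine_segment; [|lra|lra|lra].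
  by have [-> ->] := acos_cos_delta k.
have cd : delta k @[k --> \oo] --> 0.
  by have := @cvg_harmonic R; rewrite -cvg_shiftS.
have cH t : 0 <= t <= pi -> {for t, continuous H}.
  move=> /dH d; apply: differentiable_continuous; apply/derivable1_diffP.
  by case: d.
have p0 : 0 <= (pi : R) by rewrite pi_ge0.
have c0 : H (delta k) @[k --> \oo] --> H 0.
  by apply: continuous_cvg cd; apply: cH; rewrite lexx.
have cpi : H (pi - delta k) @[k --> \oo] --> H pi.
  apply: continuous_cvg; first by apply: cH; rewrite lexx p0.
  by rewrite -[X in _ --> X]subr0; apply: cvgB; [exact: cvg_cst|exact: cd].
have cv' : (\int[mu]_(x in A i) (arcsine_density x)%:E @[i --> \oo] -->
    (H pi - H 0)%:E)%E.
  under eq_fun do rewrite intA.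
  by apply: cvg_EFin; [exact: nearW|exact: cvgB].
by apply: cvg_unique cv cv'.
Qed.

Lemma integrable_arcsine_ge0 : (forall x, -1 <= x <= 1 -> 0 <= g x) ->
  mu.-integrable `[-1, 1] (EFin \o arcsine_density).
Proof.
move=> g0; apply/integrableP; split; first by apply/measurable_EFinP; exact: measurable_arcsine.
under eq_integral => x.
  rewrite inE /= in_itv /= => x1.
  rewrite ger0_norm; last by rewrite divr_ge0 ?sqrtr_ge0 // g0.
  over.
by rewrite arcsine_integral_ge0 // ltry.
Qed.

End ArcsineLaw.

(** * Riemann sums for the arcsine law *)

Section ArcsineRiemann.
Variable R : realType.
Local Notation mu := (@lebesgue_measure R).
Implicit Types (g h H : R -> R).

(** On the segment [g] is bounded below, so adding a constant reduces to the nonnegative case. The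
    constant itself has antiderivative [t * M], and subtraction is legitimate because both densities
    are integrable. *)
Lemma arcsine_integral g H : continuous g ->
  (forall t : R, 0 <= t <= pi -> is_derive t 1 H (g (cos t))) ->
  \int[mu]_(x in `[(-1), 1]) (g x / Num.sqrt (1 - x ^+ 2)) = H pi - H 0.
Proof.
move=> cg dH.
have [c _ hc] : exists2 c, c \in `[(-1 : R), 1] & forall t, t \in `[(-1), 1] -> - g t <= - g c.
  apply: (@EVT_max R (fun t => - g t)); first by lra.
  by apply: continuous_subspaceT => x; apply: cvgN; exact: cg.
pose M := Num.max 0 (- g c).
have M0 : 0 <= M by rewrite le_max lexx.
have gM x : -1 <= x <= 1 -> 0 <= g x + M.
  move=> x1; rewrite -lerBlDr sub0r lerNl (le_trans (hc x _)) ?in_itv //.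
  by rewrite le_max lexx orbT.
have cg1 : continuous (fun x => g x + M).
  by move=> x; apply: cvgD; [exact: cg|exact: cvg_cst].
have cg2 : continuous (fun _ : R => M) by move=> x; exact: cst_continuous.
have dM (t : R) : is_derive t 1 (fun t => t * M) M.
  have := is_deriveM (is_derive_id t 1) (is_derive_cst M t 1).
  by rewrite /GRing.scale /= mulr0 add0r mulr1.
have dH1 t : 0 <= t <= pi -> is_derive t 1 (fun t => H t + t * M) (g (cos t) + M).
  by move=> /dH dt; have := is_deriveD dt (dM t).
have dH2 (t : R) : 0 <= t <= pi -> is_derive t 1 (fun t => t * M) M by [].
have I1 := integrable_arcsine_ge0 cg1 dH1 gM.
have I2 := integrable_arcsine_ge0 cg2 dH2 (fun _ _ => M0).
have E1 := arcsine_integral_ge0 cg1 dH1 gM.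
have E2 := arcsine_integral_ge0 cg2 dH2 (fun _ _ => M0).
transitivity (\int[mu]_(x in `[(-1), 1]) (arcsine_density (fun x => g x + M) x
   - arcsine_density (fun=> M) x)).
  by apply: eq_Rintegral => x _; rewrite -mulrBl addrK.
rewrite (@RintegralB _ _ _ mu _ _ _ (_ : measurable _) I1 I2); last exact: measurable_itv.
by rewrite /Rintegral E1 E2 /=; ring.
Qed.

(** By the mean value theorem for [H], the integral is exactly the sum of [g (cos (xi j))] with
    suitable tags, times the mesh. Replacing [cos (xi j)] by [y j] in the same interval costs at
    most [e] per term. *)
Lemma arcsine_riemann g (e : R) : continuous g -> 0 < e ->
  exists n0, forall N, (n0 <= N)%N -> forall y : nat -> R,
    (forall j, (j < N.+1)%N -> node R N j.+1 <= y j <= node R N j) ->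
  `|N.+1%:R^-1 * (\sum_(j < N.+1) g (y j)) -
    pi^-1 * \int[mu]_(x in `[(-1), 1]) (g x / Num.sqrt (1 - x ^+ 2))| <= e.
Proof.
move=> cg e0; have p0 := @pi_gt0 R.
have cgc : continuous (fun t => g (cos t)).
  by move=> t; apply: continuous_comp; [exact: continuous_cos|exact: cg].
have [H dH] := antiderivative cgc.
have dH' t : 0 <= t <= pi -> is_derive t 1 H (g (cos t)).
  by move=> /andP[t0 _]; apply: dH; apply: lt_le_trans t0; rewrite ltrN10.
have [d d0 hd] := uniform_continuity_segment cg e0.
(* This makes the mesh [pi / (N + 1)] smaller than the modulus of continuity [d]. *)
exists (Num.truncn (pi / d)) => N n0N y hy.
rewrite (arcsine_integral cg dH').
have n0 : 0 < N.+1%:R :> R by rewrite ltr0n.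
pose a j : R := j%:R * pi / N.+1%:R.
have aS j : a j.+1 - a j = pi / N.+1%:R.
  by rewrite /a -natr1; field.
have small : pi / N.+1%:R < d.
  rewrite ltr_pdivrMr // mulrC -ltr_pdivrMr //.
  apply: lt_le_trans (truncnS_gt _) _.
  by rewrite ler_nat ltnS.
have aI j : (j <= N.+1)%N -> 0 <= a j <= pi.
  move=> jN; apply/andP; split; rewrite /a.
    by rewrite divr_ge0 // mulr_ge0 // ltW.
  by rewrite ler_pdivrMr // mulrC ler_pM2l // ler_nat.
have /choice[xi hxi] : forall j, exists x : R, (j < N.+1)%N ->
    a j < x < a j.+1 /\ H (a j.+1) - H (a j) = g (cos x) * (pi / N.+1%:R).
  move=> j.
  have [jN|jN] := boolP (j < N.+1)%N; last by exists 0.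
  have [/andP[b0 _] /andP[_ b1]] := (aI j (ltnW jN), aI j.+1 jN).
  have ab : a j < a j.+1 by rewrite -subr_gt0 aS divr_gt0.
  have dj x : a j <= x <= a j.+1 -> is_derive x 1 H (g (cos x)).
    by move=> /andP[x1 x2]; apply: dH'; rewrite (le_trans b0 x1) (le_trans x2 b1).
  have [|//|x xj ex] := @MVT R H (fun t => g (cos t)) (a j) (a j.+1) ab.
  - by move=> x; rewrite in_itv /= => /andP[x1 x2]; apply: dj; rewrite !ltW.
  - apply: derivable_within_continuous => x; rewrite in_itv /= => /dj.
    by case.
  by exists x => _; rewrite in_itv /= in xj; rewrite ex aS.
have tel : H pi - H 0 = (\sum_(j < N.+1) g (cos (xi j))) * (pi / N.+1%:R).
  have aN : a N.+1 = pi by rewrite /a mulrC mulrA mulVf ?mul1r // gt_eqF.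
  have a0 : a 0%N = 0 by rewrite /a mul0r mul0r.
  have -> : H pi - H 0 = H (a N.+1) - H (a 0%N) by rewrite aN a0.
  rewrite -(telescope_sumr (fun j => H (a j))) // big_mkord big_distrl /=.
  by apply: eq_bigr => j _; have [] := hxi j (ltn_ord j).
have -> : N.+1%:R^-1 * (\sum_(j < N.+1) g (y j)) - pi^-1 * (H pi - H 0) =
    N.+1%:R^-1 * \sum_(j < N.+1) (g (y j) - g (cos (xi j))).
  by rewrite tel sumrB mulrBr [_ * (pi / _)]mulrC !mulrA mulVf ?mul1r // gt_eqF.
rewrite normrM gtr0_norm ?invr_gt0 // mulrC ler_pdivrMr //.
apply: le_trans (ler_norm_sum _ _ _) _.
apply: (@le_trans _ _ (\sum_(j < N.+1) e)); last first.
  by rewrite sumr_const card_ord mulr_natr.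
apply: ler_sum => j _.
have jN := ltn_ord j; have [/andP[x1 x2] _] := hxi j jN.
have [/andP[b0 b0'] /andP[b1' b1]] := (aI j (ltnW jN), aI j.+1 jN).
have /andP[y1 y2] := hy j jN.
have cx : cos (a j.+1) <= cos (xi j) <= cos (a j).
  by apply/andP; split; apply: ltW; rewrite ltr_cos ?in_itv /=; lra.
apply: ltW; rewrite distrC; apply: hd; first by rewrite cos_geN1 cos_le1.
apply: le_lt_trans small.
(* Both points lie between two consecutive nodes, whose distance is at most the mesh because the
   derivative of the cosine is bounded by 1. *)
apply: (@le_trans _ _ (cos (a j) - cos (a j.+1))).
  rewrite /node in y1 y2; rewrite -/(a j) -/(a j.+1) in y1 y2.
  have /andP[c1 c2] := cx.
  by rewrite ler_norml; lra.
have ab : a j < a j.+1 by rewrite -subr_gt0 aS divr_gt0.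
have [|x xj ex] := @MVT R cos (fun t => - sin t) (a j) (a j.+1) ab.
  by apply: continuous_subspaceT => ?; exact: continuous_cos.
rewrite -opprB ex mulNr opprK aS ler_piMl ?sin_le1 //.
by rewrite divr_ge0 // ltW.
Qed.

End ArcsineRiemann.

(** * Spectra *)

Section Spectrum.
Variable R : realType.
Local Notation C := R[i].

(** With [q = S^2] and [x = 2 S y], dividing the coordinate of index [k] by [S^k] turns the
    recurrence into the Chebyshev one. *)
Lemma jacobi_vec_cheb (q : nat) (S y : R) k : S ^+ 2 = q%:R ->
  jacobi_vec (q%:R : C) (2 * S * y)%:C%C k = (S ^+ k * (cheb R k).[y])%:C%C /\
  (q%:R : C) * (if k is j.+1 then jacobi_vec (q%:R : C) (2 * S * y)%:C%C j else 0)
    = (S ^+ k.+1 * (cheb_pred R k).[y])%:C%C.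
Proof.
move=> hS; have qE : (q%:R : C) = (S ^+ 2)%:C%C by rewrite hS rmorph_nat.
elim: k => [|k [IH1 IH2]].
  by rewrite /= mulr0 hornerC horner0 mulr0 expr0 mulr1.
split; last first.
  by rewrite IH1 qE -rmorphM mulrA -exprD.
rewrite chebS /= -/(jacobi_vec _ _) IH1 IH2 -rmorphM -rmorphB; congr (_%:C%C).
by rewrite !hornerE !exprS /=; ring.
Qed.

Lemma jacobi_eigenvalue_cheb (V : lmodType C) (W : set V) (T : V -> V) N (q : nat)
    (S a b y : R) l e :
  S ^+ 2 = q%:R ->
  jacobi W T N.+1 q%:R (S * a)%:C%C (S ^+ 2 * b)%:C%C l e ->
  root (perturbed_cheb a b N) y -> eigenvalues_on W T (2 * S * y)%:C%C.
Proof.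
move=> hS J /rootP; rewrite /perturbed_cheb !hornerE => r.
apply: (jacobi_eigenvalue J erefl).
have [E1 E2] := jacobi_vec_cheb y N hS.
have [qE rq] : (q%:R : C) = (S ^+ 2)%:C%C /\ (S ^+ 2 * b)%:C%C = b%:C%C * q%:R :> C.
  have qE : (q%:R : C) = (S ^+ 2)%:C%C by rewrite hS rmorph_nat.
  by split=> //; rewrite qE -rmorphM mulrC.
rewrite rq -(mulrA b%:C%C) E2 E1 -rmorphB -!rmorphM; congr (_%:C%C).
rewrite exprS; apply/eqP; rewrite -subr_eq0; apply/eqP.
(* The two sides of the last equation differ by [S^(N+1)] times the perturbed polynomial at [y]. *)
rewrite -[RHS](mulr0 (S * S ^+ N)) -r; ring.
Qed.

Variables (F : localField) (psi : F -> C) (pi : F).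
Hypothesis charF : (2%:R : F) != 0.
Hypothesis psi_char : additive_character psi.
Hypothesis pi_unif : is_uniformizer pi.

Lemma Hecke_spectrum m chi : admissible pi psi m chi ->
  let S : R := Num.sqrt (residue_card F)%:R in
  exists n (y : nat -> R), let s := [seq (2 * S * y j)%:C%C | j <- iota 0 n] in
  [/\ uniq s,
      Lambda pi psi m chi = [set` s],
      forall x, x \in s -> alg_multiplicity (VrepK psi m chi) (Hecke pi 0) x = 1%N,
      dimension (VrepK psi m chi) = n
    & forall j, (j < n)%N -> -1 <= y j <= 1 /\ node R n.-1 j.+1 <= y j <= node R n.-1 j].
Proof.
move=> [[m0 trm] chi_char fd _ hb] S.
have [n [al [be [l [e [be0 ale J]]]]]] :=
  VrepK_jacobi charF psi_char pi_unif m0 trm chi_char fd hb.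
have q0 : 0 < (residue_card F)%:R :> R.
  by rewrite ltr0n; apply: ltnW; exact: residue_card_gt1.
have S0 : 0 < S by rewrite sqrtr_gt0.
have hS : S ^+ 2 = (residue_card F)%:R by rewrite sqr_sqrtr // ltW.
case: n J => [|N] J.
  exists 0%N, (fun=> 0) => s.
  by have [] := jacobi_spectrum J (s := [::]).
(* Divided by [q = S^2], the bound [|al| S <= 2 q - be] becomes [|a| <= 2 - b]. *)
pose a := al / S; pose b := be / S ^+ 2.
have alE : al = S * a by rewrite /a mulrC divfK // gt_eqF.
have beE : be = S ^+ 2 * b by rewrite /b mulrC divfK // expf_neq0 // gt_eqF.
have b0 : 0 < b by rewrite divr_gt0 // exprn_gt0.
have ab : `|a| <= 2 - b.
  rewrite /a normrM normfV (gtr0_norm S0) ler_pdivrMr //.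
  rewrite -(ler_pM2r S0); apply: le_trans ale _.
  by rewrite -hS beE le_eqVlt; apply/orP; left; apply/eqP; ring.
have [y [ry ny yi y1]] := perturbed_cheb_roots N b0 ab.
exists N.+1, y => s.
have us : uniq s.
  rewrite map_inj_in_uniq ?iota_uniq // => i j hi hj [] /(mulfI _) h.
  by apply: yi => //; apply: h; rewrite mulf_neq0 ?pnatr_eq0 // gt_eqF.
rewrite alE beE in J.
have ev x : x \in s -> eigenvalues_on (VrepK psi m chi) (Hecke pi 0) x.
  move=> /mapP[j]; rewrite mem_iota add0n /= => jN ->.
  exact: jacobi_eigenvalue_cheb hS J (ry j jN).
have [E1 E2 E3] := jacobi_spectrum J us (etrans (size_map _ _) (size_iota _ _)) ev.
by split=> // j jN; split; [exact: y1|exact: ny].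
Qed.

End Spectrum.

(** * Convergence of complex values through real and imaginary parts *)

Section ComplexConvergence.
Variable R : realType.
Local Notation C := R[i].

Lemma normc_le (x y : R) : `|Complex x y| <= (`|x| + `|y|)%:C%C.
Proof.
rewrite normc_def lecR /=.
have h : 0 <= `|x| + `|y| by rewrite addr_ge0.
rewrite -(ger0_norm h) -sqrtr_sqr ler_wsqrtr // sqrrD !real_normK ?num_real //.
by rewrite lerD2r lerDl mulrn_wge0 // mulr_ge0.
Qed.

Lemma sum_Complex (I : Type) (s : seq I) (z : I -> C) :
  \sum_(i <- s) z i = Complex (\sum_(i <- s) complex.Re (z i))
                              (\sum_(i <- s) complex.Im (z i)).
Proof.
elim: s => [|i s IH]; first by rewrite !big_nil.
by rewrite !big_cons IH; case: (z i).
Qed.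

Lemma scale_Complex (c x y : R) : c%:C%C * Complex x y = Complex (c * x) (c * y) :> C.
Proof. by rewrite /GRing.mul /= !mul0r subr0 addr0. Qed.

Lemma cvg_Complex (u v : nat -> R) (a b : R) :
  (forall e : R, 0 < e -> \forall k \near \oo, `|u k - a| <= e) ->
  (forall e : R, 0 < e -> \forall k \near \oo, `|v k - b| <= e) ->
  (Complex (u k) (v k) : C^o) @[k --> \oo] --> (Complex a b : C^o).
Proof.
(* The tolerance is a positive element of [R[i]], which forces its imaginary part to be zero. *)
move=> hu hv; apply/cvgrPdist_le => -[e e'] /=; rewrite ltcE /= => /andP[/eqP -> e0].
have e2 : 0 < e / 2 by rewrite divr_gt0.
near=> k; rewrite distrC.
have hk : `|u k - a| <= e / 2 by near: k; exact: hu.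
have hk' : `|v k - b| <= e / 2 by near: k; exact: hv.
apply: le_trans (normc_le (u k - a) (v k - b)) _.
by rewrite -[Complex e 0]/(e%:C%C) lecR [e]splitr lerD.
Unshelve. all: by end_near.
Qed.

(** The imaginary part of [z] is the real part of [- i z], so one estimate for [Re (f x * c)] with
    [|c| = 1] serves both. *)
Lemma continuous_ReIm (f : R -> C^o) : continuous f ->
  continuous (fun x => complex.Re (f x)) /\ continuous (fun x => complex.Im (f x)).
Proof.
have ImRe (z : C) : complex.Im z = complex.Re (z * (- 'i%C)).
  by case: z => a b; rewrite /=; ring.
have key (c : C) : `|c| = 1 -> continuous f -> continuous (fun x => complex.Re (f x * c)).
  move=> c1 cf x; apply/cvgrPdist_le => e e0.
  have /cvgrPdist_le/(_ e%:C%C) := cf x; rewrite ltcR => /(_ e0).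
  apply: filterS => y /= h.
  rewrite -lecR; apply: le_trans h.
  rewrite -(mulr1 `|f x - f y|) -c1 -normrM mulrBl; apply: le_trans (normc_ge_Re _).
  by rewrite lecR; case: (f x * c) => a b; case: (f y * c) => a' b'.
move=> cf; split.
  have := key 1 (normr1 _) cf.
  by under eq_fun do rewrite mulr1.
under eq_fun do rewrite ImRe.
by apply: key cf; rewrite normrN normc_def /= expr0n add0r expr1n sqrtr1.
Qed.

End ComplexConvergence.

Theorem proposition5p1 (R : realType) (F : localField)
    (charF : (2%:R : F) != 0)
    (varpi : F) (varpi_unif : is_uniformizer varpi)
    (psi : F -> R[i]) (psi_char : additive_character psi) :
  let sqrtq : R := Num.sqrt (residue_card F)%:R in
  (forall (m : 'M[F]_2) (chi : G F -> R[i]),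
     admissible varpi psi m chi ->
     forall l : R[i], Lambda varpi psi m chi l ->
       [/\ alg_multiplicity (VrepK psi m chi) (Hecke varpi 0) l = 1%N,
           complex.Im l = 0
         & - (2 * sqrtq) <= complex.Re l <= 2 * sqrtq])
  /\
  (forall (m : nat -> 'M[F]_2) (chi : nat -> G F -> R[i]),
     (forall n, admissible varpi psi (m n) (chi n)) ->
     dimension (VrepK psi (m n) (chi n)) @[n --> \oo] --> \oo ->
     forall f : R -> R[i]^o, Cc f ->
       ((#|` fset_set (Lambda varpi psi (m n) (chi n))|%:R)^-1 *
          \sum_(l \in Lambda varpi psi (m n) (chi n))
             f (complex.Re l / (2 * sqrtq)) : R[i]^o) @[n --> \oo]
       --> ((pi^-1)%:C%C *
            complex_integral `[-1, 1]
              (fun x : R => f x / (Num.sqrt (1 - x ^+ 2))%:C%C) : R[i]^o)).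
Proof.
move=> sqrtq.
have q0 : 0 < sqrtq.
  by rewrite sqrtr_gt0 ltr0n; apply: ltnW; exact: residue_card_gt1.
split=> [m chi adm l Ll|m chi adm dimoo f [cf _]].
  have [n [y [_ EL mult _ hy]]] := Hecke_spectrum charF psi_char varpi_unif adm.
  move: Ll; rewrite EL /= => ls; split; first exact: mult.
  - by have /mapP[j _ ->] := ls.
  - have /mapP[j] := ls; rewrite mem_iota add0n /= => jn ->.
    have [/andP[y1 y2] _] := hy j jn.
    by rewrite /= -/sqrtq; apply/andP; split; nra.
have /choice[ny hny] : forall k, exists ny : nat * (nat -> R),
    [/\ (#|` fset_set (Lambda varpi psi (m k) (chi k))|%:R)^-1 *
          \sum_(l \in Lambda varpi psi (m k) (chi k)) f (complex.Re l / (2 * sqrtq)) =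
        Complex (ny.1%:R^-1 * \sum_(j < ny.1) complex.Re (f (ny.2 j)))
                (ny.1%:R^-1 * \sum_(j < ny.1) complex.Im (f (ny.2 j))),
      dimension (VrepK psi (m k) (chi k)) = ny.1
    & forall j, (j < ny.1)%N -> node R ny.1.-1 j.+1 <= ny.2 j <= node R ny.1.-1 j].
  move=> k.
  have [n [y [us EL _ dE hy]]] := Hecke_spectrum charF psi_char varpi_unif (adm k).
  exists (n, y); split=> //=; last by move=> j /hy[].
  rewrite EL -fsbig_seq // big_map -/sqrtq.
  set s := map _ _ in us *.
  have -> : fset_set [set` s] = [fset x in s]%fset.
    by apply/fsetP => x; rewrite in_fset_set ?mem_setE ?inE; last exact: finite_seq.
  rewrite card_fseq undup_id // size_map size_iota.
  have -> : iota 0 n = index_iota 0 n by rewrite /index_iota subn0.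
  rewrite big_mkord.
  have fE j : f (complex.Re (2 * sqrtq * y j)%:C%C / (2 * sqrtq)) = f (y j).
    by rewrite /= mulrAC divff ?mul1r // mulf_neq0 // gt_eqF.
  rewrite (eq_bigr (fun j : 'I_n => f (y j)) (fun j _ => fE j)).
  rewrite sum_Complex -scale_Complex; congr (_ * _).
  by rewrite fmorphV rmorph_nat.
under eq_fun => k do have [-> _ _] := hny k.
have [cR cI] := continuous_ReIm cf.
have conv (g : R -> R) : continuous g -> forall e : R, 0 < e -> \forall k \near \oo,
    `|(ny k).1%:R^-1 * (\sum_(j < (ny k).1) g ((ny k).2 j)) -
    pi^-1 * \int[lebesgue_measure]_(x in `[(-1), 1]) (g x / Num.sqrt (1 - x ^+ 2))| <= e.
  move=> cg e e0; have [n0 hn0] := arcsine_riemann cg e0.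
  (* The threshold [n0.+1] excludes dimension 0 and matches the shift by one between the dimension
     and the index [N] of the nodes. *)
  have : \forall k \near \oo, (n0.+1 <= dimension (VrepK psi (m k) (chi k)))%N.
    exact: dimoo _ (nbhs_infty_ge n0.+1).
  apply: filterS => k hk.
  have [_ dE hy] := hny k; rewrite dE in hk.
  case: (ny k) hk hy => -[|N] y //= n0N hy.
  exact: hn0.
pose I (g : R -> R) :=
  \int[lebesgue_measure]_(x in `[(-1), 1]) (g x / Num.sqrt (1 - x ^+ 2)).
have -> : (pi^-1)%:C%C * complex_integral `[-1, 1]
      (fun x : R => f x / (Num.sqrt (1 - x ^+ 2))%:C%C) =
    Complex (pi^-1 * I (fun x => complex.Re (f x)))
            (pi^-1 * I (fun x => complex.Im (f x))) :> R[i].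
  have fE (x c : R) : f x / c%:C%C =
      Complex (complex.Re (f x) / c) (complex.Im (f x) / c) :> R[i].
    rewrite -fmorphV mulrC; case: (f x) => a b.
    by rewrite scale_Complex /= mulrC [c^-1 * b]mulrC.
  rewrite scale_Complex; congr (Complex (_ * _) (_ * _)).
    by apply: eq_Rintegral => x _; rewrite fE.
  by apply: eq_Rintegral => x _; rewrite fE.
by apply: cvg_Complex; exact: conv.
Qed.
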